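(* Let $\alpha\in(0,1)$, $d_1,d_2>0$ and $c_1,c_2\in\mathbb{R}$. Consider the system $$u_t=d_1u_{xx}+c_1u_x+v^2,\qquad v_t=d_2v_{xx}+c_2v_x+u^2,\qquad t\ge 0,\ x\in\mathbb{R}. \quad ( * )$$ Let $(u_0,v_0)\in C^{0,\alpha}(\mathbb{R},\mathbb{R}^2)\setminus\{0\}$ be such that $u_0(x),v_0(x)\ge 0$ for all $x\in\mathbb{R}$. Then there exists $c>0$ such that the classical solution $(u,v)$ of $( * )$ with initial condition $(u_0,v_0)$ satisfies $$\|(u,v)(\cdot,t)\|_\infty\ge c\log(1+t),\qquad \|(u,v)(\cdot,t)\|_1\ge ct,\qquad t\in[0,T),$$ where $[0,T)$, with $T\in(0,\infty]$, is its maximal interval of existence. In particular, the homogeneous rest state $(0,0)$ of $( * )$ is nonlinearly unstable against small, exponentially localized perturbations from $X^\alpha_{\rho_E}$, where $\rho_E(x)=e^{x^2/M}$ and $M\ge 1$.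
   Context: Function spaces. $C^{0,\alpha}(\mathbb{R},\mathbb{R}^2)$ is the space of bounded, globally $\alpha$-H\''older continuous functions $\mathbb{R}\to\mathbb{R}^2$. For a weight $\rho:\mathbb{R}\to[1,\infty)$, $X^\alpha_\rho:=\{z\in C^{0,\alpha}(\mathbb{R},\mathbb{R}^2):\|z\rho\|_\infty<\infty\}$ with norm $\|z\|_\rho:=\|z\rho\|_\infty$. Here $\|\cdot\|_\infty$ is the supremum norm and $\|\cdot\|_1$ the $L^1(\mathbb{R})$-norm (of the Euclidean length, for vector-valued functions; possibly $+\infty$). Classical solution. For $T\in(0,\infty]$, a classical solution on $[0,T)$ with initial condition $(u_0,v_0)$ is a map $(u,v):\mathbb{R}\times[0,T)\to\mathbb{R}^2$ with $(u,v)(\cdot,0)=(u_0,v_0)$ such that: $t\mapsto(u,v)(\cdot,t)$ is continuous from $[0,T)$ into the bounded continuous functions with the supremum norm; on $\mathbb{R}\times(0,T)$ the derivatives $\partial_t,\partial_x,\partial_{xx}$ of $u,v$ exist, are continuous, and the equations hold pointwise; and for all $0<\tau<T'<T$ the functions $u,v$ and their derivatives $\partial_x,\partial_{xx},\partial_t$ are bounded on $\mathbb{R}\times[\tau,T']$, with $\partial_{xx}$ and $\partial_t$ of $u,v$ being $\alpha$-H\''older continuous in $x$ and $\frac{\alpha}{2}$-H\''older continuous in $t$ uniformly on $\mathbb{R}\times[\tau,T']$. The interval $[0,T)$ is the maximal interval of existence if the solution cannot be extended to a classical solution on $[0,T')$ for any $T'>T$. Instability. Nonlinear instability of $(0,0)$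 against perturbations from $X^\alpha_{\rho_E}$ means failure of stability: there is $\epsilon>0$ such that for every $\delta>0$ there is an initial condition in $X^\alpha_{\rho_E}$ with $\|\cdot\|_{\rho_E}$-norm less than $\delta$ whose maximal classical solution is either not global or has supremum norm exceeding $\epsilon$ at some time. *)

(* Defs.v *)
From HB Require Import structures.
From mathcomp Require Import all_boot all_order all_algebra.
From mathcomp Require Import all_classical all_reals all_analysis.

Set Implicit Arguments.
Unset Strict Implicit.
Unset Printing Implicit Defensive.

Import Order.TTheory GRing.Theory Num.Theory.
Import numFieldNormedType.Exports.

Local Open Scope classical_set_scope.
Local Open Scope ring_scope.

(* The canonical norm of [R * R] is the maximum norm, so the Euclidean length
   is introduced separately. *)
Definition euclid (R : realType) (p : R * R) : R :=
  Num.sqrt (p.1 ^+ 2 + p.2 ^+ 2).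

Definition sup_norm (R : realType) (z : R -> R * R) : \bar R :=
  ereal_sup [set (euclid (z x))%:E | x in [set: R]].

Definition L1_norm (R : realType) (z : R -> R * R) : \bar R :=
  Lnorm (@lebesgue_measure R) 1%E (fun x => (euclid (z x))%:E).

Definition weighted_norm (R : realType) (rho : R -> R) (z : R -> R * R)
    : \bar R :=
  ereal_sup [set (euclid (z x) * rho x)%:E | x in [set: R]].

Definition holder_space (R : realType) (alpha : R) (z : R -> R * R) : Prop :=
  (sup_norm z < +oo)%E /\
  exists C : R, forall x y : R, euclid (z x - z y) <= C * `|x - y| `^ alpha.

Definition weighted_space (R : realType) (alpha : R) (rho : R -> R)
    (z : R -> R * R) : Prop :=
  holder_space alpha z /\ (weighted_norm rho z < +oo)%E.

Definition gaussian_weight (R : realType) (M : R) (x : R) : R :=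
  expR (x ^+ 2 / M).

(* A scalar function on space-time is written [f x t], space variable first. *)
Section space_time.
Context {R : realType}.
Implicit Types (f u v : R -> R -> R) (T : \bar R) (alpha : R).

Definition dt f (x t : R) : R := derive1 (f x) t.
Definition dx f (x t : R) : R := derive1 (f^~ t) x.
Definition dxx f : R -> R -> R := dx (dx f).

Definition time_interval T : set R := [set t | 0 <= t /\ (t%:E < T)%E].

Definition slice u v (t : R) : R -> R * R := fun x => (u x t, v x t).

(* [t |-> (u, v)(., t)] is continuous from [0, T) into the bounded continuous
   functions with the supremum norm. *)
Definition sup_norm_continuous T u v : Prop :=
  (forall t, time_interval T t ->
     continuous (slice u v t) /\ (sup_norm (slice u v t) < +oo)%E) /\
  (forall t0, time_interval T t0 ->
     sup_norm (slice u v t - slice u v t0)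
       @[t --> within (time_interval T) (nbhs t0)] --> (0%E : \bar R)).

Definition C21 T f : Prop :=
  forall x t : R, 0 < t -> (t%:E < T)%E ->
  [/\ derivable (f x) t 1, derivable (f^~ t) x 1 & derivable ((dx f)^~ t) x 1]
  /\
  [/\ {for (x, t), continuous (fun p : R * R => dt f p.1 p.2)},
      {for (x, t), continuous (fun p : R * R => dx f p.1 p.2)} &
      {for (x, t), continuous (fun p : R * R => dxx f p.1 p.2)}].

Definition bounded_on_slab (tau T' : R) f : Prop :=
  exists C : R, forall x t : R, tau <= t <= T' -> `|f x t| <= C.

Definition holder_on_slab alpha (tau T' : R) f : Prop :=
  (exists C : R, forall x y t : R, tau <= t <= T' ->
     `|f x t - f y t| <= C * `|x - y| `^ alpha) /\
  (exists C : R, forall x s t : R, tau <= s <= T' -> tau <= t <= T' ->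
     `|f x s - f x t| <= C * `|s - t| `^ (alpha / 2)).

Definition interior_regular alpha T f : Prop :=
  forall tau T' : R, 0 < tau -> tau < T' -> (T'%:E < T)%E ->
  [/\ bounded_on_slab tau T' f, bounded_on_slab tau T' (dx f),
      bounded_on_slab tau T' (dxx f) & bounded_on_slab tau T' (dt f)] /\
  (holder_on_slab alpha tau T' (dxx f) /\ holder_on_slab alpha tau T' (dt f)).

(* The values of [u] and [v] at times outside [0, T) are irrelevant. *)
Definition classical_solution (alpha d1 d2 c1 c2 : R) (z0 : R -> R * R)
    T u v : Prop :=
  (0 < T)%E /\ slice u v 0 = z0 /\ sup_norm_continuous T u v /\
  (C21 T u /\ C21 T v) /\
  (forall x t : R, 0 < t -> (t%:E < T)%E ->
     dt u x t = d1 * dxx u x t + c1 * dx u x t + v x t ^+ 2 /\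
     dt v x t = d2 * dxx v x t + c2 * dx v x t + u x t ^+ 2) /\
  (interior_regular alpha T u /\ interior_regular alpha T v).

Definition maximal_classical_solution (alpha d1 d2 c1 c2 : R)
    (z0 : R -> R * R) T u v : Prop :=
  classical_solution alpha d1 d2 c1 c2 z0 T u v /\
  ~ exists (T' : \bar R) (u' v' : R -> R -> R),
      [/\ (T < T')%E, classical_solution alpha d1 d2 c1 c2 z0 T' u' v' &
          forall t, time_interval T t -> slice u' v' t = slice u v t].

Definition nonlinearly_unstable (alpha d1 d2 c1 c2 : R) (rho : R -> R)
    : Prop :=
  exists2 eps : R, 0 < eps & forall delta : R, 0 < delta ->
  exists z0 : R -> R * R,
    [/\ weighted_space alpha rho z0, (weighted_norm rho z0 < delta%:E)%E &
        exists (T : \bar R) (u v : R -> R -> R),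
          maximal_classical_solution alpha d1 d2 c1 c2 z0 T u v /\
          ((T < +oo)%E \/
           exists2 t, time_interval T t & (eps%:E < sup_norm (slice u v t))%E)].

End space_time.

(* Main.v *)
Require Import Defs.
From HB Require Import structures.
From mathcomp Require Import all_boot all_order all_algebra.
From mathcomp Require Import all_classical all_reals all_analysis.
From mathcomp Require Import ring lra measurable_realfun.
Import Order.TTheory GRing.Theory Num.Theory.
Import numFieldNormedType.Exports.
Local Open Scope classical_set_scope.
Local Open Scope ring_scope.

(** Growth. By the maximum principle u and v dominate every bounded
    subsolution, and two kinds of explicit subsolutions suffice: differences of
    error functions (heat flow of a box, which decays like t^(-1/2)) and
    parabolas a(t) (1 - z^2 / L^2) moving with the drift (gain produced by a
    source). Suppose u_0 is bounded below by a
    positive constant on an interval. In the frame y = x - x_0 + c_1 t the heat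
    flow gives u >= k t^(-1/2) for |y| <= l sqrt t, so v has a source of size
    1/t there. If c_1 <> c_2, a window of v stays over this region for a time
    of order sqrt t, gains t^(-1/2), and is then carried away at relative speed
    c_2 - c_1; hence v >= k t^(-1/2) on an interval of length of order t
    starting at y = 0. The source v^2 >= k/t of u on this long interval gives
    mass k t, and at a fixed y the integral of k/s produces log t. If
    c_1 = c_2, then v >= k and u >= k t on |y| <= l sqrt t.

    Instability. The initial condition is a small Gaussian, all derivatives of
    which are bounded. For such data a local solution is the limit of an
    explicit Euler scheme in which the diffusion step is the average of two
    translates: the scheme commutes with space derivatives, so the derivatives
    up to order six stay bounded for a short time, and halving the time step
    changes the scheme by O(tau^2) per step. A maximal extension exists by
    Zorn's lemma; by the growth estimate it is not global or exceeds 1. *)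

Set Implicit Arguments.
Unset Strict Implicit.
Unset Printing Implicit Defensive.

(** * One-variable calculus *)

Section calculus.
Context {R : realType}.
Implicit Types (f g : R -> R) (x y z h d e : R).

(** Uniqueness of classical solutions is not established, so no constant may depend on the solution:
    every growth constant is fixed by the coefficients and the initial data before [T], [u] and [v]
    appear. The estimate then applies to whichever maximal solution Zorn's lemma produces. The
    sources are squares, hence nonnegative whatever the sign of their argument. This decouples the
    comparison: each component is a supersolution of a scalar linear equation whose source is
    already bounded below. A subsolution has to satisfy its inequality only where it is positive,
    because the component it is compared with is nonnegative; parabolas can therefore be used
    without any cut-off. The order six of the derivative bounds is 2 + 4: the limit is controlled
    together with two space derivatives, and the consistency error of the averaged step costs four
    more. Defects of size [tau^2] over about [1 / tau] steps add up to [O(tau)], which is summable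
    along [tau = 2^-m]; so the dyadic approximations converge with an explicit rate and all
    estimates pass to the limit as inequalities. *)

Lemma is_derive_expansion f x d : is_derive x 1 f d ->
  forall e, 0 < e -> exists2 r, 0 < r &
    forall h, `|h| < r -> `|f (x + h) - f x - h * d| <= e * `|h|.
Proof.
move=> [df dE] e e0.
have /cvgrPdist_le/(_ e e0) : h^-1 *: (f (h *: 1 + x) - f x) @[h --> 0^'] --> d.
  by rewrite -dE; exact: df.
rewrite /= near_withinE => /nbhs_ballP[r r0 rP]; exists r => // h hr.
have [->|h0] := eqVneq h 0; first by rewrite addr0 subrr mul0r subrr normr0 mulr0.
have /= := rP h _ h0; rewrite -ball_normE/= sub0r normrN => /(_ hr).
rewrite /GRing.scale/= mulr1 (addrC h) => /(ler_wpM2r (normr_ge0 h)).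
rewrite -normrM mulrBl mulrAC mulVf// mul1r distrC.
by rewrite (mulrC d).
Qed.

(** Being free of division and valid at [h = 0], this criterion lets the limit of the scheme be
    differentiated directly from its quadratic remainder bounds. *)
Lemma expansion_is_derive f x d :
  (forall e, 0 < e -> exists2 r, 0 < r &
    forall h, `|h| < r -> `|f (x + h) - f x - h * d| <= e * `|h|) ->
  is_derive x 1 f d.
Proof.
move=> H.
have cv : h^-1 *: (f (h *: 1 + x) - f x) @[h --> 0^'] --> d.
  apply/cvgrPdist_le => /= e e0; have [r r0 rP] := H e e0.
  rewrite near_withinE; apply/nbhs_ballP; exists r => //= h.
  rewrite -ball_normE/= sub0r normrN => hr h0.
  have hn : 0 < `|h| by rewrite normr_gt0.
  rewrite -(ler_pM2r hn) -normrM mulrBl /GRing.scale/= mulrAC mulVf// mul1r.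
  rewrite distrC mulr1 (addrC h) (mulrC d).
  exact: rP.
by apply: DeriveDef; [apply/cvg_ex; exists d|exact: cvg_lim cv].
Qed.

Lemma is_derive_continuous f x d : is_derive x 1 f d -> {for x, continuous f}.
Proof. by move=> [df _]; exact/differentiable_continuous/derivable1_diffP. Qed.

Lemma is_derive_compose f g x d e : is_derive (g x) 1 f d ->
  is_derive x 1 g e -> is_derive x 1 (fun y => f (g y)) (d * e).
Proof. exact: is_derive1_comp. Qed.

Lemma is_derive_min f x d r : 0 < r -> is_derive x 1 f d ->
  (forall h, `|h| < r -> f x <= f (x + h)) -> d = 0.
Proof.
move=> r0 fd fm; apply/eqP/negP => /negP d0.
have dp : 0 < `|d| / 2 by rewrite divr_gt0// normr_gt0.
have [q q0 qP] := is_derive_expansion fd dp.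
have m0 : 0 < Num.min q r / 2 by rewrite divr_gt0// lt_min q0.
(* A step against the sign of [d] changes [f] by [- |d| |h|] to first order, and an error of at most
   half that size cannot undo the decrease. *)
pose h := - Num.sg d * (Num.min q r / 2).
have hE : `|h| = Num.min q r / 2.
  by rewrite normrM normrN normr_sg d0 mul1r gtr0_norm.
have lmin : Num.min q r / 2 < Num.min q r by rewrite ltr_pdivrMr// ltr_pMr ?ltr1n // lt_min q0.
have hq : `|h| < q by rewrite hE (lt_le_trans lmin)// ge_min lexx.
have hr : `|h| < r by rewrite hE (lt_le_trans lmin)// ge_min lexx orbT.
have := qP h hq; rewrite ler_norml => /andP[_].
have -> : h * d = - (`|d| * `|h|) by rewrite hE /h normrEsg; ring.
have := fm h hr; have : 0 < `|d| * `|h| by rewrite mulr_gt0 ?normr_gt0// -normr_gt0 hE.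
by rewrite opprK mulrAC -mulrA; lra.
Qed.

(** In a time slab the minimum may lie at the final time, where only backward increments are
    admissible; there the derivative still has a sign. *)
Lemma is_derive_min_left f x d r : 0 < r -> is_derive x 1 f d ->
  (forall h, 0 < h < r -> f x <= f (x - h)) -> d <= 0.
Proof.
move=> r0 fd fm; rewrite leNgt; apply/negP => d0.
have dp : 0 < d / 2 by rewrite divr_gt0.
have [q q0 qP] := is_derive_expansion fd dp.
have m0 : 0 < Num.min q r / 2 by rewrite divr_gt0// lt_min q0.
have lmin : Num.min q r / 2 < Num.min q r by rewrite ltr_pdivrMr// ltr_pMr ?ltr1n // lt_min q0.
pose h := Num.min q r / 2.
have hq : h < q by rewrite (lt_le_trans lmin)// ge_min lexx.
have hr : h < r by rewrite (lt_le_trans lmin)// ge_min lexx orbT.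
have h0 : 0 < h by [].
have := qP (- h); rewrite normrN gtr0_norm// => /(_ hq).
rewrite ler_norml => /andP[_].
have := fm h; rewrite h0 hr => /(_ isT).
have : 0 < d * h by rewrite mulr_gt0.
by nra.
Qed.

Lemma MVT_is_derive f (f' : R -> R) x y : x < y ->
  (forall z, is_derive z 1 f (f' z)) ->
  exists2 z, x < z < y & f y - f x = f' z * (y - x).
Proof.
move=> xy fd.
have fc : {within `[x, y], continuous f}.
  by apply: continuous_subspaceT => z; exact: is_derive_continuous (fd z).
have [z zxy E] := MVT xy (fun z _ => fd z) fc.
by exists z => //; rewrite in_itv/= in zxy.
Qed.

(** At the minimum [f'] vanishes. If its derivative were negative there, [f'] would be negative just
    to the right, and the mean value theorem would push [f] below its minimum. *)
Lemma second_derive_min f (f' : R -> R) x d :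
  (forall y, is_derive y 1 f (f' y)) -> is_derive x 1 f' d ->
  (forall y, f x <= f y) -> 0 <= d.
Proof.
move=> fd f'd fm; rewrite leNgt; apply/negP => d0.
have f'0 : f' x = 0 by by apply: (is_derive_min ltr01 (fd x)) => h _; exact: fm.
have dp : 0 < - d / 2 by rewrite divr_gt0// oppr_gt0.
have [r r0 rP] := is_derive_expansion f'd dp.
have xr : x < x + r / 2 by rewrite ltrDl divr_gt0.
have [z /andP[xz zr] zE] := MVT_is_derive xr fd.
have := rP (z - x); rewrite gtr0_norm ?subr_gt0//.
have -> : z - x < r by lra.
move=> /(_ isT); rewrite subrKC f'0 subr0 ler_norml => /andP[_ H].
have f'z : f' z < 0 by nra.
have := fm (x + r / 2); have : f' z * (x + r / 2 - x) < 0 by nra.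
by lra.
Qed.

(* A crude Taylor remainder: the factorial is dropped. *)
Lemma derive_growth f (f' : R -> R) (C : R) (n : nat) (s : R) :
  (forall y, is_derive y 1 f (f' y)) -> f 0 = 0 ->
  (forall y, 0 <= y <= s -> `|f' y| <= C * y ^+ n) ->
  forall y, 0 <= y <= s -> `|f y| <= C * y ^+ n.+1.
Proof.
move=> fd f0 f'C y /andP[]; rewrite le_eqVlt => /predU1P[<- _|y0 ys].
  by rewrite f0 normr0 exprS mul0r mulr0.
have [z /andP[z0 zy]] := MVT_is_derive y0 fd.
rewrite f0 !subr0 => ->; rewrite normrM exprSr mulrA (gtr0_norm y0).
apply: ler_wpM2r; first exact: ltW.
apply: (le_trans (f'C z _)); first by lra.
have C0 : 0 <= C.
  have := f'C z _; rewrite (ltW z0) (le_trans (ltW zy) ys) => /(_ isT).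
  move=> /(le_trans (normr_ge0 _)); rewrite pmulr_lge0//.
  by rewrite exprn_gt0.
apply: ler_wpM2l => //; apply: lerXn2r; rewrite ?nnegrE; lra.
Qed.

End calculus.

(** * The maximum principle *)

Section maximum_principle.
Context {R : realType}.
Implicit Types (f w : R -> R -> R) (x y t c d : R).

Definition jet_at f x t (ft : R) (fx : R -> R) (fxx : R) : Prop :=
  [/\ is_derive t 1 (f x) ft, forall y, is_derive y 1 (f^~ t) (fx y) &
      is_derive x 1 fx fxx].

Lemma jet_atB f w x t ft fx fxx wt wx wxx :
  jet_at f x t ft fx fxx -> jet_at w x t wt wx wxx ->
  jet_at (fun y s => f y s - w y s) x t (ft - wt) (fun y => fx y - wx y)
    (fxx - wxx).
Proof.
move=> [f1 f2 f3] [w1 w2 w3]; split => [|y|].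
- exact: is_deriveB.
- exact: (is_deriveB (f := f^~ t) (g := w^~ t)).
- exact: is_deriveB.
Qed.

Definition strip (t0 t1 : R) : set (R * R) := [set p | t0 <= p.2 <= t1].

Definition cont2 (A : set (R * R)) f := {within A, continuous (fun p => f p.1 p.2)}.

(* The penalty [e * expR (K * (t - t0)) * (1 + x ^+ 2)] is a strict
   supersolution of the linear equation which forces the minimum to be
   attained. *)
Lemma maximum_principle f (d c t0 t1 B : R) : 0 <= d ->
  cont2 (strip t0 t1) f ->
  (forall x t, t0 <= t <= t1 -> - B <= f x t) ->
  (forall x, 0 <= f x t0) ->
  (forall x t, t0 < t <= t1 -> f x t < 0 -> exists ft fx fxx,
     jet_at f x t ft fx fxx /\ d * fxx + c * fx x <= ft) ->
  forall x t, t0 <= t <= t1 -> 0 <= f x t.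
Proof.
move=> d0 fc fB f0 fpde x1 s1 /andP[t0s1 s1t1]; rewrite leNgt; apply/negP => fneg.
(* By [2 |x| <= 1 + x^2], diffusion and drift of the penalty are at most [2 d + |c|] times the
   penalty, so the extra 1 leaves a strict surplus. *)
pose K := 2 * d + `|c| + 1.
pose E t := expR (K * (t - t0)).
have E0 t : 0 < E t by exact: expR_gt0.
have K0 : 0 <= K by rewrite /K; have := normr_ge0 c; lra.
have E1 t : t0 <= t -> 1 <= E t.
  by move=> tt0; rewrite -expR0 ler_expR mulr_ge0// subr_ge0.
pose m := E s1 * (1 + x1 ^+ 2).
have m0 : 0 < m by rewrite mulr_gt0// ltr_wpDr// sqr_ge0.
(* The penalty at [(x1, s1)] is then half of [- f x1 s1], so the penalised function remains negative
   there. *)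
pose e := - f x1 s1 / (2 * m).
have e0 : 0 < e by rewrite divr_gt0 ?oppr_gt0// mulr_gt0.
pose p x t := e * (E t * (1 + x ^+ 2)).
have p0 x t : 0 < p x t by rewrite mulr_gt0// mulr_gt0// ltr_wpDr// sqr_ge0.
have pe x t : t0 <= t -> e * (1 + x ^+ 2) <= p x t.
  move=> tt0; rewrite ler_wpM2l ?(ltW e0)// ler_peMl ?E1//.
  by rewrite addr_ge0// sqr_ge0.
pose g (q : R * R) := f q.1 q.2 + p q.1 q.2.
have gneg : g (x1, s1) < 0.
  rewrite /g/= /p -/m /e; have -> : - f x1 s1 / (2 * m) * m = - f x1 s1 / 2.
    by field; rewrite gt_eqF.
  by lra.
have B0 : 0 <= `|B| + 1 by rewrite addr_ge0.
(* For [|x| > L] the penalty exceeds [|B|], so [g] can be negative only inside the rectangle; the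
   summand [|x1|] keeps the known negative point in it. *)
pose L := (`|B| + 1) / e + `|x1| + 1.
have Lp : 0 <= (`|B| + 1) / e by rewrite divr_ge0// ltW.
have L1 : 1 <= L by rewrite /L; have := normr_ge0 x1; lra.
pose A : set (R * R) := `[- L, L] `*` `[t0, t1].
have AS : A `<=` strip t0 t1 by move=> [x t] [_]; rewrite /= in_itv.
have Ac : compact A by apply: compact_setX; exact: segment_compact.
have pc : continuous (fun q : R * R => p q.1 q.2).
  move=> q; apply: cvgM; first exact: cvg_cst.
  apply: cvgM.
    apply: (continuous_comp (f := fun q : R * R => K * (q.2 - t0)) (g := expR)); last exact: continuous_expR.
    apply: cvgM; first exact: cvg_cst.
    by apply: cvgB; [exact: cvg_snd|exact: cvg_cst].
  apply: cvgD; first exact: cvg_cst.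
  by apply: cvgM; exact: cvg_fst.
have gc : {within A, continuous g}.
  move=> q; apply: cvgD; first exact: (continuous_subspaceW AS fc).
  exact: (continuous_subspaceT pc).
have [xh [th]] : exists xh th : R, (xh, th) \in A /\
    forall q, q \in A -> g (xh, th) <= g q.
  have [|[xh th] xhA gm] := compact_EVT_min _ Ac gc; last by exists xh, th.
  by exists (0, t0); split; rewrite /= in_itv/=; lra.
rewrite inE => -[[]]; rewrite /= !in_itv/= => xhL /andP[t0h ht1] gmin.
have gmin1 : g (xh, th) < 0.
  apply: le_lt_trans gneg; apply: gmin; rewrite inE; split; rewrite /= in_itv/=; last by lra.
  by rewrite -ler_norml /L; have := normr_ge0 x1; lra.
have fh : f xh th < 0 by have := p0 xh th; move: gmin1; rewrite /g/=; lra.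
have gminx x : g (xh, th) <= g (x, th).
  have [xL|Lx] := lerP `|x| L.
    by apply: gmin; rewrite inE; split; rewrite /= in_itv/= -?ler_norml//; lra.
  apply: (le_trans (ltW gmin1)); rewrite /g/=.
  have := fB x th; rewrite t0h ht1 => /(_ isT).
  have := pe x th t0h.
  have : `|B| + 1 <= e * (1 + x ^+ 2).
    have x1' : `|x| <= 1 + x ^+ 2 by have := sqr_ge0 (`|x| - 1); rewrite -[x ^+ 2]real_normK ?num_real// ; nra.
    apply: (@le_trans _ _ (e * `|x|)); last by rewrite ler_wpM2l// ltW.
    rewrite mulrC -ler_pdivrMr//.
    by move: Lx; rewrite /L; have := normr_ge0 x1; lra.
  by have := ler_norm B; lra.
have t0lt : t0 < th.
  rewrite lt_neqAle t0h andbT; apply/eqP => tE.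
  by have := f0 xh; rewrite tE; lra.
have gmint s : t0 <= s <= t1 -> g (xh, th) <= g (xh, s).
  by move=> sI; apply: gmin; rewrite inE; split; rewrite /= in_itv/=.
have tI : t0 < th <= t1 by rewrite t0lt.
have [ft [fx [fxx [[f1 f2 f3] fle]]]] := fpde xh th tI fh.
have dE' : is_derive th 1 (fun t => p xh t) (e * (E th * K * (1 + xh ^+ 2))).
  have dl : is_derive th 1 (fun t => K * (t - t0)) K.
    by apply: is_derive_eq; rewrite /GRing.scale/=; ring.
  have dE : is_derive th 1 E (E th * K).
    exact: (is_derive_compose (is_derive_expR _) dl).
  rewrite /p.
  by apply: is_derive_eq; rewrite /GRing.scale/= /cst; ring.
have dx1 y : is_derive y 1 (fun x => p x th) (e * (E th * (2 * y))).
  by rewrite /p; apply: is_derive_eq; rewrite /GRing.scale/= /cst; ring.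
have dx2 : is_derive xh 1 (fun y => e * (E th * (2 * y))) (e * (E th * 2)).
  by apply: is_derive_eq; rewrite /GRing.scale/= /cst; ring.
have gx y : is_derive y 1 (fun x => f x th + p x th) (fx y + e * (E th * (2 * y))).
  exact: (is_deriveD (f := f^~ th)).
have gx0 : fx xh + e * (E th * (2 * xh)) = 0.
  by apply: (is_derive_min ltr01 (gx xh)) => h _; exact: gminx.
have gxx : 0 <= fxx + e * (E th * 2).
  by apply: (second_derive_min gx) => //; exact: (is_deriveD (f := fx)).
have gt : ft + e * (E th * K * (1 + xh ^+ 2)) <= 0.
  have tp : 0 < th - t0 by rewrite subr_gt0.
  apply: (is_derive_min_left tp (f := fun s => f xh s + p xh s)).
  move=> h /andP[h0 hr]; apply: (gmint (th - h)); apply/andP; split; last by lra.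
  by move: hr; rewrite ltrBrDl -ltrBrDr => /ltW.
have eE : 0 < e * E th by rewrite mulr_gt0.
set q := e * E th in eE.
have : d * - (q * 2) <= d * fxx by apply: ler_wpM2l => //; move: gxx; rewrite /q; lra.
have : c * fx xh = - (q * (2 * (c * xh))).
  have -> : fx xh = - (e * (E th * (2 * xh))) by lra.
  by rewrite /q; ring.
have : ft <= - (q * (K * (1 + xh ^+ 2))) by move: gt; rewrite /q; nra.
have cx : 2 * (c * xh) <= `|c| * (1 + xh ^+ 2).
  apply: (@le_trans _ _ (2 * (`|c| * `|xh|))).
    by rewrite -normrM; have := ler_norm (c * xh); lra.
  by have := sqr_ge0 (`|xh| - 1); have := normr_ge0 c; rewrite -[xh ^+ 2]real_normK ?num_real//; nra.
have : q * (2 * (c * xh)) <= q * (`|c| * (1 + xh ^+ 2)).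
  by apply: ler_wpM2l => //; exact: ltW.
have K2 : 2 * d + `|c| * (1 + xh ^+ 2) + 1 <= K * (1 + xh ^+ 2).
  by rewrite /K; have := sqr_ge0 xh; nra.
have := ler_wpM2l (ltW eE) K2.
by lra.
Qed.

End maximum_principle.

(** * The error function *)

Section error_function.
Context {R : realType}.

Lemma exists_error_function :
  {Phi : R -> R | forall q : R, is_derive q 1 Phi (expR (- q ^+ 2))}.
Proof.
pose Phi (x : R) := (\int[@lebesgue_measure R]_(t in `]-oo, x]) gauss_fun t)%R.
exists Phi => q.
have qq : q < q + 1 by rewrite ltrDl.
have gi : lebesgue_measure.-integrable `]-oo, q + 1] (EFin \o @gauss_fun R).
  by apply: integrableS integrableT_gauss.
have [dPhi Phi'] := continuous_FTC1 qq gi (ltNyr q) (@continuous_gauss_fun R q).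
by apply: DeriveDef; [exact: dPhi|rewrite -derive1E; exact: Phi'].
Qed.

Definition Phi : R -> R := sval exists_error_function.

Lemma is_derive_Phi (q : R) : is_derive q 1 Phi (expR (- q ^+ 2)).
Proof. exact: (svalP exists_error_function). Qed.

Lemma Phi_ge (a b m : R) : a <= b -> (forall q, a <= q <= b -> q ^+ 2 <= m) ->
  expR (- m) * (b - a) <= Phi b - Phi a.
Proof.
rewrite le_eqVlt => /predU1P[->|ab] H; first by rewrite !subrr mulr0.
have [z /andP[az zb] ->] := MVT_is_derive ab is_derive_Phi.
apply: ler_wpM2r; first by rewrite subr_ge0 ltW.
by rewrite ler_expR lerN2; apply: H; rewrite !ltW.
Qed.

Lemma Phi_le (a b m : R) : a <= b -> (forall q, a <= q <= b -> m <= q ^+ 2) ->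
  Phi b - Phi a <= expR (- m) * (b - a).
Proof.
rewrite le_eqVlt => /predU1P[->|ab] H; first by rewrite !subrr mulr0.
have [z /andP[az zb] ->] := MVT_is_derive ab is_derive_Phi.
apply: ler_wpM2r; first by rewrite subr_ge0 ltW.
by rewrite ler_expR lerN2; apply: H; rewrite !ltW.
Qed.

Lemma Phi_homo (a b : R) : a <= b -> Phi a <= Phi b.
Proof.
move=> ab; rewrite -subr_ge0; apply: le_trans (Phi_ge (m := Num.max (a ^+ 2) (b ^+ 2)) ab _).
  by rewrite mulr_ge0 ?expR_ge0// subr_ge0.
move=> q /andP[aq qb]; rewrite le_max.
have [q0|/ltW q0] := lerP 0 q; apply/orP; [right|left].
  by rewrite lerXn2r// nnegrE (le_trans q0).
by rewrite -(sqrrN q) -(sqrrN a) lerXn2r// ?nnegrE; lra.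
Qed.

Lemma expR_Nle_inv (u : R) : 0 < u -> expR (- u) <= u^-1.
Proof.
move=> u0; rewrite expRN lef_pV2 ?posrE ?expR_gt0//.
by have := expR_ge1Dx u; lra.
Qed.

(* Compare with the arc tangent, whose derivative is larger. *)
Lemma Phi_bounded (a b : R) : Phi b - Phi a <= 4.
Proof.
have [|ab] := lerP b a.
  by move=> /Phi_homo; lra.
have dF (q : R) : is_derive q 1 (fun x => atan x - Phi x) ((1 + q ^+ 2)^-1 - expR (- q ^+ 2)).
  apply: (is_deriveB (f := atan)); exact: is_derive_Phi.
have [z _ E] := MVT_is_derive ab dF.
have : 0 <= (1 + z ^+ 2)^-1 - expR (- z ^+ 2).
  rewrite subr_ge0 expRN lef_pV2 ?posrE ?expR_gt0//.
    by have := expR_ge1Dx (z ^+ 2); lra.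
  by have := sqr_ge0 z; lra.
move=> D; have : 0 <= atan b - Phi b - (atan a - Phi a).
  by rewrite E mulr_ge0// subr_ge0 ltW.
have := atan_ltpi2 b; have := atan_gtNpi2 a; have := @pihalf_lt2 R.
by lra.
Qed.

End error_function.

(** * Subsolutions *)

Section supersolutions.
Context {R : realType}.
Implicit Types (f g w : R -> R -> R) (x y t c d : R) (T : \bar R).

(** Here [g] is the whole source term. Continuity in time uniformly in space (third clause) allows a
    comparison with the heat flow to start slightly after [t0], where the error functions are
    already smooth. *)
Definition supersolution T d c g f : Prop :=
  [/\ forall x t, time_interval T t -> 0 <= f x t,
      forall t0 t1, 0 <= t0 -> (t1%:E < T)%E -> cont2 (strip t0 t1) f,
      forall t0, time_interval T t0 -> forall e, 0 < e -> exists2 r, 0 < r &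
        forall x t, time_interval T t -> `|t - t0| < r ->
          `|f x t - f x t0| <= e &
      forall x t, 0 < t -> (t%:E < T)%E -> exists ft fx fxx,
        jet_at f x t ft fx fxx /\ d * fxx + c * fx x + g x t <= ft].

(** Since [f >= 0], the difference [f - w] can be negative only where [w > 0]; the maximum principle
    asks for the differential inequality there and nowhere else. *)
Lemma comparison T d c g f w t0 t1 B : 0 <= d -> supersolution T d c g f ->
  0 <= t0 -> (t1%:E < T)%E -> cont2 (strip t0 t1) w ->
  (forall x t, t0 <= t <= t1 -> w x t <= B) ->
  (forall x, w x t0 <= f x t0) ->
  (forall x t, t0 < t <= t1 -> 0 < w x t -> exists wt wx wxx,
     jet_at w x t wt wx wxx /\ wt <= d * wxx + c * wx x + g x t) ->
  forall x t, t0 <= t <= t1 -> w x t <= f x t.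
Proof.
move=> d0 [f0 fc _ fpde] t00 t1T wc wB wf0 wpde x t tI; rewrite -subr_ge0.
have tT s : s <= t1 -> (s%:E < T)%E by move=> st; rewrite (le_lt_trans _ t1T)// lee_fin.
apply: (@maximum_principle _ (fun x t => f x t - w x t) d c t0 t1 B d0) tI.
- by move=> p; apply: cvgB; [exact: (fc _ _ t00 t1T p)|exact: (wc p)].
- move=> y s /andP[ts st]; have := wB y s; rewrite ts st => /(_ isT).
  by have := f0 y s (conj (le_trans t00 ts) (tT _ st)); lra.
- by move=> y; rewrite subr_ge0.
move=> y s /andP[ts st] fw.
have s0 : 0 < s by exact: le_lt_trans ts.
have [ft [fx [fxx [jf fle]]]] := fpde y s s0 (tT _ st).
have w0 : 0 < w y s by have := f0 y s (conj (ltW s0) (tT _ st)); lra.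
have [|wt [wx [wxx [jw wle]]]] := wpde y s _ w0; first by rewrite ts.
exists (ft - wt), (fun y => fx y - wx y), (fxx - wxx); split; first exact: jet_atB.
by lra.
Qed.

Lemma cont2_for (A : set (R * R)) f :
  (forall p, A p -> {for p, continuous (fun q : R * R => f q.1 q.2)}) -> cont2 A f.
Proof.
by move=> H; apply: continuous_in_subspaceT => p; rewrite inE; exact: H.
Qed.

(** In the frame moving with the drift the transport terms cancel. What remains is [a'] times a
    factor at most 1, plus the diffusive loss [2 d a / L^2]; the source has to pay for both, but
    only for [|x - x0 + c t| < L], where the parabola is positive. *)
Lemma source_bound T d c g f (x0 L t0 t1 B : R) (a a' : R -> R) :
  0 <= d -> supersolution T d c g f -> 0 < L -> 0 <= t0 -> t0 <= t1 ->
  (t1%:E < T)%E ->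
  (forall t, t0 <= t <= t1 -> [/\ is_derive t 1 a (a' t), 0 <= a' t & 0 <= a t <= B]) ->
  a t0 = 0 ->
  (forall x t, t0 < t <= t1 -> `|x - x0 + c * t| < L ->
     a' t + 2 * d * a t / L ^+ 2 <= g x t) ->
  forall x t, t0 <= t <= t1 -> a t * (1 - (x - x0 + c * t) ^+ 2 / L ^+ 2) <= f x t.
Proof.
move=> d0 fs L0 t00 t01 t1T aP at0 ag.
pose i := (L ^+ 2)^-1; have i0 : 0 < i by rewrite invr_gt0 exprn_gt0.
apply: (@comparison T d c g f _ t0 t1 B d0 fs t00 t1T).
- apply: cont2_for => -[x t] tI; have [da _ _] := aP t tI.
  apply: cvgM.
    apply: (continuous_comp (f := snd) (g := a)); first exact: cvg_snd.
    exact: is_derive_continuous da.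
  apply: cvgB; first exact: cvg_cst.
  apply: cvgM; last exact: cvg_cst.
  have cl : {for (x, t), continuous (fun p : R * R => p.1 - x0 + c * p.2)}.
    apply: cvgD; first by apply: cvgB; [exact: cvg_fst|exact: cvg_cst].
    by apply: cvgM; [exact: cvg_cst|exact: cvg_snd].
  by rewrite /continuous_at expr2; apply: cvgM.
- move=> x t /aP[_ _ /andP[a0 aB]]; apply: le_trans aB.
  by rewrite ler_piMr// gerBl mulr_ge0 ?sqr_ge0// ltW.
- move=> x; rewrite at0 mul0r; case: fs => f0 _ _ _.
  by apply: f0; split => //; rewrite (le_lt_trans _ t1T)// lee_fin.
move=> x t tI w0.
have tI' : t0 <= t <= t1 by case/andP: tI => /ltW -> ->.
have [da a'0 /andP[a0 aB]] := aP t tI'.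
have yL : `|x - x0 + c * t| < L.
  rewrite ltNge; apply/negP => Ly; move: w0; rewrite ltNge => /negP; apply.
  rewrite mulr_ge0_le0// subr_le0 ler_pdivlMr ?exprn_gt0// mul1r.
  by rewrite -[leRHS]real_normK ?num_real// lerXn2r// ?nnegrE// ltW.
exists (a' t * (1 - (x - x0 + c * t) ^+ 2 * i) - a t * (2 * (x - x0 + c * t) * c * i)).
exists (fun y => - (a t * (2 * (y - x0 + c * t) * i))), (- (a t * (2 * i))).
split.
  have dl (y : R) : is_derive y 1 (fun z => z - x0 + c * t) 1.
    by apply: is_derive_eq; rewrite /cst; ring.
  have dl' : is_derive t 1 (fun s => x - x0 + c * s) c.
    by apply: is_derive_eq; rewrite /cst /GRing.scale/=; ring.
  split => [|y|].
  - by apply: is_derive_eq; rewrite /GRing.scale/= /i; ring.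
  - by apply: is_derive_eq; rewrite /GRing.scale/= /i; ring.
  - by apply: is_derive_eq; rewrite /GRing.scale/= /i; ring.
have := ag x t tI yL; rewrite -/i => H.
have : 0 <= a' t * ((x - x0 + c * t) ^+ 2 * i).
  by rewrite mulr_ge0// mulr_ge0 ?sqr_ge0// ltW.
by lra.
Qed.

(** Take [a] linear with slope [k / (1 + 2 d m)]: as the duration is at most [m L^2], slope and
    diffusive loss together stay below [k]. The factor 3/4 is the value of the parabolic profile at
    distance [L / 2]. *)
Lemma constant_source_bound T d c g f (x0 L t0 t1 k m : R) :
  0 <= d -> supersolution T d c g f -> 0 < L -> 0 <= t0 -> t0 <= t1 ->
  (t1%:E < T)%E -> 0 <= k -> t1 - t0 <= m * L ^+ 2 ->
  (forall x t, t0 <= t <= t1 -> `|x - x0 + c * t| <= L -> k <= g x t) ->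
  forall x, `|x - x0 + c * t1| <= L / 2 ->
    3 / 4 * (k / (1 + 2 * d * m)) * (t1 - t0) <= f x t1.
Proof.
move=> d0 fs L0 t00 t01 t1T k0 hm kg x xL.
have L2 : 0 < L ^+ 2 by rewrite exprn_gt0.
have m0 : 0 <= m.
  by rewrite -(pmulr_lge0 _ L2) (le_trans _ hm)// subr_ge0.
have D0 : 0 < 1 + 2 * d * m by have := mulr_ge0 d0 m0; lra.
set A := k / _; have A0 : 0 <= A by rewrite divr_ge0// ltW.
have aP t : t0 <= t <= t1 -> [/\ is_derive t 1 (fun s => A * (s - t0)) A, 0 <= A &
    0 <= A * (t - t0) <= A * (t1 - t0)].
  move=> /andP[ts st]; split=> //.
    by apply: is_derive_eq; rewrite /GRing.scale/=; ring.
  by rewrite mulr_ge0 ?subr_ge0// ler_wpM2l// lerB.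
have := source_bound d0 fs L0 t00 t01 t1T aP; rewrite subrr mulr0 => /(_ x0 erefl).
move=> /(_ _ x t1); rewrite t01 lexx => /(_ _ isT) H.
apply: le_trans (H _).
  rewrite -mulrA mulrC ler_wpM2l//; first by rewrite mulr_ge0// subr_ge0.
  have : (x - x0 + c * t1) ^+ 2 / L ^+ 2 <= 1 / 4.
    rewrite ler_pdivrMr// -[leLHS]real_normK ?num_real//.
    have -> : 1 / 4 * L ^+ 2 = (L / 2) ^+ 2 by field.
    by rewrite lerXn2r ?nnegrE// divr_ge0// ltW.
  by lra.
move=> y t /andP[ts st] yL; apply: le_trans (kg y t _ (ltW yL)); last by rewrite ltW.
have E : A * (1 + 2 * d * m) = k by rewrite /A divfK// gt_eqF.
have : (t - t0) / L ^+ 2 <= m by rewrite ler_pdivrMr//; lra.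
move=> /(ler_wpM2l (mulr_ge0 d0 A0)); move: E.
by lra.
Qed.

(** * Error-function solutions of the drift-diffusion equation *)

Section heat_kernel.
Variables (d c b t0 : R).
Hypothesis d0 : 0 < d.

Definition heat_width t := Num.sqrt (4 * d * (t - t0)).

(** Up to an affine normalisation, the evolution of a unit step which at time [t0] jumps at
    [b - c t0]. *)
Definition heat_step x t := Phi ((x - b + c * t) / heat_width t).

Lemma heat_width_gt0 t : t0 < t -> 0 < heat_width t.
Proof. by move=> t0t; rewrite sqrtr_gt0 mulr_gt0 ?subr_gt0// mulr_gt0. Qed.

(** Self-similarity: the width [s] satisfies [s s' = 2 d], so the similarity variable [q] has time
    derivative [c / s - 2 d q / s^2], whose two terms match the drift and the diffusion. *)
Lemma heat_stepP x t : t0 < t -> exists ft fx fxx,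
  jet_at heat_step x t ft fx fxx /\ ft = d * fxx + c * fx x.
Proof.
move=> t0t; set s := heat_width t; have s0 : 0 < s by exact: heat_width_gt0.
have sE : s ^+ 2 = 4 * d * (t - t0).
  by rewrite sqr_sqrtr// mulr_ge0 ?subr_ge0 ?ltW// mulr_gt0.
pose q y := (y - b + c * t) / s.
have ds : is_derive t 1 heat_width (2 * d / s).
  have dl : is_derive t 1 (fun r => 4 * d * (r - t0)) (4 * d).
    by apply: is_derive_eq; rewrite /GRing.scale/=; ring.
  have p0 : 0 < 4 * d * (t - t0) by rewrite mulr_gt0 ?subr_gt0// mulr_gt0.
  have dS : is_derive t 1 heat_width ((2 * Num.sqrt (4 * d * (t - t0)))^-1 * (4 * d)).
    exact: (is_derive_compose (g := fun r => 4 * d * (r - t0)) (is_derive1_sqrt p0) dl).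
  apply: (is_derive_eq dS).
  by rewrite -/(heat_width t) -/s; field; rewrite gt_eqF.
have dq : is_derive t 1 (fun r => (x - b + c * r) / heat_width r)
    (c / s - q x * (2 * d / s ^+ 2)).
  have := is_deriveV (f := heat_width) (lt0r_neq0 s0) ds; rewrite -/s => dV.
  have dl : is_derive t 1 (fun r => x - b + c * r) c.
    by apply: is_derive_eq; rewrite /cst /GRing.scale/=; ring.
  apply: (is_derive_eq (is_deriveM dl dV)).
  by rewrite /GRing.scale/= /q -/s; field; rewrite gt_eqF.
have dqx y : is_derive y 1 q s^-1.
  by rewrite /q; apply: is_derive_eq; rewrite /GRing.scale/= /cst; ring.
pose fx y := expR (- q y ^+ 2) / s.
exists (expR (- q x ^+ 2) * (c / s - q x * (2 * d / s ^+ 2))), fx.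
exists (expR (- q x ^+ 2) * (- (2 * q x / s ^+ 2))); split; last first.
  by rewrite /fx; field; rewrite gt_eqF.
split.
- exact: (is_derive_compose (g := fun r => (x - b + c * r) / heat_width r) (is_derive_Phi _) dq).
- by move=> y; exact: (is_derive_compose (g := q) (is_derive_Phi _) (dqx y)).
- have dN : is_derive x 1 (fun y => - q y ^+ 2) (- (2 * q x / s)).
    by have := dqx x => ?; apply: is_derive_eq; rewrite /GRing.scale/=; ring.
  have dE := is_derive_compose (g := fun y => - q y ^+ 2) (is_derive_expR _) dN.
  by rewrite /fx; apply: is_derive_eq; rewrite /GRing.scale/= /cst; field; rewrite gt_eqF.
Qed.

Lemma heat_step_continuous p : t0 < p.2 ->
  {for p, continuous (fun q : R * R => heat_step q.1 q.2)}.
Proof.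
move=> t0p; apply: (continuous_comp
    (f := fun q : R * R => (q.1 - b + c * q.2) / heat_width q.2) (g := Phi)).
  apply: cvgM.
    apply: cvgD; first by apply: cvgB; [exact: cvg_fst|exact: cvg_cst].
    by apply: cvgM; [exact: cvg_cst|exact: cvg_snd].
  apply: cvgV; first by rewrite gt_eqF// heat_width_gt0.
  apply: (continuous_comp (f := fun q : R * R => 4 * d * (q.2 - t0))).
    by apply: cvgM; [exact: cvg_cst|apply: cvgB; [exact: cvg_snd|exact: cvg_cst]].
  exact: sqrt_continuous.
exact: is_derive_continuous (is_derive_Phi _).
Qed.

End heat_kernel.

End supersolutions.

(** * Lower bound by the heat flow of a box *)

Section heat_lower_bound.
Context {R : realType}.
Implicit Types (f g w : R -> R -> R) (x y t c d : R) (T : \bar R).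

Lemma jet_at_affine f k e x t ft fx fxx : jet_at f x t ft fx fxx ->
  jet_at (fun y s => k * f y s - e) x t (k * ft) (fun y => k * fx y) (k * fxx).
Proof.
move=> [f1 f2 f3]; split => [|y|].
- by apply: is_derive_eq; rewrite /GRing.scale/=; ring.
- have := f2 y => f2y.
  have : is_derive y 1 (fun z => k * (f^~ t) z - e) (k * fx y).
    by apply: is_derive_eq; rewrite /GRing.scale/=; ring.
  by [].
- by apply: is_derive_eq; rewrite /GRing.scale/=; ring.
Qed.

(** On [[-2, 2]] the integrand is at least [exp (-4)], so a long enough part of the integration
    interval has to be found there. If [s <= p], the interval contains [[0, 1]] or [[-1, 0]]
    according to the sign of [z]; otherwise it lies entirely in [[-2, 2]] and has length
    [2 p / s]. *)
Lemma heat_step_diff_ge (z p s : R) : 0 < p -> 0 < s -> `|z| <= Num.max p s ->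
  expR (- 4) * Num.min 1 (p / s) <= Phi ((z + p) / s) - Phi ((z - p) / s).
Proof.
move=> p0 s0 zps; set a := (z - p) / s; set b := (z + p) / s.
have e0 : 0 <= expR (- 4 : R) by exact: expR_ge0.
have sub (a' b' : R) : a <= a' -> a' <= b' -> b' <= b -> - 2 <= a' -> b' <= 2 ->
    expR (- 4) * (b' - a') <= Phi b - Phi a.
  move=> aa ab bb a2 b2.
  have : Phi b' - Phi a' <= Phi b - Phi a by have := Phi_homo aa; have := Phi_homo bb; lra.
  apply: le_trans; apply: Phi_ge => // q /andP[aq qb].
  have -> : 4 = 2 ^+ 2 :> R by ring.
  by rewrite -(real_normK (num_real q)) lerXn2r ?nnegrE// ler_norml; lra.
have [sp|ps] := lerP s p.
  have : Num.min 1 (p / s) <= 1 by rewrite ge_min lexx.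
  have : 1 <= p / s by rewrite ler_pdivlMr// mul1r.
  have : `|z| <= p by move: zps; rewrite max_l.
  rewrite ler_norml => /andP[z1 z2] ps1 /(ler_wpM2l e0) min1.
  apply: (le_trans min1); have [z0|z0] := lerP 0 z.
    rewrite -[X in _ * X]subr0; apply: sub; try lra.
      by rewrite /a ler_pdivrMr// mul0r; lra.
    by rewrite (le_trans ps1)// ler_pM2r ?invr_gt0//; lra.
  have -> : expR (- 4) * 1 = expR (- 4) * (0 - (- 1)) :> R by ring.
  apply: sub; try lra.
    by rewrite /a ler_pdivrMr// mulN1r; lra.
  by rewrite /b divr_ge0 ?(ltW s0)//; lra.
have : `|z| <= s by move: zps; rewrite max_r// ltW.
rewrite ler_norml => /andP[z1 z2].
apply: (@le_trans _ _ (expR (- 4) * (b - a))); last first.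
  apply: sub => //.
  - by rewrite ler_pM2r ?invr_gt0//; lra.
  - by rewrite ler_pdivlMr//; lra.
  - by rewrite ler_pdivrMr//; lra.
apply: ler_wpM2l => //; have -> : b - a = 2 * (p / s) by rewrite /a /b; ring.
have : 0 <= p / s by rewrite divr_ge0 ?ltW.
by have : Num.min 1 (p / s) <= p / s by [rewrite ge_min lexx orbT|]; lra.
Qed.

(** Outside the box the integration variable has modulus at least [m = (|z| - p) / s], and
    [exp (- m^2) <= 1 / m^2]. This polynomial tail is good enough: the bound is [O(s)] at fixed
    distance from the box, and it is applied with [s] tending to zero. *)
Lemma heat_step_diff_le (z p s : R) : 0 < p -> 0 < s -> p < `|z| ->
  Phi ((z + p) / s) - Phi ((z - p) / s) <= (s / (`|z| - p)) ^+ 2 * (2 * (p / s)).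
Proof.
move=> p0 s0 pz; pose m := (`|z| - p) / s.
have m0 : 0 < m by rewrite divr_gt0// subr_gt0.
have ab : (z - p) / s <= (z + p) / s by rewrite ler_pM2r ?invr_gt0//; lra.
apply: (le_trans (Phi_le (m := m ^+ 2) ab _)).
  move=> q /andP[]; rewrite ler_pdivrMr// ler_pdivlMr// => q1 q2.
  rewrite -[leRHS](real_normK (num_real q)) lerXn2r// ?nnegrE ?(ltW m0)//.
  rewrite /m ler_pdivrMr// -[X in _ * X](gtr0_norm s0) -normrM.
  have : `|z - q * s| <= p by rewrite ler_norml; lra.
  by have := lerB_dist z (z - q * s); rewrite subKr; lra.
have -> : (z + p) / s - (z - p) / s = 2 * (p / s) by ring.
have ps0 : 0 < p / s by rewrite divr_gt0.
apply: ler_wpM2r; first by lra.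
have -> : (s / (`|z| - p)) ^+ 2 = (m ^+ 2)^-1 by rewrite /m -exprVn invf_div.
by rewrite expR_Nle_inv// exprn_gt0.
Qed.

(** Increments of [Phi] are at most 4, so [eta / 4] times the evolved box stays below [eta]. The
    error functions are singular at [t0]; the comparison therefore starts at [t0 + h] with a loss
    [e] that is arbitrary. *)
Lemma heat_bound T d c g f (x0 r eta t0 t x : R) :
  0 < d -> supersolution T d c g f -> (forall y s, 0 <= g y s) ->
  0 < r -> 0 < eta -> 0 <= t0 -> t0 < t -> (t%:E < T)%E ->
  (forall y, `|y - x0 + c * t0| <= r -> eta <= f y t0) ->
  `|x - x0 + c * t| <= Num.max (r / 2) (heat_width d t0 t) ->
  expR (- 4) / 8 * eta * Num.min 1 (r / heat_width d t0 t) <= f x t.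
Proof.
move=> d0 fs g0 r0 eta0 t00 t0t tT f_eta xz.
set s := heat_width d t0 t in xz *; have s0 : 0 < s by exact: heat_width_gt0.
pose p := r / 2; have p0 : 0 < p by rewrite divr_gt0.
pose W y u := heat_step d c (x0 - p) t0 y u - heat_step d c (x0 + p) t0 y u.
have WE y u : W y u = Phi ((y - x0 + c * u + p) / heat_width d t0 u) -
    Phi ((y - x0 + c * u - p) / heat_width d t0 u).
  by rewrite /W /heat_step; congr (Phi (_ / _) - Phi (_ / _)); ring.
(* The box has half-width [r / 2], which costs a factor 2; together with the prefactor [eta / 4]
   this explains the 8. *)
have step : expR (- 4) / 8 * eta * Num.min 1 (r / s) <= eta / 4 * W x t.
  have : Num.min 1 (r / s) <= 2 * Num.min 1 (p / s).
    have : 0 < r / s by rewrite divr_gt0.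
    have -> : p / s = r / s / 2 by rewrite /p; ring.
    by move=> rs; rewrite !minEle; case: ifP; case: ifP; lra.
  have := heat_step_diff_ge p0 s0 xz; rewrite WE -/s.
  set M := Num.min 1 (p / s); set N := Num.min 1 _; set V := _ - _ => H1 H2.
  have : expR (- 4) * N <= expR (- 4) * (2 * M) by rewrite ler_wpM2l// expR_ge0.
  by nra.
apply: (le_trans step); apply/ler_addgt0Pl => e e0; rewrite -lerBlDl.
have [f0 _ fu _] := fs.
have t0T : time_interval T t0 by split => //; rewrite (lt_trans _ tT)// lte_fin.
have [u u0 uP] := fu t0 t0T e e0.
(* The four bounds on [h] serve in turn: to change [f] by at most [e], to stay before [t], to let
   the drift move the box by at most [r / 4], and to make the width so small that the tail beyond
   [3 r / 4] is at most [e]. *)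
pose h := Num.min (Num.min (u / 2) (t - t0))
  (Num.min (r / (4 * (`|c| + 1))) ((e * r / (4 * eta)) ^+ 2 / (4 * d))).
have c1 : 0 < 4 * (`|c| + 1) by have := normr_ge0 c; lra.
have h0 : 0 < h.
  rewrite !lt_min (divr_gt0 u0) ?subr_gt0 ?t0t ?(divr_gt0 r0)//=.
  by apply: divr_gt0; rewrite ?exprn_gt0 ?divr_gt0 ?mulr_gt0.
have hu : h <= u / 2 by rewrite /h !ge_min lexx.
have ht : h <= t - t0 by rewrite /h !ge_min lexx orbT.
have hc : `|c| * h <= r / 4.
  have : h <= r / (4 * (`|c| + 1)) by rewrite /h !ge_min lexx !orbT.
  by rewrite ler_pdivlMr//; nra.
have hs : heat_width d t0 (t0 + h) <= e * r / (4 * eta).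
  have : h <= (e * r / (4 * eta)) ^+ 2 / (4 * d) by rewrite /h !ge_min lexx !orbT.
  rewrite ler_pdivlMr ?mulr_gt0// => hh.
  rewrite /heat_width addrAC subrr add0r.
  have E0 : 0 <= e * r / (4 * eta) by rewrite ltW// divr_gt0// mulr_gt0.
  apply: (@le_trans _ _ (Num.sqrt ((e * r / (4 * eta)) ^+ 2))).
    by rewrite ler_wsqrtr// mulrC.
  by rewrite sqrtr_sqr ger0_norm.
have t1T : time_interval T (t0 + h).
  by split; [lra|rewrite (le_lt_trans _ tT)// lee_fin; lra].
have init y : eta / 4 * W y (t0 + h) - e <= f y (t0 + h).
  pose z := y - x0 + c * (t0 + h).
  set sh := heat_width d t0 (t0 + h) in hs.
  have sh0 : 0 < sh by rewrite heat_width_gt0// ltrDl.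
  have [zr|rz] := lerP `|z| (3 / 4 * r).
    have : eta <= f y t0.
      apply: f_eta; have -> : y - x0 + c * t0 = z - c * h by rewrite /z; ring.
      by rewrite (le_trans (ler_normB _ _))// normrM (gtr0_norm h0); lra.
    have : W y (t0 + h) <= 4 by rewrite WE; exact: Phi_bounded.
    move=> /(ler_wpM2l (ltW eta0)).
    have := uP y (t0 + h) t1T; rewrite addrAC subrr add0r gtr0_norm//.
    have -> : h < u by lra.
    by move=> /(_ isT); rewrite ler_norml => /andP[] + _; lra.
  apply: (@le_trans _ _ 0); last exact: f0.
  rewrite subr_le0; have : W y (t0 + h) <= 16 * (sh / r).
    have pz : p < `|z| by rewrite /p; lra.
    rewrite WE -/z -/sh; apply: (le_trans (heat_step_diff_le p0 sh0 pz)).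
    have zp : r / 4 <= `|z| - p by rewrite /p; lra.
    have : sh / (`|z| - p) <= sh / (r / 4).
      rewrite ler_wpM2l ?(ltW sh0)// lef_pV2 ?posrE// ?divr_gt0//; lra.
    have q0 : 0 <= sh / (`|z| - p) by rewrite divr_ge0 ?(ltW sh0)//; lra.
    move=> H; apply: (@le_trans _ _ ((sh / (r / 4)) ^+ 2 * (2 * (p / sh)))).
      apply: ler_wpM2r; first by rewrite mulr_ge0// divr_ge0// ltW.
      by rewrite lerXn2r// nnegrE// divr_ge0 ?ltW// divr_gt0.
    by rewrite /p le_eqVlt; apply/orP; left; apply/eqP; field; rewrite !gt_eqF.
  have e4 : 0 <= eta / 4 by rewrite divr_ge0// ltW.
  move=> /(ler_wpM2l e4) H; apply: (le_trans H).
  have -> : eta / 4 * (16 * (sh / r)) = sh / (r / (4 * eta)).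
    by field; rewrite !gt_eqF.
  by rewrite ler_pdivrMr ?divr_gt0 ?mulr_gt0// mulrA.
have th : t0 < t0 + h by rewrite ltrDl.
apply: (@comparison _ T d c g f (fun y v => eta / 4 * W y v - e) (t0 + h) t (4 * eta)) => //.
- exact: ltW.
- by rewrite addr_ge0// ltW.
- apply: cont2_for => q /= /andP[q1 _].
  have q0 : t0 < q.2 by lra.
  apply: cvgB; last exact: cvg_cst.
  apply: cvgM; first exact: cvg_cst.
  by apply: cvgB; exact: heat_step_continuous.
- move=> y v _; have : W y v <= 4 by rewrite WE; exact: Phi_bounded.
  by move=> /(ler_wpM2l (ltW eta0)); lra.
- move=> y v /andP[v1 v2] _; have v0 : t0 < v by lra.
  have [ft [fx [fxx [j1 E1]]]] := heat_stepP c (x0 - p) d0 y v0.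
  have [wt [wx [wxx [j2 E2]]]] := heat_stepP c (x0 + p) d0 y v0.
  have := jet_at_affine (eta / 4) e (jet_atB j1 j2) => j.
  do 3 eexists; split; first exact: j.
  by have := g0 y v; rewrite E1 E2; lra.
- by apply/andP; split; lra.
Qed.

End heat_lower_bound.

(** * The growth mechanism *)

Section growth.
Context {R : realType}.
Implicit Types (f g : R -> R -> R) (T : \bar R).

Definition coupled T (d1 d2 c1 c2 : R) f g : Prop :=
  supersolution T d1 c1 (fun x t => g x t ^+ 2) f /\
  supersolution T d2 c2 (fun x t => f x t ^+ 2) g.

(** The constants of the growth lemmas depend on the parameters listed before [T] and hold for all
    [T], [f], [g]. Only [f] is required to start positive somewhere; the other case is reached by
    exchanging the components. *)
Definition started_above (d1 d2 c1 c2 x0 r eta : R) T f g : Prop :=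
  coupled T d1 d2 c1 c2 f g /\ forall y : R, `|y - x0| <= r -> eta <= f y 0.

Lemma heat_widthM (d t0 t : R) : 0 <= d ->
  heat_width d t0 t = Num.sqrt (4 * d) * Num.sqrt (t - t0).
Proof. by move=> d0; rewrite /heat_width sqrtrM// mulr_ge0. Qed.

Lemma min1_gt0 (a : R) : 0 < a -> 0 < Num.min 1 a.
Proof. by move=> a0; rewrite lt_min ltr01. Qed.

Lemma sqr_ge_div (k x s t : R) : 0 <= k -> 0 < s -> s <= t ->
  k / Num.sqrt s <= x -> k ^+ 2 / t <= x ^+ 2.
Proof.
move=> k0 s0 st H; apply: (@le_trans _ _ ((k / Num.sqrt s) ^+ 2)).
  rewrite expr_div_n sqr_sqrtr ?(ltW s0)//.
  by rewrite ler_wpM2l ?sqr_ge0// lef_pV2 ?posrE// (lt_le_trans s0).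
have K0 : 0 <= k / Num.sqrt s by rewrite divr_ge0// sqrtr_ge0.
by rewrite lerXn2r// nnegrE// (le_trans K0).
Qed.

Lemma sqrt_half_ge (s t : R) : 0 <= t -> t / 2 <= s -> Num.sqrt t / 2 <= Num.sqrt s.
Proof.
move=> t0 ts.
have -> : Num.sqrt t / 2 = Num.sqrt (t / 4).
  have -> : t / 4 = (Num.sqrt t / 2) ^+ 2 by rewrite expr_div_n sqr_sqrtr//; field.
  by rewrite sqrtr_sqr ger0_norm// divr_ge0// sqrtr_ge0.
by rewrite ler_wsqrtr//; lra.
Qed.

Lemma sqrt_ge1 (t : R) : 1 <= t -> 1 <= Num.sqrt t.
Proof. by move=> t1; rewrite -[leLHS]sqrtr1 ler_wsqrtr. Qed.

Section coupled_system.
Variables (d1 d2 c1 c2 x0 r eta : R).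
Hypotheses (d10 : 0 < d1) (d20 : 0 < d2) (r0 : 0 < r) (eta0 : 0 < eta).

Local Notation started := (started_above d1 d2 c1 c2 x0 r eta).
Local Notation gam := (c2 - c1).

(** For [t >= 1], [min (1, r / (l sqrt t))] is at least [min (1, r / l) / sqrt t], so the initial
    width [r] affects only the constant. *)
Lemma heat_decay : exists2 k : R, 0 < k & forall T f g, started T f g ->
  forall x t : R, 1 <= t -> (t%:E < T)%E ->
    `|x - x0 + c1 * t| <= Num.sqrt (4 * d1) * Num.sqrt t ->
    k / Num.sqrt t <= f x t.
Proof.
set l := Num.sqrt (4 * d1); have l0 : 0 < l by rewrite sqrtr_gt0 mulr_gt0.
have k00 : 0 < expR (- 4) / 8 * eta by rewrite mulr_gt0// divr_gt0// expR_gt0.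
exists (expR (- 4) / 8 * eta * Num.min 1 (r / l)).
  by rewrite mulr_gt0// min1_gt0// divr_gt0.
move=> T f g [[fs _] f_eta] x t t1 tT xt.
have t0 : 0 < t by lra.
have st1 := sqrt_ge1 t1; have st0 : 0 < Num.sqrt t by lra.
have wE : heat_width d1 0 t = l * Num.sqrt t by rewrite heat_widthM ?subr0// ltW.
apply: le_trans (heat_bound d10 fs _ r0 eta0 (lexx 0) t0 tT _ _) => //.
- rewrite wE -mulrA ler_wpM2l//; first exact: ltW.
  have -> : r / (l * Num.sqrt t) = r / l / Num.sqrt t by rewrite invfM mulrA.
  have q0 : 0 < r / l by rewrite divr_gt0.
  have m1 : Num.min 1 (r / l) <= 1 by rewrite ge_min lexx.
  have mq : Num.min 1 (r / l) <= r / l by rewrite ge_min lexx orbT.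
  rewrite le_min !ler_pdivrMr// mul1r divfK ?gt_eqF// mq andbT.
  by lra.
- by move=> y s; exact: sqr_ge0.
- by move=> y; rewrite mulr0 addr0; exact: f_eta.
- by rewrite le_max wE xt orbT.
Qed.

(** Covers the bounded range of times before the asymptotic lemmas apply: there the heat factor is
    at least its value at [t1]. *)
Lemma early_bound (t1 : R) : 0 < t1 -> exists2 k : R, 0 < k & forall T f g,
  started T f g -> forall x t : R, 0 < t -> t <= t1 -> (t%:E < T)%E ->
    `|x - x0 + c1 * t| <= r / 2 -> k <= f x t.
Proof.
move=> t10; have w0 : 0 < heat_width d1 0 t1 by rewrite heat_width_gt0.
have k00 : 0 < expR (- 4) / 8 * eta by rewrite mulr_gt0// divr_gt0// expR_gt0.
exists (expR (- 4) / 8 * eta * Num.min 1 (r / heat_width d1 0 t1)).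
  by rewrite mulr_gt0// min1_gt0// divr_gt0.
move=> T f g [[fs _] f_eta] x t t0 tt1 tT xt.
apply: le_trans (heat_bound d10 fs _ r0 eta0 (lexx 0) t0 tT _ _) => //.
- rewrite ler_wpM2l ?(ltW k00)// le_min ge_min lexx/= ge_min; apply/orP; right.
  rewrite ler_wpM2l ?(ltW r0)// lef_pV2 ?posrE// ?heat_width_gt0//.
  by rewrite ler_wsqrtr// ler_wpM2l ?mulr_ge0 ?(ltW d10)// lerB.
- by move=> y s; exact: sqr_ge0.
- by move=> y; rewrite mulr0 addr0; exact: f_eta.
- by rewrite le_max xt.
Qed.

(* The frame of [g] drifts with velocity [gam] relative to the one of [f], so
   that a window of width [sqrt s] of [g] stays above the bulk of [f] for a
   time of order [sqrt s]. *)
Lemma emission : exists k : R, exists2 l : R, 0 < k /\ 0 < l &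
  forall T f g, started T f g -> forall x s : R, 2 <= s -> (s%:E < T)%E ->
    `|x - x0 + c1 * s| <= l * Num.sqrt s -> k / Num.sqrt s <= g x s.
Proof.
have [k k0 kP] := heat_decay.
set l := Num.sqrt (4 * d1) in kP; have l0 : 0 < l by rewrite sqrtr_gt0 mulr_gt0.
(* The source acts during [th sqrt s]. The bound 1/2 keeps this within [[s / 2, s]]; the other bound
   keeps the relative drift below [l sqrt s / 4]. With the window [l sqrt s / 4] the total is
   [l sqrt s / 2 <= l sqrt t], the region of [heat_decay]. *)
pose th := Num.min (1 / 2) (l / (4 * (`|gam| + 1))).
have g1 : 0 < 4 * (`|gam| + 1) by have := normr_ge0 gam; lra.
have th0 : 0 < th by rewrite lt_min !divr_gt0.
have th1 : th <= 1 / 2 by rewrite ge_min lexx.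
have th2 : `|gam| * th <= l / 4.
  have : th <= l / (4 * (`|gam| + 1)) by rewrite ge_min lexx orbT.
  by rewrite ler_pdivlMr//; nra.
pose m := 16 * th / l ^+ 2.
have m0 : 0 < m by rewrite divr_gt0 ?mulr_gt0// exprn_gt0.
have D0 : 0 < 1 + 2 * d2 * m by have := mulr_gt0 d20 m0; lra.
exists (3 / 4 * (k ^+ 2 / (1 + 2 * d2 * m)) * th), (l / 8).
  split; last by rewrite divr_gt0.
  by rewrite !mulr_gt0// ?invr_gt0// exprn_gt0.
move=> T f g fgs x s s2 sT xs; set S := Num.sqrt s in xs *.
have [[_ gs] _] := fgs.
have S1 : 1 <= S by apply: sqrt_ge1; lra.
have sE : s = S ^+ 2 by rewrite sqr_sqrtr//; lra.
have thS : th * S <= s / 2 by nra.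
have thS0 : 0 <= th * S by rewrite mulr_ge0 ?(ltW th0)//; lra.
have -> : 3 / 4 * (k ^+ 2 / (1 + 2 * d2 * m)) * th / S =
    3 / 4 * ((k ^+ 2 / s) / (1 + 2 * d2 * m)) * (s - (s - th * S)).
  by rewrite sE; field; rewrite !gt_eqF//; lra.
(* With the centre [x0 + gam * s] the moving frame of [g] meets that of [f] exactly at the final
   time [s]. *)
apply: (constant_source_bound (x0 := x0 + gam * s) (L := l * S / 4) (ltW d20) gs _ _ _ sT).
- by rewrite divr_gt0// mulr_gt0//; lra.
- by lra.
- by lra.
- by rewrite divr_ge0 ?sqr_ge0//; lra.
- rewrite subKr /m.
  have -> : 16 * th / l ^+ 2 * (l * S / 4) ^+ 2 = th * S ^+ 2 by field; rewrite gt_eqF.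
  by rewrite ler_wpM2l ?(ltW th0)// expr2; nra.
- move=> y t /andP[t1 t2] yt.
  have tT : (t%:E < T)%E by rewrite (le_lt_trans _ sT)// lee_fin.
  apply: (@sqr_ge_div k _ t); [exact: ltW|lra|by []|].
  apply: (kP T f g fgs y t) => //; first by lra.
  have -> : y - x0 + c1 * t = (y - (x0 + gam * s) + c2 * t) + gam * (s - t) by ring.
  apply: (le_trans (ler_normD _ _)); rewrite normrM.
  have st0 : 0 <= s - t by lra.
  have : `|gam| * `|s - t| <= `|gam| * (th * S).
    by rewrite ler_wpM2l// ger0_norm//; lra.
  have : S / 2 <= Num.sqrt t by apply: sqrt_half_ge; lra.
  move=> /(ler_wpM2l (ltW l0)); have : `|gam| * th * S <= l / 4 * S by rewrite ler_wpM2r//; lra.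
  by lra.
have -> : x - (x0 + gam * s) + c2 * s = x - x0 + c1 * s by ring.
by apply: (le_trans xs); lra.
Qed.

(** What [g] received at time [s - rho] is carried to the relative position [- gam * rho] at time
    [s]. As [rho <= s - rho], the box emitted is wide in comparison with the diffusion during [rho],
    so only a constant factor is lost. Varying [rho] sweeps out an interval of length of order
    [s]. *)
Lemma transport : exists2 k : R, 0 < k &
  forall T f g, started T f g -> forall x s rho : R, 4 <= s -> (s%:E < T)%E ->
    0 < rho <= s / 2 -> x - x0 + c1 * s = - (gam * rho) ->
    k / Num.sqrt s <= g x s.
Proof.
have [k [l [k0 l0] kP]] := emission.
set l' := Num.sqrt (4 * d2); have l'0 : 0 < l' by rewrite sqrtr_gt0 mulr_gt0.
have q0 : 0 < l / l' by rewrite divr_gt0.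
have e0 : 0 < expR (- 4 : R) / 8 by rewrite divr_gt0 ?expR_gt0.
exists (expR (- 4) / 8 * k * Num.min 1 (l / l')).
  by rewrite !mulr_gt0 ?min1_gt0// expR_gt0.
move=> T f g fgs x s rho s4 sT /andP[rho0 rhos] xE.
have [[_ gs] _] := fgs.
pose t0 := s - rho; have t0s : t0 < s by rewrite /t0; lra.
have t02 : 2 <= t0 by rewrite /t0; lra.
have t0T : (t0%:E < T)%E by rewrite (lt_trans _ sT)// lte_fin.
have S0 : 0 < Num.sqrt t0 by rewrite sqrtr_gt0; lra.
have eta'0 : 0 < k / Num.sqrt t0 by rewrite divr_gt0.
have r'0 : 0 < l * Num.sqrt t0 by rewrite mulr_gt0.
have wE : heat_width d2 t0 s = l' * Num.sqrt rho.
  by rewrite heat_widthM ?(ltW d20)// /t0 subKr.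
have rho_t0 : Num.sqrt rho <= Num.sqrt t0 by rewrite ler_wsqrtr// /t0; lra.
have srho : 0 < Num.sqrt rho by rewrite sqrtr_gt0.
have H : expR (- 4) / 8 * (k / Num.sqrt t0) *
    Num.min 1 (l * Num.sqrt t0 / heat_width d2 t0 s) <= g x s.
  apply: (heat_bound (x0 := x0 + gam * t0) d20 gs _ r'0 eta'0 _ t0s sT).
  - by move=> y t; exact: sqr_ge0.
  - by lra.
  - move=> y yt; apply: (kP T f g fgs y t0 t02 t0T).
    by apply: le_trans yt; rewrite le_eqVlt; apply/orP; left; apply/eqP; congr `|_|; ring.
  have -> : x - (x0 + gam * t0) + c2 * s = 0.
    have -> : x = x0 - c1 * s - gam * rho by lra.
    by rewrite /t0; ring.
  by rewrite normr0 le_max divr_ge0// ltW.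
apply: le_trans H; rewrite -!mulrA ler_wpM2l ?expR_ge0// ler_wpM2l// ler_wpM2l ?(ltW k0)//.
rewrite mulrC; have m0 : 0 < Num.min 1 (l / l') by exact: min1_gt0.
apply: ler_pM; rewrite ?invr_ge0 ?sqrtr_ge0 ?(ltW m0)//.
  by rewrite lef_pV2 ?posrE ?sqrtr_gt0// ?ler_wsqrtr//; lra.
rewrite le_min ge_min lexx/= ge_min; apply/orP; right.
have -> : l * (Num.sqrt t0 / heat_width d2 t0 s) = l / l' * (Num.sqrt t0 / Num.sqrt rho).
  by rewrite wE; field; rewrite !gt_eqF.
by rewrite ler_peMr ?(ltW q0)// ler_pdivlMr// mul1r.
Qed.

(** The window around [- gam * m] corresponds to delays [rho] between [m / 2] and [3 m / 2], which
    [3 m <= s] makes admissible. It is fixed in the frame of [f] for all such [s], as a parabolic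
    subsolution requires. *)
Lemma wide_region : gam != 0 -> exists2 k : R, 0 < k &
  forall T f g, started T f g -> forall x s m : R, 4 <= s -> (s%:E < T)%E ->
    0 < m -> 3 * m <= s -> `|x - (x0 - gam * m) + c1 * s| <= `|gam| * m / 2 ->
    k / s <= g x s ^+ 2.
Proof.
move=> gam0; have [k k0 kP] := transport.
exists (k ^+ 2); first by rewrite exprn_gt0.
move=> T f g fgs x s m s4 sT m0 ms xs.
apply: (@sqr_ge_div k _ s); [exact: ltW|lra|by []|].
set z := x - _ + _ in xs.
have zg : `|z / gam| <= m / 2.
  by rewrite normrM normfV ler_pdivrMr ?normr_gt0//; lra.
apply: (kP T f g fgs x s (m - z / gam)) => //.
  by move: zg; rewrite ler_norml => /andP[z1 z2]; apply/andP; split; lra.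
by rewrite mulrBr mulrCA divff// mulr1 /z; ring.
Qed.

Lemma mass_bound_drift : gam != 0 -> exists k : R, exists2 l : R, 0 < k /\ 0 < l &
  forall T f g, started T f g -> forall t : R, 8 <= t -> (t%:E < T)%E ->
    exists X : R, forall x, `|x - X| <= l * t -> k <= f x t.
Proof.
move=> gam0; have [k k0 kP] := wide_region gam0.
have g0 : 0 < `|gam| by rewrite normr_gt0.
(* With the half-width [L = |gam| t / 12] one gets [m L^2 = t^2 / 2], which dominates the duration
   [t / 2]. *)
pose m := 72 / `|gam| ^+ 2.
have m0 : 0 < m by rewrite divr_gt0// exprn_gt0.
have D0 : 0 < 1 + 2 * d1 * m by have := mulr_gt0 d10 m0; lra.
exists (3 / 8 * (k / (1 + 2 * d1 * m))), (`|gam| / 24).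
  by split; rewrite ?mulr_gt0 ?invr_gt0.
move=> T f g fgs t t8 tT; have [[fs _] _] := fgs.
have t0 : 0 < t by lra.
exists (x0 - gam * (t / 6) - c1 * t) => x xt.
have -> : 3 / 8 * (k / (1 + 2 * d1 * m)) =
    3 / 4 * (k / t / (1 + 2 * d1 * m)) * (t - t / 2).
  by field; rewrite !gt_eqF.
apply: (constant_source_bound (x0 := x0 - gam * (t / 6)) (L := `|gam| * t / 12) (ltW d10) fs _ _ _ tT).
- by rewrite divr_gt0// mulr_gt0.
- by lra.
- by lra.
- by rewrite divr_ge0 ?(ltW k0) ?(ltW t0).
- have -> : m * (`|gam| * t / 12) ^+ 2 = t ^+ 2 / 2 by rewrite /m; field; rewrite gt_eqF.
  by nra.
- move=> y s /andP[s1 s2] ys.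
  have sT : (s%:E < T)%E by rewrite (le_lt_trans _ tT)// lee_fin.
  apply: (@le_trans _ _ (k / s)); first by rewrite ler_wpM2l ?(ltW k0)// lef_pV2 ?posrE//; lra.
  apply: (kP T f g fgs y s (t / 6)) => //; try lra.
by move: xt; have -> : x - (x0 - gam * (t / 6) - c1 * t) = x - (x0 - gam * (t / 6)) + c1 * t; [ring|lra].
Qed.

(* At a fixed position in the frame of [f], the source is at least [k / s] for
   all times [s] between [t ^ (3/4)] and [t]. *)
Lemma log_bound_drift : gam != 0 -> exists2 k : R, 0 < k &
  forall T f g, started T f g -> forall t : R, 256 <= t -> (t%:E < T)%E ->
    exists x : R, k * ln t <= f x t.
Proof.
move=> gam0; have [k k0 kP] := wide_region gam0.
have g0 : 0 < `|gam| by rewrite normr_gt0.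
(* For [L = |gam| s0 / 6] the diffusive rate [2 d1 / L^2] equals [m / s0^2]. *)
pose m := 72 * d1 / `|gam| ^+ 2.
have m0 : 0 < m by rewrite divr_gt0 ?mulr_gt0// exprn_gt0.
have D0 : 0 < 1 + m by lra.
pose A := k / (1 + m); have A0 : 0 < A by rewrite divr_gt0.
exists (A / 4); first by rewrite divr_gt0.
move=> T f g fgs t t256 tT; have [[fs _] _] := fgs.
(* The start [s0 = q^3] balances two demands. It is late enough for diffusion: the relative loss is
   controlled by [s ln (s / s0) / s0^2 <= t q / s0^2 = q^5 / q^6 <= 1]. It is early enough for
   growth: [ln (t / s0) = ln q] is still a quarter of [ln t]. *)
pose q := Num.sqrt (Num.sqrt t).
have tE : t = q ^+ 4.
  by rewrite (_ : 4%N = (2 * 2)%N)// exprM sqr_sqrtr ?sqrtr_ge0// sqr_sqrtr//; lra.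
have q2 : 2 <= q.
  have q0 : 0 <= q by exact: sqrtr_ge0.
  rewrite leNgt; apply/negP => q2.
  have : q ^+ 2 < 4 by rewrite expr2; nra.
  have : 0 <= q ^+ 2 by exact: sqr_ge0.
  by move: t256; rewrite tE (_ : q ^+ 4 = q ^+ 2 * q ^+ 2); [nra|ring].
have q0 : 0 < q by lra.
pose s0 := q ^+ 3; have s00 : 0 < s0 by rewrite exprn_gt0.
have s0t : s0 <= t by rewrite tE /s0 [leRHS]exprSr ler_peMr ?exprn_ge0//; lra.
have s04 : 4 <= s0.
  have : q * 2 <= q * q by nra.
  by rewrite /s0 (_ : q ^+ 3 = q * q * q); [nra|ring].
have tq : t / s0 = q by rewrite tE /s0; field; rewrite gt_eqF.
have lnt : ln t = 4 * ln q by rewrite tE lnXn// mulr_natl.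
exists (x0 - gam * (s0 / 3) - c1 * t).
have aP s : s0 <= s <= t -> [/\ is_derive s 1 (fun s => A * (ln s - ln s0)) (A / s),
    0 <= A / s & 0 <= A * (ln s - ln s0) <= A * ln q].
  move=> /andP[s1 s2]; have sp : 0 < s by lra.
  split.
  - have dl := is_derive1_ln sp.
    by apply: is_derive_eq; rewrite /GRing.scale/=; ring.
  - by rewrite divr_ge0// ltW.
  rewrite -ln_div ?posrE//; apply/andP; split.
    by rewrite mulr_ge0 ?(ltW A0)// ln_ge0// ler_pdivlMr// mul1r.
  rewrite ler_wpM2l ?(ltW A0)// ler_ln ?posrE ?divr_gt0//.
  by rewrite -tq ler_wpM2r// invr_ge0 ltW.
have L0 : 0 < `|gam| * s0 / 6 by rewrite divr_gt0// mulr_gt0.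
have := source_bound (x0 := x0 - gam * (s0 / 3)) (ltW d10) fs L0 (ltW s00) s0t tT aP.
rewrite subrr mulr0 => /(_ erefl) H.
apply: le_trans (H _ _ t _); last by rewrite s0t lexx.
  have -> : x0 - gam * (s0 / 3) - c1 * t - (x0 - gam * (s0 / 3)) + c1 * t = 0 by ring.
  rewrite expr0n/= mul0r subr0 mulr1 -ln_div ?posrE//; last by lra.
  by rewrite tq lnt; lra.
move=> y s /andP[s1 s2] ys.
have sp : 0 < s by lra.
have sT : (s%:E < T)%E by rewrite (le_lt_trans _ tT)// lee_fin.
apply: (@le_trans _ _ (k / s)); last first.
  by apply: (kP T f g fgs y s (s0 / 3)) => //; lra.
have lnq : ln s - ln s0 <= q.
  have := aP s; rewrite (ltW s1) s2 => /(_ isT)[_ _ /andP[_]]; rewrite ler_pM2l// => H1.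
  by apply: (le_trans H1); have := @ln_sublinear _ q q0; lra.
have key : s * (ln s - ln s0) <= s0 ^+ 2.
  apply: (@le_trans _ _ (t * q)).
    apply: ler_pM => //; first exact: ltW.
    by have := aP s; rewrite (ltW s1) s2 => /(_ isT)[_ _ /andP[+ _]]; rewrite pmulr_rge0.
  rewrite tE /s0 -exprSr -exprM; apply: ler_weXn2l => //; lra.
rewrite ler_pdivlMr//.
have -> : (A / s + 2 * d1 * (A * (ln s - ln s0)) / (`|gam| * s0 / 6) ^+ 2) * s =
    A * (1 + m * (s * (ln s - ln s0) / s0 ^+ 2)).
  by rewrite /m; field; rewrite !gt_eqF.
rewrite /A mulrAC ler_pdivrMr// ler_pM2l// lerD2l ger_pMr//.
by rewrite ler_pdivrMr ?mul1r// exprn_gt0.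
Qed.

End coupled_system.
End growth.

Section growth_bound.
Context {R : realType}.
Implicit Types (f g : R -> R -> R) (T : \bar R).
Variables (d1 d2 c1 c2 x0 r eta : R).
Hypotheses (d10 : 0 < d1) (d20 : 0 < d2) (r0 : 0 < r) (eta0 : 0 < eta).

Local Notation started := (started_above d1 d2 c1 c2 x0 r eta).

Lemma no_drift_bound : c2 = c1 -> exists k : R, exists2 l : R, 0 < k /\ 0 < l &
  forall T f g, started T f g -> forall t : R, 4 <= t -> (t%:E < T)%E ->
    exists X : R, forall x, `|x - X| <= l * Num.sqrt t -> k * t <= f x t.
Proof.
move=> c21; have [k k0 kP] := heat_decay d2 c1 c2 x0 d10 r0 eta0.
set l := Num.sqrt (4 * d1) in kP; have l0 : 0 < l by rewrite sqrtr_gt0 mulr_gt0.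
have l20 : 0 < l ^+ 2 by rewrite exprn_gt0.
(* This [m] and the later [m'] make [m L^2] exactly the duration [t / 2], for [L = l sqrt t / 2] and
   [L = l sqrt t / 8] respectively. *)
pose m := 2 / l ^+ 2; have m0 : 0 < m by rewrite divr_gt0.
have D0 : 0 < 1 + 2 * d2 * m by have := mulr_gt0 d20 m0; lra.
pose k' := 3 / 8 * (k ^+ 2 / (1 + 2 * d2 * m)).
have k'0 : 0 < k' by rewrite mulr_gt0 ?divr_gt0// exprn_gt0.
have k'P T f g : started T f g -> forall x t : R, 2 <= t -> (t%:E < T)%E ->
    `|x - x0 + c1 * t| <= l / 4 * Num.sqrt t -> k' <= g x t.
  move=> fgs x t t2 tT xt; have [[_ gs] _] := fgs.
  have t0 : 0 < t by lra.
  have -> : k' = 3 / 4 * (k ^+ 2 / t / (1 + 2 * d2 * m)) * (t - t / 2).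
    by rewrite /k'; field; rewrite !gt_eqF.
  have S0 : 0 < Num.sqrt t by rewrite sqrtr_gt0.
  apply: (constant_source_bound (x0 := x0) (L := l * Num.sqrt t / 2) (ltW d20) gs _ _ _ tT).
  - by rewrite divr_gt0// mulr_gt0.
  - by lra.
  - by lra.
  - by rewrite divr_ge0 ?sqr_ge0 ?(ltW t0).
  - rewrite expr_div_n exprMn (sqr_sqrtr (ltW t0)) /m le_eqVlt; apply/orP; left.
    by apply/eqP; field; rewrite gt_eqF.
  - move=> y s /andP[s1 s2] ys.
    have sT : (s%:E < T)%E by rewrite (le_lt_trans _ tT)// lee_fin.
    apply: (@sqr_ge_div _ k _ s); [exact: ltW|lra|by []|].
    apply: (kP T f g fgs y s) => //; first by lra.
    rewrite -c21; apply: (le_trans ys).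
    by rewrite -mulrA ler_wpM2l ?(ltW l0)//; apply: sqrt_half_ge; lra.
  by rewrite c21; apply: (le_trans xt); lra.
pose m' := 32 / l ^+ 2; have m'0 : 0 < m' by rewrite divr_gt0.
have D'0 : 0 < 1 + 2 * d1 * m' by have := mulr_gt0 d10 m'0; lra.
exists (3 / 8 * (k' ^+ 2 / (1 + 2 * d1 * m'))), (l / 16).
  by split; rewrite ?divr_gt0// mulr_gt0 ?divr_gt0// exprn_gt0.
move=> T f g fgs t t4 tT; have [[fs _] _] := fgs.
have t0 : 0 < t by lra.
have S0 : 0 < Num.sqrt t by rewrite sqrtr_gt0.
exists (x0 - c1 * t) => x xt.
have -> : 3 / 8 * (k' ^+ 2 / (1 + 2 * d1 * m')) * t =
    3 / 4 * (k' ^+ 2 / (1 + 2 * d1 * m')) * (t - t / 2) by field; rewrite gt_eqF.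
apply: (constant_source_bound (x0 := x0) (L := l * Num.sqrt t / 8) (ltW d10) fs _ _ _ tT).
- by rewrite divr_gt0// mulr_gt0.
- by lra.
- by lra.
- exact: sqr_ge0.
- rewrite expr_div_n exprMn (sqr_sqrtr (ltW t0)) /m' le_eqVlt; apply/orP; left.
  by apply/eqP; field; rewrite gt_eqF.
- move=> y s /andP[s1 s2] ys.
  have sT : (s%:E < T)%E by rewrite (le_lt_trans _ tT)// lee_fin.
  have gk : k' <= g y s.
    apply: (k'P T f g fgs) => //; first by lra.
    apply: (le_trans ys); have := sqrt_half_ge (ltW t0) s1.
    by move=> /(ler_wpM2l (ltW l0)); lra.
  by rewrite lerXn2r// nnegrE (le_trans (ltW k'0)).
by move: xt; rewrite opprB addrA; have -> : x + c1 * t - x0 = x - x0 + c1 * t; [ring|lra].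
Qed.

(* The last conjunct bounds the mass of [f] from below by the one of a box. *)
Lemma growth_bound : exists2 k : R, 0 < k & forall T f g, started T f g ->
  forall t : R, 0 < t -> (t%:E < T)%E ->
    (exists x : R, k * ln (1 + t) <= f x t) /\
    (exists X l m : R, [/\ 0 < l, 0 < m, forall x, `|x - X| <= l -> m <= f x t &
      k * t <= l * m]).
Proof.
have [k1 k10 k1P] : exists2 k : R, 0 < k & forall T f g, started T f g ->
    forall t : R, 256 <= t -> (t%:E < T)%E ->
    (exists x : R, k * ln (1 + t) <= f x t) /\
    (exists X l m : R, [/\ 0 < l, 0 < m, forall x, `|x - X| <= l -> m <= f x t &
      k * t <= l * m]).
  have [c21|c21] := eqVneq c2 c1.
    have [k [l [k0 l0] kP]] := no_drift_bound c21.
    exists (Num.min k (l * k)); first by rewrite lt_min k0 mulr_gt0.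
    have m1 : Num.min k (l * k) <= k by rewrite ge_min lexx.
    have m2 : Num.min k (l * k) <= l * k by rewrite ge_min lexx orbT.
    move=> T f g fgs t t256 tT.
    have t0 : 0 < t by lra.
    have S1 : 1 <= Num.sqrt t by apply: sqrt_ge1; lra.
    have t4 : 4 <= t by lra.
    have [X XP] := kP T f g fgs t t4 tT; split.
      exists X; apply: le_trans (XP X _); last first.
        by rewrite subrr normr0 mulr_ge0// ltW.
      apply: ler_pM => //; first by rewrite le_min (ltW k0) mulr_ge0 ?ltW.
        by rewrite ln_ge0//; lra.
      by apply: le_ln1Dx; lra.
    exists X, (l * Num.sqrt t), (k * t); split => //.
    - by rewrite mulr_gt0//; lra.
    - by rewrite mulr_gt0.
    have : l * (k * t) <= l * Num.sqrt t * (k * t).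
      by rewrite ler_wpM2r ?mulr_ge0 ?(ltW k0) ?(ltW t0)// ler_peMr// ltW.
    by have := ler_wpM2r (ltW t0) m2; lra.
  have gam0 : c2 - c1 != 0 by rewrite subr_eq0.
  have [k [l [k0 l0] kP]] := mass_bound_drift x0 d10 d20 r0 eta0 gam0.
  have [k' k'0 k'P] := log_bound_drift x0 d10 d20 r0 eta0 gam0.
  exists (Num.min (k' / 2) (l * k)); first by rewrite lt_min divr_gt0// mulr_gt0.
  have m1 : Num.min (k' / 2) (l * k) <= k' / 2 by rewrite ge_min lexx.
  have m2 : Num.min (k' / 2) (l * k) <= l * k by rewrite ge_min lexx orbT.
  move=> T f g fgs t t256 tT; have t0 : 0 < t by lra.
  split.
    have [x xP] := k'P T f g fgs t t256 tT; exists x; apply: le_trans xP.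
    have : ln (1 + t) <= 2 * ln t.
      rewrite mulr_natl -lnXn// ler_ln ?posrE ?exprn_gt0//; last by lra.
      by rewrite expr2; nra.
    have l1t : 0 <= ln (1 + t) by rewrite ln_ge0//; lra.
    by have := ler_wpM2r l1t m1; nra.
  have t8 : 8 <= t by lra.
  have [X XP] := kP T f g fgs t t8 tT.
  exists X, (l * t), k; split => //; first by rewrite mulr_gt0.
  by have := ler_wpM2r (ltW t0) m2; lra.
(* Before time 256 a box of height [k2] and half-width [r / 2] persists; with [ln (1 + t) <= t] both
   estimates become a choice of constants. *)
have [k2 k20 k2P] := early_bound d2 c1 c2 x0 d10 r0 eta0 (ltr0n R 256).
pose k3 := Num.min (k2 / 256) (r / 2 * k2 / 256).
have k30 : 0 < k3.
  have rk : 0 < r / 2 * k2 by rewrite mulr_gt0 ?divr_gt0 ?ltr0n.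
  by rewrite lt_min !divr_gt0 ?ltr0n.
have k31 : k3 <= k2 / 256 by rewrite ge_min lexx.
have k32 : k3 <= r / 2 * k2 / 256 by rewrite ge_min lexx orbT.
exists (Num.min k1 k3); first by rewrite lt_min k10.
move=> T f g fgs t t0 tT.
have l0 : 0 <= ln (1 + t) by rewrite ln_ge0//; lra.
have [t256|t256] := lerP 256 t.
  have [[x xP] [X [l [m [l1 m1 lm kt]]]]] := k1P T f g fgs t t256 tT.
  have kk : Num.min k1 k3 <= k1 by rewrite ge_min lexx.
  split; first by exists x; apply: le_trans xP; rewrite ler_wpM2r.
  exists X, l, m; split => //; apply: le_trans kt.
  by rewrite ler_wpM2r// ltW.
have kk : Num.min k1 k3 <= k3 by rewrite ge_min lexx orbT.
have box x : `|x - (x0 - c1 * t)| <= r / 2 -> k2 <= f x t.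
  move=> xr; apply: (k2P T f g fgs x t t0 (ltW t256) tT).
  by rewrite (_ : x - x0 + c1 * t = x - (x0 - c1 * t))//; ring.
split.
  exists (x0 - c1 * t); apply: le_trans (box _ _); last first.
    by rewrite subrr normr0 divr_ge0// ltW.
  have : ln (1 + t) <= t by apply: le_ln1Dx; lra.
  have := ler_wpM2r l0 (le_trans kk k31).
  by nra.
exists (x0 - c1 * t), (r / 2), k2; split => //; first by rewrite divr_gt0.
have := ler_wpM2r (ltW t0) (le_trans kk k32).
have : 0 < r / 2 * k2 by rewrite mulr_gt0// divr_gt0.
by nra.
Qed.

End growth_bound.

(** * From classical solutions to the growth estimate *)

Section norms.
Context {R : realType}.
Implicit Types (p : R * R) (z : R -> R * R).

Lemma euclid_ge0 p : 0 <= euclid p.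
Proof. exact: sqrtr_ge0. Qed.

Lemma euclid_ge1 p : `|p.1| <= euclid p.
Proof. by rewrite -sqrtr_sqr ler_wsqrtr// lerDl sqr_ge0. Qed.

Lemma euclid_ge2 p : `|p.2| <= euclid p.
Proof. by rewrite -sqrtr_sqr ler_wsqrtr// lerDr sqr_ge0. Qed.

Lemma euclid_le p : euclid p <= `|p.1| + `|p.2|.
Proof.
rewrite -(ger0_norm (addr_ge0 (normr_ge0 p.1) (normr_ge0 p.2))) -sqrtr_sqr.
rewrite ler_wsqrtr// -(real_normK (num_real p.1)) -(real_normK (num_real p.2)).
by have := mulr_ge0 (normr_ge0 p.1) (normr_ge0 p.2); nra.
Qed.

Lemma sup_norm_ge z x : ((euclid (z x))%:E <= sup_norm z)%E.
Proof. by apply: ereal_sup_ubound; exists x. Qed.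

Lemma sup_norm_le z (C : \bar R) :
  (forall x, (euclid (z x))%:E <= C)%E -> (sup_norm z <= C)%E.
Proof. by move=> H; apply: ge_ereal_sup => _ [x _ <-]. Qed.

Lemma L1_norm_ge z (X l m : R) : continuous z -> 0 < l -> 0 < m ->
  (forall x, `|x - X| <= l -> m <= euclid (z x)) -> ((l * m)%:E <= L1_norm z)%E.
Proof.
move=> zc l0 m0 zm; rewrite /L1_norm Lnorm1.
pose D : set R := `[X - l, X + l]%classic.
have Dm : measurable D by exact: measurable_itv.
have ec : continuous (fun x => euclid (z x)).
  move=> x; apply: (continuous_comp (f := fun x => (z x).1 ^+ 2 + (z x).2 ^+ 2)).
    have c1 : {for x, continuous (fun x => (z x).1)}.
      by apply: (continuous_comp (g := fst)); [exact: zc|exact: cvg_fst].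
    have c2 : {for x, continuous (fun x => (z x).2)}.
      by apply: (continuous_comp (g := snd)); [exact: zc|exact: cvg_snd].
    by apply: cvgD; rewrite expr2; apply: cvgM.
  exact: sqrt_continuous.
have em : measurable_fun [set: R] (abse \o (EFin \o (fun x => euclid (z x)))).
  apply: measurableT_comp => //; apply/measurable_EFinP.
  exact: measurable_realfun.continuous_measurable_fun.
apply: (@le_trans _ _ (\int[lebesgue_measure]_(x in D) (m%:E))%E).
  rewrite integral_cst//= /D lebesgue_measure_itv/= lte_fin.
  have -> : X - l < X + l by lra.
  by rewrite -EFinD -EFinM lee_fin; nra.
apply: (@le_trans _ _ (\int[lebesgue_measure]_(x in D) `|(euclid (z x))%:E|)%E).
  apply: ge0_le_integral => //.
  - by move=> x _; rewrite lee_fin ltW.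
  - exact: measurable_funTS.
  - move=> x; rewrite /D/= in_itv/= => /andP[x1 x2].
    rewrite lee_fin (le_trans (zm x _)) ?ler_norm//.
    by rewrite ler_norml; lra.
by apply: ge0_subset_integral.
Qed.

End norms.

Section classical_solutions.
Context {R : realType}.
Implicit Types (f u v : R -> R -> R) (T : \bar R).

Definition uniformly_continuous_in_time T f : Prop :=
  forall t0, time_interval T t0 -> forall e, 0 < e -> exists2 r, 0 < r &
    forall x t, time_interval T t -> `|t - t0| < r -> `|f x t - f x t0| <= e.

Lemma sup_norm_continuous_uniform T u v : sup_norm_continuous T u v ->
  uniformly_continuous_in_time T u /\ uniformly_continuous_in_time T v.
Proof.
move=> [_ H]; suff K t0 : time_interval T t0 -> forall e, 0 < e -> exists2 r, 0 < r &
    forall x t, time_interval T t -> `|t - t0| < r ->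
      euclid (slice u v t x - slice u v t0 x) <= e.
  split=> t0 t0T e e0; have [r r0 rP] := K t0 t0T e e0;
    exists r => // x t tT tr; apply: le_trans (rP x t tT tr).
    exact: (euclid_ge1 (slice u v t x - slice u v t0 x)).
  exact: (euclid_ge2 (slice u v t x - slice u v t0 x)).
move=> t0T e e0.
have N : nbhs (0%E : \bar R) [set y | (y < e%:E)%E].
  by apply: open_nbhs_nbhs; split; [exact: open_ereal_lt_ereal|rewrite /= lte_fin].
have : \forall t \near within (time_interval T) (nbhs t0),
  (sup_norm (slice u v t - slice u v t0)%R < e%:E)%E := H t0 t0T _ N.
rewrite near_withinE => /nbhs_ballP[r r0 rP].
exists r => // x t tT tr; rewrite -lee_fin.
apply: le_trans (ltW (rP t _ tT)); last by rewrite -ball_normE/= distrC.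
exact: (sup_norm_ge (slice u v t - slice u v t0)).
Qed.

(** The strip may include [t = 0], where interior regularity says nothing. The time modulus is
    uniform in space, so the space increment can be taken inside the fixed slice [s]. *)
Lemma uniform_cont2 T f : uniformly_continuous_in_time T f ->
  (forall t, time_interval T t -> continuous (f^~ t)) ->
  forall t0 t1, 0 <= t0 -> (t1%:E < T)%E -> cont2 (strip t0 t1) f.
Proof.
move=> fu fc t0 t1 t00 t1T; apply/subspace_continuousP => -[x s] /= /andP[s0 s1].
have IT t : t0 <= t <= t1 -> time_interval T t.
  move=> /andP[a b]; split; first exact: le_trans a.
  by rewrite (le_lt_trans _ t1T)// lee_fin.
have sT : time_interval T s by apply: IT; rewrite s0.
apply/cvgrPdist_le => /= e e0.
have e20 : 0 < e / 2 by rewrite divr_gt0.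
have [r r0 rP] := fu s sT _ e20.
have /cvgrPdist_le/(_ _ e20)/nbhs_ballP[q q0 qP] := fc s sT x.
rewrite near_withinE; apply/nbhs_ballP; exists (Num.min r q) => /=; first by rewrite lt_min r0.
move=> [y t]; rewrite /ball/= => -[yq tr] /= /IT tT.
have {}yq : ball x q y by apply: le_ball yq; rewrite ge_min lexx orbT.
have {}tr : `|t - s| < r.
  by rewrite distrC; apply: (lt_le_trans tr); rewrite ge_min lexx.
have := rP y t tT tr; have := qP y yq; rewrite distrC => H1 H2.
rewrite distrC.
have -> : f y t - f x s = (f y t - f y s) + (f y s - f x s) by ring.
by rewrite (le_trans (ler_normD _ _))//; have := H1; have := H2; rewrite /=; lra.
Qed.

Lemma C21_jet T f x t : C21 T f -> 0 < t -> (t%:E < T)%E ->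
  jet_at f x t (dt f x t) (fun y => dx f y t) (dxx f x t).
Proof.
move=> fC t0 tT; split=> [|y|].
- have [[H _ _] _] := fC x t t0 tT.
  by rewrite /dt derive1E; exact: derivableP.
- have [[_ H _] _] := fC y t t0 tT.
  by rewrite /dx derive1E; exact: derivableP.
- have [[_ _ H] _] := fC x t t0 tT.
  by rewrite /dxx /dx derive1E; exact: derivableP.
Qed.

(** Interior bounds hold only on slabs away from [t = 0]; below a small [tau], uniform continuity in
    time compares with the initial values. *)
Lemma bounded_below T f (C t1 : R) : uniformly_continuous_in_time T f ->
  (forall x, `|f x 0| <= C) ->
  (forall tau T1 : R, 0 < tau -> tau < T1 -> (T1%:E < T)%E -> bounded_on_slab tau T1 f) ->
  (t1%:E < T)%E -> exists B, forall x t, 0 <= t <= t1 -> - B <= f x t.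
Proof.
move=> fu fC fb t1T; have [t10|t10] := lerP t1 0.
  exists C => x t /andP[t0 tt1].
  have -> : t = 0 by apply/eqP; rewrite eq_le t0 (le_trans tt1).
  by have := fC x; rewrite ler_norml => /andP[].
have T0 : time_interval T 0 by split => //; rewrite (lt_trans _ t1T)// lte_fin.
have [r r0 rP] := fu 0 T0 1 ltr01.
pose tau := Num.min (r / 2) (t1 / 2).
have tau0 : 0 < tau by rewrite lt_min !divr_gt0.
have tau1 : tau < t1 by rewrite (le_lt_trans (y := t1 / 2)) ?ge_min ?lexx ?orbT//; lra.
have taur : tau < r by rewrite (le_lt_trans (y := r / 2)) ?ge_min ?lexx//; lra.
have [D DP] := fb tau t1 tau0 tau1 t1T.
exists (C + 1 + `|D|) => x t /andP[t0 tt1].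
have tT : time_interval T t by split => //; rewrite (le_lt_trans _ t1T)// lee_fin.
have C0 : 0 <= C by exact: le_trans (fC x).
have [tt|tt] := lerP tau t.
  have := DP x t; rewrite tt tt1 => /(_ isT); rewrite ler_norml => /andP[+ _].
  by have := ler_norm D; lra.
have := rP x t tT; rewrite subr0 ger0_norm// => /(_ (lt_trans tt taur)).
have := fC x; rewrite !ler_norml => /andP[H1 _] /andP[H2 _].
by have := normr_ge0 D; lra.
Qed.

(** Nonnegativity of [f] is part of the conclusion: it follows from the maximum principle, since the
    source [g^2] is nonnegative whatever the sign of [g]. *)
Lemma classical_supersolution T d c f g (C : R) : 0 <= d ->
  uniformly_continuous_in_time T f ->
  (forall t, time_interval T t -> continuous (f^~ t)) ->
  C21 T f -> (forall x, 0 <= f x 0 <= C) ->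
  (forall tau T1 : R, 0 < tau -> tau < T1 -> (T1%:E < T)%E -> bounded_on_slab tau T1 f) ->
  (forall x t, 0 < t -> (t%:E < T)%E ->
     dt f x t = d * dxx f x t + c * dx f x t + g x t ^+ 2) ->
  supersolution T d c (fun x t => g x t ^+ 2) f.
Proof.
move=> d0 fu fc fC f0 fb fpde; split => //.
- move=> x t [t0 tT].
  have fB : forall x, `|f x 0| <= C by move=> y; rewrite ger0_norm; case/andP: (f0 y).
  have [B BP] := bounded_below fu fB fb tT.
  apply: (maximum_principle d0 (c := c) (uniform_cont2 fu fc (lexx 0) tT) BP).
  + by move=> y; case/andP: (f0 y).
  + move=> y s /andP[s0 st] _.
    have sT : (s%:E < T)%E by rewrite (le_lt_trans _ tT)// lee_fin.
    do 3 eexists; split; first exact: C21_jet fC s0 sT.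
    by rewrite fpde//; have := sqr_ge0 (g y s); lra.
  + by rewrite t0 lexx.
- exact: uniform_cont2.
- move=> x t t0 tT; do 3 eexists; split; first exact: C21_jet fC t0 tT.
  by rewrite fpde.
Qed.

Lemma classical_coupled (alpha d1 d2 c1 c2 : R) (u0 v0 : R -> R) T u v :
  0 <= d1 -> 0 <= d2 -> (forall x, 0 <= u0 x) -> (forall x, 0 <= v0 x) ->
  classical_solution alpha d1 d2 c1 c2 (fun x => (u0 x, v0 x)) T u v ->
  coupled T d1 d2 c1 c2 u v.
Proof.
move=> d10 d20 u00 v00 [T0 [ini [cont [[uC vC] [pde [ur vr]]]]]].
have [uu vu] := sup_norm_continuous_uniform cont.
have iniu x : u x 0 = u0 x by have := congr1 (fun h => (h x).1) ini.
have iniv x : v x 0 = v0 x by have := congr1 (fun h => (h x).2) ini.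
have T00 : time_interval T 0 by split.
have [_ bd0] := cont.1 0 T00.
have [C CP] : exists C : R, forall x, euclid (u x 0, v x 0) <= C.
  exists (fine (sup_norm (slice u v 0))) => x.
  have le := sup_norm_ge (slice u v 0) x.
  rewrite -lee_fin fineK// fin_numElt bd0 andbT.
  by apply: lt_le_trans le; rewrite ltNyr.
have uc t : time_interval T t -> continuous (u^~ t).
  move=> tT x; have [c _] := cont.1 t tT.
  by apply: (continuous_comp (f := slice u v t) (g := fst)); [exact: c|exact: cvg_fst].
have vc t : time_interval T t -> continuous (v^~ t).
  move=> tT x; have [c _] := cont.1 t tT.
  by apply: (continuous_comp (f := slice u v t) (g := snd)); [exact: c|exact: cvg_snd].
split.
- apply: (@classical_supersolution _ _ _ _ _ C) => //.
  + move=> x; rewrite iniu u00/= -iniu; apply: le_trans (CP x).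
    by apply: le_trans (ler_norm _) (euclid_ge1 (_, _)).
  + by move=> tau T1 a b e; have [[]] := ur tau T1 a b e.
  + by move=> x t t0 tT; have [] := pde x t t0 tT.
- apply: (@classical_supersolution _ _ _ _ _ C) => //.
  + move=> x; rewrite iniv v00/= -iniv; apply: le_trans (CP x).
    by apply: le_trans (ler_norm _) (euclid_ge2 (_, _)).
  + by move=> tau T1 a b e; have [[]] := vr tau T1 a b e.
  + by move=> x t t0 tT; have [] := pde x t t0 tT.
Qed.

Lemma holder_small (alpha C e : R) : 0 < alpha -> 0 < e -> exists2 r : R, 0 < r &
  forall h, 0 <= h <= r -> C * h `^ alpha <= e.
Proof.
move=> a0 e0; pose q := e / (`|C| + 1).
have C1 : 0 < `|C| + 1 by have := normr_ge0 C; lra.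
have q0 : 0 < q by rewrite divr_gt0.
exists (q `^ alpha^-1); first exact: powR_gt0.
move=> h /andP[h0 hr].
have : h `^ alpha <= q.
  rewrite -(powRr1 (ltW q0)) -(mulVf (lt0r_neq0 a0)) powRrM.
  by apply: ge0_ler_powR; rewrite ?nnegrE ?powR_ge0 ?(ltW a0).
have := powR_ge0 h alpha; set p := h `^ alpha => p0 pq.
apply: (@le_trans _ _ (`|C| * p)); first by rewrite ler_wpM2r// ler_norm.
by have : q * (`|C| + 1) = e by [rewrite /q divfK// gt_eqF|]; have := normr_ge0 C; nra.
Qed.

Lemma positive_near (alpha C x0 : R) (u0 : R -> R) : 0 < alpha ->
  (forall x y, `|u0 x - u0 y| <= C * `|x - y| `^ alpha) ->
  0 < u0 x0 -> exists r : R, exists2 eta : R, 0 < r /\ 0 < eta &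
    forall y, `|y - x0| <= r -> eta <= u0 y.
Proof.
move=> a0 uC u00; have e0 : 0 < u0 x0 / 2 by rewrite divr_gt0.
have [r r0 rP] := holder_small C a0 e0.
exists r, (u0 x0 / 2) => // y yr; have := uC y x0.
have := rP `|y - x0|; rewrite normr_ge0 yr => /(_ isT) H1 H2.
by have := le_trans H2 H1; rewrite ler_norml => /andP[]; lra.
Qed.

Lemma classical_growth (alpha d1 d2 c1 c2 : R) (u0 v0 : R -> R) :
  0 < alpha -> 0 < d1 -> 0 < d2 ->
  holder_space alpha (fun x => (u0 x, v0 x)) ->
  (fun x => (u0 x, v0 x)) <> (fun=> (0, 0)) ->
  (forall x, 0 <= u0 x) -> (forall x, 0 <= v0 x) ->
  exists2 c : R, 0 < c &
    forall T u v, classical_solution alpha d1 d2 c1 c2 (fun x => (u0 x, v0 x)) T u v ->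
    forall t : R, 0 <= t -> (t%:E < T)%E ->
      ((c * ln (1 + t))%:E <= sup_norm (slice u v t))%E /\
      ((c * t)%:E <= L1_norm (slice u v t))%E.
Proof.
move=> a0 d10 d20 [_ [C HC]] nz u00 v00.
have uH x y : `|u0 x - u0 y| <= C * `|x - y| `^ alpha.
  by apply: le_trans (HC x y); exact: (euclid_ge1 ((u0 x, v0 x) - (u0 y, v0 y))).
have vH x y : `|v0 x - v0 y| <= C * `|x - y| `^ alpha.
  by apply: le_trans (HC x y); exact: (euclid_ge2 ((u0 x, v0 x) - (u0 y, v0 y))).
suff [k k0 kP] : exists2 k : R, 0 < k & forall T u v,
    classical_solution alpha d1 d2 c1 c2 (fun x => (u0 x, v0 x)) T u v ->
    forall t : R, 0 < t -> (t%:E < T)%E ->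
    (exists x : R, k * ln (1 + t) <= euclid (u x t, v x t)) /\
    (exists X l m : R, [/\ 0 < l, 0 < m,
      forall x, `|x - X| <= l -> m <= euclid (u x t, v x t) & k * t <= l * m]).
  exists k => // T u v sol t; rewrite le_eqVlt => /predU1P[<- _|t0 tT].
    rewrite addr0 ln1 !mulr0; split; last by rewrite /L1_norm Lnorm_ge0.
    by apply: le_trans (sup_norm_ge (slice u v 0) 0); rewrite lee_fin euclid_ge0.
  have [[x xP] [X [l [m [l0 m0 lm km]]]]] := kP T u v sol t t0 tT.
  split; first by apply: le_trans (sup_norm_ge (slice u v t) x); rewrite lee_fin.
  apply: (@le_trans _ _ (l * m)%:E); first by rewrite lee_fin.
  have [_ [_ [cont _]]] := sol.
  by have [zc _] := cont.1 t (conj (ltW t0) tT); exact: (L1_norm_ge zc l0 m0 lm).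
have [[x0 ux0]|u0z] := pselect (exists x, 0 < u0 x).
  have [r [eta [r0 eta0] retaP]] := positive_near a0 uH ux0.
  have [k k0 kP] := growth_bound c1 c2 x0 d10 d20 r0 eta0.
  exists k => // T u v sol t t0 tT.
  have cp := classical_coupled (ltW d10) (ltW d20) u00 v00 sol.
  have st : started_above d1 d2 c1 c2 x0 r eta T u v.
    split => // y yr; have [_ [ini _]] := sol.
    by have /= -> := congr1 (fun h => (h y).1) ini; exact: retaP.
  have [[x xP] [X [l [m [l0 m0 lm km]]]]] := kP T u v st t t0 tT.
  have ue y : u y t <= euclid (u y t, v y t).
    by apply: le_trans (ler_norm _) (euclid_ge1 (_, _)).
  split; first by exists x; apply: le_trans (ue x).
  by exists X, l, m; split => // y /lm H; apply: le_trans (ue y).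
(* The system is invariant under exchanging the components together with their coefficients, so [v]
   now takes the role of [f]. *)
have [x0 vx0] : exists x, 0 < v0 x.
  apply: contrapT => v0z; apply: nz; apply/funext => x; congr (_, _).
    by apply/eqP; rewrite eq_le u00 andbT leNgt; apply/negP => ?; apply: u0z; exists x.
  by apply/eqP; rewrite eq_le v00 andbT leNgt; apply/negP => ?; apply: v0z; exists x.
have [r [eta [r0 eta0] retaP]] := positive_near a0 vH vx0.
have [k k0 kP] := growth_bound c2 c1 x0 d20 d10 r0 eta0.
exists k => // T u v sol t t0 tT.
have [cp1 cp2] := classical_coupled (ltW d10) (ltW d20) u00 v00 sol.
have st : started_above d2 d1 c2 c1 x0 r eta T v u.
  split => // y yr; have [_ [ini _]] := sol.
  by have /= -> := congr1 (fun h => (h y).2) ini; exact: retaP.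
have [[x xP] [X [l [m [l0 m0 lm km]]]]] := kP T v u st t t0 tT.
have ve y : v y t <= euclid (u y t, v y t).
  by apply: le_trans (ler_norm _) (euclid_ge2 (_, _)).
split; first by exists x; apply: le_trans (ve x).
by exists X, l, m; split => // y /lm H; apply: le_trans (ve y).
Qed.

End classical_solutions.

(** * Local existence: jets and the explicit Euler scheme *)

Section taylor.
Context {R : realType}.
Implicit Types (f : nat -> R -> R) (x y s h : R).

(** Derivatives are carried along as a sequence on which the scheme acts, so regularity estimates
    become sup bounds on its entries. *)
Definition is_jet f := forall k x, is_derive x 1 (f k) (f k.+1 x).

Lemma jet_lipschitz f (M : R) k x y : is_jet f -> (forall z, `|f k.+1 z| <= M) ->
  `|f k y - f k x| <= M * `|y - x|.
Proof.
move=> fJ fM; wlog xy : x y / x < y.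
  move=> H; have [xy|yx|->] := ltgtP x y; first exact: H.
    by rewrite distrC (distrC y); exact: H.
  by rewrite !subrr normr0 mulr0.
have [z _ ->] := MVT_is_derive xy (fJ k).
by rewrite normrM ler_wpM2r.
Qed.

Lemma jet_expansion f (M : R) k x h : is_jet f -> (forall z, `|f k.+2 z| <= M) ->
  `|f k (x + h) - f k x - h * f k.+1 x| <= M * h ^+ 2.
Proof.
move=> fJ fM.
have dF (y : R) : is_derive y 1 (fun z => f k z - (z - x) * f k.+1 x) (f k.+1 y - f k.+1 x).
  by have := fJ k y => ?; apply: is_derive_eq; rewrite /GRing.scale/= /cst; ring.
have M0 : 0 <= M by exact: le_trans (normr_ge0 _) (fM 0).
have fl := jet_lipschitz (k := k.+1) _ _ fJ fM.
have [->|h0] := eqVneq h 0.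
  by rewrite addr0 subrr mul0r subrr normr0 expr0n mulr0.
have E (a b : R) : a < b -> `|a - x| <= `|h| -> `|b - x| <= `|h| ->
    `|(f k b - (b - x) * f k.+1 x) - (f k a - (a - x) * f k.+1 x)| <= M * `|h| * (b - a).
  move=> ab ah bh; have [z /andP[az zb] ->] := MVT_is_derive ab dF.
  rewrite normrM (gtr0_norm (x := b - a)) ?subr_gt0// ler_wpM2r ?subr_ge0 ?(ltW ab)//.
  apply: (le_trans (fl x z)); rewrite ler_wpM2l//.
  move: ah bh; rewrite !ler_norml => /andP[a1 a2] /andP[b1 b2].
  by apply/andP; split; lra.
have [hp|hn] := ltrP 0 h.
  have := E x (x + h); rewrite ltrDl hp subrr normr0 addrAC subrr add0r lexx normr_ge0.
  move=> /(_ isT isT isT); rewrite mul0r subr0 (gtr0_norm hp) -mulrA -expr2.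
  by rewrite (_ : f k (x + h) - h * f k.+1 x - f k x = f k (x + h) - f k x - h * f k.+1 x)//; ring.
have {}hn : h < 0 by rewrite lt_neqAle h0.
have := E (x + h) x; rewrite gtrDl hn subrr normr0 addrAC subrr add0r lexx normr_ge0.
move=> /(_ isT isT isT); rewrite mul0r subr0 (ltr0_norm hn) distrC.
rewrite (_ : f k (x + h) - h * f k.+1 x - f k x = f k (x + h) - f k x - h * f k.+1 x); last by ring.
by rewrite (_ : M * - h * (x - (x + h)) = M * h ^+ 2)//; ring.
Qed.

Lemma second_difference f (M : R) k y s : is_jet f -> (forall z, `|f k.+2 z| <= M) ->
  0 <= s -> `|f k (y + s) + f k (y - s) - 2 * f k y| <= 2 * M * s ^+ 2.
Proof.
move=> fJ fM s0.
have := jet_expansion y s fJ fM; have := jet_expansion y (- s) fJ fM.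
rewrite sqrrN !ler_norml => /andP[a1 a2] /andP[b1 b2].
by apply/andP; split; lra.
Qed.

(** As functions of [s], the remainder and its first derivative vanish at 0, and its second
    derivative is a second difference of [f''], hence [O(s^2)]. Two applications of the mean value
    theorem raise this to [s^4]. *)
Lemma second_difference_expansion f (M : R) k y s : is_jet f ->
  (forall z, `|f k.+4 z| <= M) -> 0 <= s ->
  `|f k (y + s) + f k (y - s) - 2 * f k y - s ^+ 2 * f k.+2 y| <= 2 * M * s ^+ 4.
Proof.
move=> fJ fM s0.
have dp j (r : R) : is_derive r 1 (fun r => f j (y + r)) (f j.+1 (y + r)).
  have dl : is_derive r 1 (fun r => y + r) 1 by apply: is_derive_eq; rewrite /cst; ring.
  by have := is_derive_compose (g := fun r => y + r) (fJ j _) dl; rewrite mulr1.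
have dm j (r : R) : is_derive r 1 (fun r => f j (y - r)) (- f j.+1 (y - r)).
  have dl : is_derive r 1 (fun r => y - r) (- 1) by apply: is_derive_eq; rewrite /cst; ring.
  by have := is_derive_compose (g := fun r => y - r) (fJ j _) dl; rewrite mulrN1.
pose D2 r := f k.+2 (y + r) + f k.+2 (y - r) - 2 * f k.+2 y.
pose D1 r := f k.+1 (y + r) - f k.+1 (y - r) - 2 * r * f k.+2 y.
pose D0 r := f k (y + r) + f k (y - r) - 2 * f k y - r ^+ 2 * f k.+2 y.
have d1 (r : R) : is_derive r 1 D1 (D2 r).
  by have := dp k.+1 r => ?; have := dm k.+1 r => ?; apply: is_derive_eq;
    rewrite /GRing.scale/= /cst /D2; ring.
have d0 (r : R) : is_derive r 1 D0 (D1 r).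
  by have := dp k r => ?; have := dm k r => ?; apply: is_derive_eq;
    rewrite /GRing.scale/= /cst /D1; ring.
have B2 r : 0 <= r <= s -> `|D2 r| <= 2 * M * r ^+ 2.
  by move=> /andP[r0 _]; exact: second_difference.
have D10 : D1 0 = 0 by rewrite /D1 !addr0 !subr0; ring.
have D00 : D0 0 = 0 by rewrite /D0 !addr0 !subr0; ring.
by apply: (derive_growth d0 D00 (derive_growth d1 D10 B2)); rewrite s0 lexx.
Qed.

(** The derivative of order [k] of a product, unfolded into [2^k] terms instead of binomial
    coefficients. Counting these terms gives the 64 and 128 in the later bounds. *)
Fixpoint leibniz f g (k : nat) (x : R) : R :=
  if k is j.+1 then leibniz (fun i => f i.+1) g j x + leibniz f (fun i => g i.+1) j x
  else f 0 x * g 0 x.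

Lemma leibniz_is_jet f g : is_jet f -> is_jet g -> is_jet (leibniz f g).
Proof.
move=> + + k; elim: k f g => [|k IH] f g fJ gJ x /=.
  have := fJ 0 x => ?; have := gJ 0 x => ?.
  by apply: is_derive_eq; rewrite /GRing.scale/=; ring.
have fJ' : is_jet (fun i => f i.+1) by move=> j; exact: fJ.
have gJ' : is_jet (fun i => g i.+1) by move=> j; exact: gJ.
have := IH _ _ fJ' gJ x => ?; have := IH _ _ fJ gJ' x => ?.
exact: is_deriveD.
Qed.

Lemma leibniz_le f g (M N : R) n k x : (k <= n)%N ->
  (forall j x, (j <= n)%N -> `|f j x| <= M) ->
  (forall j x, (j <= n)%N -> `|g j x| <= N) ->
  `|leibniz f g k x| <= 2 ^+ n * (M * N).
Proof.
move=> kn fM gN; have M0 : 0 <= M by exact: le_trans (fM 0 0 _).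
have N0 : 0 <= N by exact: le_trans (gN 0 0 _).
apply: (@le_trans _ _ (2 ^+ k * (M * N))); last first.
  by rewrite ler_wpM2r ?mulr_ge0// ler_weXn2l// ler1n.
elim: k n kn f g fM gN => [|k IH] n kn f g fM gN /=.
  by rewrite normrM expr0 mul1r; apply: ler_pM => //; [exact: fM|exact: gN].
case: n kn fM gN => // n kn fM gN.
rewrite (le_trans (ler_normD _ _))// exprS -mulrA mulr_natl mulr2n lerD//.
  apply: (IH n) => // j y jn; first exact: fM.
  by apply: gN; rewrite (leq_trans jn).
apply: (IH n) => // j y jn; last exact: gN.
by apply: fM; rewrite (leq_trans jn).
Qed.

Lemma leibnizB f f' g g' k x : leibniz f g k x - leibniz f' g' k x =
  leibniz (fun j y => f j y - f' j y) g k x + leibniz f' (fun j y => g j y - g' j y) k x.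
Proof.
elim: k f f' g g' => [|k IH] f f' g g' /=; first by ring.
have -> : forall a b p q : R, a + b - (p + q) = (a - p) + (b - q) by move=> *; ring.
by rewrite !IH; ring.
Qed.

Lemma leibniz_dist f g (M D : R) n k x : (k <= n)%N ->
  (forall j x, (j <= n)%N -> `|f j x| <= M) ->
  (forall j x, (j <= n)%N -> `|g j x| <= M) ->
  (forall j x, (j <= n)%N -> `|f j x - g j x| <= D) ->
  `|leibniz f f k x - leibniz g g k x| <= 2 ^+ n.+1 * (M * D).
Proof.
move=> kn fM gM fgD; rewrite leibnizB (le_trans (ler_normD _ _))//.
have -> : 2 ^+ n.+1 * (M * D) = 2 ^+ n * (D * M) + 2 ^+ n * (M * D) by rewrite exprS; ring.
by apply: lerD; apply: leibniz_le.
Qed.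

End taylor.

(** * One step of the explicit scheme *)

Section euler_scheme.
Context {R : realType}.
Variables (d c : bool -> R).
Hypothesis d0 : forall b, 0 < d b.
Implicit Types (w : bool -> nat -> R -> R) (b : bool) (k n : nat) (x tau M D : R).

(** The shift [sqrt (2 d tau)] makes half the second-order term of the average equal to [d tau w''],
    as for a random walk. An average of translates does not increase sup norms, so the step is
    stable for every [tau] and loses no derivative. *)
Definition euler_step tau w b k x : R :=
  (w b k (x + c b * tau + Num.sqrt (2 * d b * tau)) +
   w b k (x + c b * tau - Num.sqrt (2 * d b * tau))) / 2 +
  tau * leibniz (w (~~ b)) (w (~~ b)) k x.

Definition generator w b k x : R :=
  d b * w b k.+2 x + c b * w b k.+1 x + leibniz (w (~~ b)) (w (~~ b)) k x.

Definition bounded_jet n M w : Prop := forall b k x, (k <= n)%N -> `|w b k x| <= M.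

Definition close_jet n D w w' : Prop :=
  forall b k x, (k <= n)%N -> `|w b k x - w' b k x| <= D.

Definition coef_bound : R := d true + d false + `|c true| + `|c false|.

Local Notation kap := coef_bound.

Let kap0 : 0 < kap.
Proof.
by rewrite /coef_bound; have := d0 true; have := d0 false; have := normr_ge0 (c true);
  have := normr_ge0 (c false); lra.
Qed.

Lemma coef_bound_ge0 : 0 <= kap.
Proof. exact: ltW. Qed.

Let dkap b : d b <= kap.
Proof.
by rewrite /coef_bound; have := d0 true; have := d0 false; have := normr_ge0 (c true);
  have := normr_ge0 (c false); case: b; lra.
Qed.

Let ckap b : `|c b| <= kap.
Proof.
by rewrite /coef_bound; have := d0 true; have := d0 false; have := normr_ge0 (c true);
  have := normr_ge0 (c false); case: b; lra.
Qed.

Lemma euler_step_jet tau w : (forall b, is_jet (w b)) ->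
  forall b, is_jet (euler_step tau w b).
Proof.
move=> wJ b k x.
have sh (e : R) : is_derive x 1 (fun y => w b k (y + c b * tau + e)) (w b k.+1 (x + c b * tau + e)).
  have dl : is_derive x 1 (fun y => y + c b * tau + e) 1.
    by apply: is_derive_eq; rewrite /cst; ring.
  by have := is_derive_compose (g := fun y => y + c b * tau + e) (wJ b k _) dl; rewrite mulr1.
have := sh (Num.sqrt (2 * d b * tau)) => ?; have := sh (- Num.sqrt (2 * d b * tau)) => ?.
have := leibniz_is_jet (wJ (~~ b)) (wJ (~~ b)) k x => ?.
by rewrite /euler_step; apply: is_derive_eq; rewrite /GRing.scale/= /cst; ring.
Qed.

Lemma bounded_jet_ge0 n M w : bounded_jet n M w -> 0 <= M.
Proof. by move=> H; exact: le_trans (H true 0%N 0 isT). Qed.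

Lemma average_le (p q M : R) : `|p| <= M -> `|q| <= M -> `|(p + q) / 2| <= M.
Proof. by rewrite !ler_norml => /andP[a1 a2] /andP[b1 b2]; apply/andP; split; lra. Qed.

Lemma euler_step_bounded tau M w : 0 <= tau -> bounded_jet 6 M w ->
  bounded_jet 6 (M + tau * (64 * M ^+ 2)) (euler_step tau w).
Proof.
move=> t0 wM b k x k6; rewrite (le_trans (ler_normD _ _))// lerD//.
  by apply: average_le; exact: wM.
rewrite normrM (ger0_norm t0) ler_wpM2l//.
have -> : 64 * M ^+ 2 = 2 ^+ 6 * (M * M) by ring.
by apply: leibniz_le => // j y; exact: wM.
Qed.

Lemma euler_step_stable tau M D n w w' : (n <= 6)%N -> 0 <= tau ->
  bounded_jet 6 M w -> bounded_jet 6 M w' -> close_jet n D w w' ->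
  close_jet n (D * (1 + 128 * M * tau)) (euler_step tau w) (euler_step tau w').
Proof.
move=> n6 t0 wM w'M ww b k x kn; rewrite /euler_step.
set p := w b k _; set q := w b k _; set p' := w' b k _; set q' := w' b k _.
set L := leibniz _ _ _ _; set L' := leibniz _ _ _ _.
have -> : (p + q) / 2 + tau * L - ((p' + q') / 2 + tau * L') =
  ((p - p') + (q - q')) / 2 + tau * (L - L') by ring.
rewrite (le_trans (ler_normD _ _))//.
have : `|(p - p' + (q - q')) / 2| <= D by apply: average_le; exact: ww.
have : `|tau * (L - L')| <= tau * (2 ^+ 7 * (M * D)).
  rewrite normrM (ger0_norm t0) ler_wpM2l//.
  have D0 : 0 <= D by exact: le_trans (normr_ge0 _) (ww b k x kn).
  have M0 := bounded_jet_ge0 wM.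
  apply: (@le_trans _ _ (2 ^+ n.+1 * (M * D))).
    by apply: leibniz_dist => // j y jn; [apply: wM|apply: w'M|apply: ww];
      rewrite ?(leq_trans jn).
  by rewrite ler_wpM2r ?mulr_ge0// ler_weXn2l// ler1n.
have -> : (2 : R) ^+ 7 = 128 by ring.
by lra.
Qed.

Let sigma tau b := Num.sqrt (2 * d b * tau).

Let sigma2 tau b : 0 <= tau -> sigma tau b ^+ 2 = 2 * d b * tau.
Proof. by move=> t0; rewrite sqr_sqrtr// !mulr_ge0// ltW. Qed.

Lemma euler_step_lipschitz tau M w : (forall b, is_jet (w b)) ->
  bounded_jet 6 M w -> 0 <= tau ->
  close_jet 4 ((3 * kap * M + 64 * M ^+ 2) * tau) (euler_step tau w) w.
Proof.
move=> wJ wM t0 b k x k4; rewrite /euler_step -/(sigma tau b).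
have M0 := bounded_jet_ge0 wM.
set s := sigma tau b; set y := x + c b * tau.
have fM j : (j <= 6)%N -> forall z, `|w b j z| <= M by move=> j6 z; exact: wM.
have k26 : (k.+2 <= 6)%N by [].
have H1 := second_difference y (wJ b) (fM _ k26) (sqrtr_ge0 _ : 0 <= s).
have k16 : (k.+1 <= 6)%N by exact: leq_ltn_trans k4 _.
have H2 := jet_lipschitz (k := k) x y (wJ b) (fM _ k16).
have H3 : `|tau * leibniz (w (~~ b)) (w (~~ b)) k x| <= tau * (64 * M ^+ 2).
  rewrite normrM (ger0_norm t0) ler_wpM2l//.
  have -> : 64 * M ^+ 2 = 2 ^+ 6 * (M * M) by ring.
  by apply: leibniz_le => //; [rewrite (leq_trans k4)|move=> j z; exact: wM|move=> j z; exact: wM].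
have H4 : `|y - x| <= kap * tau.
  by rewrite /y addrAC subrr add0r normrM (ger0_norm t0) ler_wpM2r// ckap.
have H5 : M * `|y - x| <= M * (kap * tau) by rewrite ler_wpM2l.
have H6 : M * (d b * tau) <= M * (kap * tau).
  by rewrite ler_wpM2l// ler_wpM2r// dkap.
move: H1; rewrite sigma2// => H1.
have {H2} : `|w b k y - w b k x| <= M * (kap * tau) by exact: le_trans H2 H5.
move: H1 H3; set L := tau * _; set p := w b k (y + s); set q := w b k (y - s).
rewrite !ler_norml => /andP[a1 a2] /andP[b1 b2] /andP[e1 e2].
by apply/andP; split; lra.
Qed.

(** The fourth-order remainder of the second difference needs four derivatives beyond order [k]. The
    6 is 4 from that remainder ([s^4 = (2 d tau)^2]), 1 from the second-order remainder of the drift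
    shift, and 1 from evaluating [w''] at the shifted point. *)
Lemma euler_step_consistent tau M w : (forall b, is_jet (w b)) ->
  bounded_jet 6 M w -> 0 <= tau -> forall b k x, (k <= 2)%N ->
  `|euler_step tau w b k x - w b k x - tau * generator w b k x| <=
    6 * kap ^+ 2 * M * tau ^+ 2.
Proof.
move=> wJ wM t0 b k x k2; rewrite /euler_step /generator -/(sigma tau b).
have M0 := bounded_jet_ge0 wM.
set s := sigma tau b; set y := x + c b * tau.
have fM j : (j <= 4)%N -> forall z, `|w b (j + k)%N z| <= M.
  by move=> j4 z; apply: wM; rewrite (@leq_add j k 4 2).
have H1 := second_difference_expansion y (wJ b) (fM 4%N isT) (sqrtr_ge0 _ : 0 <= s).
have H2 := jet_expansion x (c b * tau) (wJ b) (fM 2%N isT).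
have H3 := jet_lipschitz (k := k.+2) x y (wJ b) (fM 3%N isT).
have ss4 : s ^+ 4 = (2 * d b * tau) ^+ 2.
  by rewrite (_ : 4%N = (2 * 2)%N)// exprM sigma2.
have dd : d b ^+ 2 <= kap ^+ 2.
  by rewrite lerXn2r ?nnegrE ?(ltW kap0) ?dkap// ltW.
have t2 : 0 <= tau ^+ 2 by exact: sqr_ge0.
have E1 : M * (d b ^+ 2 * tau ^+ 2) <= M * (kap ^+ 2 * tau ^+ 2).
  by rewrite ler_wpM2l// ler_wpM2r.
have E2 : M * (c b * tau) ^+ 2 <= M * (kap ^+ 2 * tau ^+ 2).
  rewrite ler_wpM2l// exprMn ler_wpM2r// -real_normK ?num_real//.
  by rewrite lerXn2r ?nnegrE ?(ltW kap0) ?ckap.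
have E3 : `|d b * tau * (w b k.+2 y - w b k.+2 x)| <= M * (kap ^+ 2 * tau ^+ 2).
  rewrite normrM ger0_norm; last by rewrite mulr_ge0// ltW.
  have H4 : `|y - x| <= kap * tau.
    by rewrite /y addrAC subrr add0r normrM (ger0_norm t0) ler_wpM2r// ckap.
  have dt0 : 0 <= d b * tau by rewrite mulr_ge0// ltW.
  have dtk : d b * tau <= kap * tau by rewrite ler_wpM2r// dkap.
  apply: (@le_trans _ _ ((kap * tau) * (M * (kap * tau)))).
    apply: ler_pM => //; apply: (le_trans H3); rewrite ler_wpM2l//.
  by rewrite le_eqVlt; apply/orP; left; apply/eqP; ring.
move: H1 H2 E3; rewrite ss4 sigma2// -/y.
set p := w b k (y + s); set q := w b k (y - s); set L := leibniz _ _ _ _.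
rewrite !ler_norml => /andP[a1 a2] /andP[b1 b2] /andP[e1 e2].
by apply/andP; split; nra.
Qed.

Lemma generator_dist M D n w w' : (n <= 4)%N ->
  bounded_jet 6 M w -> bounded_jet 6 M w' -> close_jet n.+2 D w w' ->
  close_jet n ((2 * kap + 128 * M) * D) (generator w) (generator w').
Proof.
move=> n4 wM w'M ww b k x kn; rewrite /generator.
set p := w b k.+2 x; set q := w b k.+1 x; set p' := w' b k.+2 x; set q' := w' b k.+1 x.
set L := leibniz _ _ _ _; set L' := leibniz _ _ _ _.
have D0 : 0 <= D by exact: le_trans (normr_ge0 _) (ww b k x (leqW (leqW kn))).
have M0 := bounded_jet_ge0 wM.
have -> : d b * p + c b * q + L - (d b * p' + c b * q' + L') =
  d b * (p - p') + c b * (q - q') + (L - L') by ring.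
have H1 : `|d b * (p - p')| <= kap * D.
  by rewrite normrM ger0_norm ?(ltW (d0 b))//; apply: ler_pM => //; [exact: ltW|exact: ww].
have H2 : `|c b * (q - q')| <= kap * D.
  by rewrite normrM; apply: ler_pM => //; apply: ww; rewrite leqW.
have H3 : `|L - L'| <= 128 * M * D.
  apply: (@le_trans _ _ (2 ^+ n.+1 * (M * D))).
    apply: leibniz_dist => // j y jn; [apply: wM|apply: w'M|apply: ww].
    + by rewrite (leq_trans jn)// (leq_trans n4).
    + by rewrite (leq_trans jn)// (leq_trans n4).
    + by rewrite !leqW.
  have -> : 128 * M * D = 2 ^+ 7 * (M * D) by ring.
  by rewrite ler_wpM2r ?mulr_ge0// ler_weXn2l// ?ler1n// (leq_ltn_trans n4).
rewrite (le_trans (ler_normD _ _))// (le_trans (lerD (ler_normD _ _) (lexx _)))//.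
by lra.
Qed.

Lemma generator_bounded M w b k x : bounded_jet 6 M w -> (k <= 4)%N ->
  `|generator w b k x| <= 2 * kap * M + 64 * M ^+ 2.
Proof.
move=> wM k4; have M0 := bounded_jet_ge0 wM; rewrite /generator.
have H1 : `|d b * w b k.+2 x| <= kap * M.
  by rewrite normrM ger0_norm ?(ltW (d0 b))//; apply: ler_pM => //; [exact: ltW|exact: wM].
have H2 : `|c b * w b k.+1 x| <= kap * M.
  by rewrite normrM; apply: ler_pM => //; apply: wM; rewrite leqW.
have H3 : `|leibniz (w (~~ b)) (w (~~ b)) k x| <= 64 * M ^+ 2.
  have -> : 64 * M ^+ 2 = 2 ^+ 6 * (M * M) by ring.
  by apply: leibniz_le => //; [rewrite (leq_trans k4)|move=> j z; exact: wM|move=> j z; exact: wM].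
rewrite (le_trans (ler_normD _ _))// (le_trans (lerD (ler_normD _ _) (lexx _)))//.
by lra.
Qed.

(** Both the full step and the two half steps equal [w + tau * generator w] up to [O(tau^2)]: during
    a half step the jet moves by [O(tau)] up to order four, hence the generator moves by [O(tau)] up
    to order two. *)
Lemma euler_step_refine M : 0 <= M -> exists2 C : R, 0 <= C & forall tau w,
  (forall b, is_jet (w b)) -> 0 <= tau ->
  bounded_jet 6 M w -> bounded_jet 6 M (euler_step (tau / 2) w) ->
  close_jet 2 (C * tau ^+ 2) (euler_step (tau / 2) (euler_step (tau / 2) w)) (euler_step tau w).
Proof.
move=> M0; pose A1 := 3 * kap * M + 64 * M ^+ 2; pose A2 := 6 * kap ^+ 2 * M.
pose A3 := 2 * kap + 128 * M.
have k0 := ltW kap0.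
have A10 : 0 <= A1 by rewrite addr_ge0 ?mulr_ge0 ?sqr_ge0.
have A20 : 0 <= A2 by rewrite !mulr_ge0 ?sqr_ge0.
have A30 : 0 <= A3 by rewrite addr_ge0 ?mulr_ge0.
exists (2 * A2 + A3 * A1); first by rewrite addr_ge0 ?mulr_ge0.
move=> tau w wJ t0 wM w1M b k x k2.
have h0 : 0 <= tau / 2 by lra.
have H0 := euler_step_consistent wJ wM t0 b x k2.
have H1 := euler_step_consistent wJ wM h0 b x k2.
have H2 := euler_step_consistent (euler_step_jet (tau / 2) wJ) w1M h0 b x k2.
have H3 := generator_dist (n := 2) isT w1M wM (euler_step_lipschitz wJ wM h0) b x k2.
have H4 : `|tau / 2 * (generator (euler_step (tau / 2) w) b k x - generator w b k x)| <=
    tau / 2 * (A3 * (A1 * (tau / 2))).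
  by rewrite normrM (ger0_norm h0) ler_wpM2l.
move: H0 H1 H2 H4; rewrite -/A2.
have T2 : 0 <= A2 * tau ^+ 2 by rewrite mulr_ge0 ?sqr_ge0.
have T3 : 0 <= A3 * A1 * tau ^+ 2 by rewrite mulr_ge0 ?sqr_ge0// mulr_ge0.
rewrite !ler_norml => /andP[a1 a2] /andP[b1 b2] /andP[e1 e2] /andP[g1 g2].
by apply/andP; split; lra.
Qed.

End euler_scheme.

(** * Local existence: dyadic refinement *)

Section dyadic_limits.
Context {R : realType}.
Implicit Types (a b C : R) (m n : nat).

Lemma pow2_gt0 m : 0 < 2 ^+ m :> R.
Proof. exact: exprn_gt0. Qed.

Lemma le_of_dyadic a b C : (forall m, a <= b + C / 2 ^+ m) -> a <= b.
Proof.
move=> H; rewrite leNgt; apply/negP => ba.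
have ab0 : 0 < a - b by rewrite subr_gt0.
pose n := (Num.truncn (`|C| / (a - b))).+1.
have Cn : `|C| / (a - b) < n%:R by exact: truncnS_gt.
have n2 : n%:R <= 2 ^+ n :> R by rewrite -natrX ler_nat ltnW// ltn_expl.
have := lt_le_trans Cn n2; rewrite ltr_pdivrMr// => K.
have := H n; rewrite -lerBlDl ler_pdivlMr ?pow2_gt0// => H1.
by have := ler_norm C; nra.
Qed.

(** The tail of the increments from index [m] sums to at most [2 C / 2^m], so the intervals of that
    radius around [u m] are nested; the supremum of their left ends lies in all of them. *)
Lemma geometric_limit (u : nat -> R) C : (forall m, `|u m.+1 - u m| <= C / 2 ^+ m) ->
  exists l : R, forall m, `|u m - l| <= 2 * C / 2 ^+ m.
Proof.
move=> uC; pose lo m := u m - 2 * C / 2 ^+ m; pose up m := u m + 2 * C / 2 ^+ m.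
have half m : 2 * C / 2 ^+ m.+1 = C / 2 ^+ m.
  by rewrite exprS; field; rewrite gt_eqF// pow2_gt0.
have los m : lo m <= lo m.+1.
  rewrite /lo half; have := uC m; rewrite ler_norml => /andP[H _].
  by lra.
have ups m : up m.+1 <= up m.
  rewrite /up half; have := uC m; rewrite ler_norml => /andP[_ H].
  by lra.
have lom m n : lo m <= lo (m + n)%N.
  by elim: n => [|n IH]; rewrite ?addn0// addnS (le_trans IH).
have upm m n : up (m + n)%N <= up m.
  by elim: n => [|n IH]; rewrite ?addn0// addnS (le_trans (ups _)).
have C0 : 0 <= C.
  by have := uC 0%N; rewrite expr0 divr1; exact: le_trans.
have lu m : lo m <= up m.
  have : 0 <= 2 * C / 2 ^+ m by rewrite divr_ge0 ?mulr_ge0 ?(ltW (pow2_gt0 m)).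
  by rewrite /lo /up; lra.
have loup m n : lo m <= up n.
  by apply: (le_trans (lom m n)); apply: (le_trans (lu _)); rewrite addnC.
exists (sup (range lo)) => m.
have hs : has_sup (range lo).
  by split; [exists (lo 0%N), 0%N|exists (up 0%N) => _ [n _ <-]].
have H1 : lo m <= sup (range lo) by apply: sup_upper_bound => //; exists m.
have H2 : sup (range lo) <= up m by apply: ge_sup; [exists (lo 0%N), 0%N|move=> _ [n _ <-]].
by move: H1 H2; rewrite /lo /up ler_norml => H1 H2; apply/andP; split; lra.
Qed.

Lemma powD1_le_expR a n : 0 <= a -> (1 + a) ^+ n <= expR (a * n%:R).
Proof.
move=> a0; rewrite mulrC expRM_natl lerXn2r ?nnegrE ?expR_ge0//; first by lra.
exact: expR_ge1Dx.
Qed.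

End dyadic_limits.

(** * Uniform bounds and convergence of the Euler orbits *)

Section euler_limit.
Context {R : realType}.
Variables (d c : bool -> R) (w0 : bool -> nat -> R -> R) (M0 : R).
Hypotheses (d0 : forall b, 0 < d b) (w0J : forall b, is_jet (w0 b))
  (M00 : 0 < M0) (w0M : bounded_jet 6 M0 w0).
Implicit Types (b : bool) (k m n p : nat) (x t tau : R).

Definition euler_orbit tau n := iter n (euler_step d c tau) w0.

(** The bound [B] of the six derivatives grows at rate [64 B^2]. While [B <= 2 M0] this is at most
    [256 M0^2], so doubling [M0] takes at least this long. *)
Definition existence_time : R := (256 * M0)^-1.

Local Notation T0 := existence_time.
Local Notation M := (2 * M0).
Local Notation kap := (coef_bound d c).

Let T00 : 0 < T0. Proof. by rewrite invr_gt0 mulr_gt0 ?ltr0n. Qed.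

Let M_ge0 : 0 <= M. Proof. by rewrite mulr_ge0// ltW. Qed.

Lemma euler_orbitS tau n : euler_orbit tau n.+1 = euler_step d c tau (euler_orbit tau n).
Proof. by []. Qed.

Lemma euler_orbit_jet tau n b : is_jet (euler_orbit tau n b).
Proof. by elim: n b => [|n IH] b //; rewrite euler_orbitS; exact: euler_step_jet. Qed.

Lemma euler_orbit_bounded tau n : 0 <= tau -> n%:R * tau <= T0 -> bounded_jet 6 M (euler_orbit tau n).
Proof.
move=> t0 nT; pose K := 256 * M0 ^+ 2.
have K0 : 0 <= K by rewrite mulr_ge0 ?ler0n ?sqr_ge0.
have key : T0 * K = M0.
  by rewrite /existence_time /K; field; rewrite gt_eqF.
have K4 : 64 * M ^+ 2 = K by rewrite /K; ring.
move: K K0 key K4 => K K0 key K4.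
have small q : q <= T0 -> M0 + q * K <= M.
  by move=> qT; have := ler_wpM2r K0 qT; rewrite key; lra.
suff H : bounded_jet 6 (M0 + n%:R * tau * K) (euler_orbit tau n).
  by move=> b k x k6; apply: (le_trans (H b k x k6)); exact: small.
elim: n nT => [|n IH] nT.
  by move=> b k x k6; rewrite mul0r mul0r addr0; exact: w0M.
have nT' : n%:R * tau <= T0.
  by apply: le_trans nT; rewrite ler_wpM2r// ler_nat.
rewrite euler_orbitS => b k x k6; apply: (le_trans (euler_step_bounded d c t0 (IH nT') b x k6)).
have n0 : 0 <= n%:R * tau by rewrite mulr_ge0.
have := small _ nT'; set B := M0 + _ => BM.
have B0 : 0 <= B by rewrite addr_ge0 ?(ltW M00) ?mulr_ge0.
have B2 : B ^+ 2 <= M ^+ 2 by rewrite lerXn2r ?nnegrE.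
have : 64 * B ^+ 2 <= K by rewrite -K4 ler_wpM2l ?ler0n.
have BE : B = M0 + n%:R * tau * K by [].
move: (64 * B ^+ 2) => z zK; have := ler_wpM2l t0 zK.
by rewrite BE -natr1; lra.
Qed.

(** Discrete Gronwall: [n] defects of size [C tau^2], each amplified by at most
    [q^n <= exp (128 M T0)], add up to [O(tau)] because [n tau <= T0]. *)
Lemma euler_orbit_refine : exists2 C : R, 0 <= C & forall tau n, 0 <= tau ->
  n%:R * tau <= T0 -> close_jet 2 (C * tau) (euler_orbit (tau / 2) (2 * n)) (euler_orbit tau n).
Proof.
have [C C0 CP] := euler_step_refine c d0 M_ge0.
exists (C * (T0 * expR (128 * M * T0))).
  by rewrite !mulr_ge0// ?expR_ge0// ltW.
move=> tau n t0 nT.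
pose q := 1 + 128 * M * tau.
have q1 : 1 <= q by rewrite lerDl !mulr_ge0// ltW.
have q0 : 0 <= q by lra.
suff H : close_jet 2 (C * tau ^+ 2 * n%:R * q ^+ n) (euler_orbit (tau / 2) (2 * n)) (euler_orbit tau n).
  move=> b k x k2; apply: (le_trans (H b k x k2)).
  have qE : q ^+ n <= expR (128 * M * T0).
    apply: (le_trans (powD1_le_expR _ _)); first by rewrite !mulr_ge0// ltW.
    rewrite ler_expR -mulrA ler_wpM2l//; first by rewrite mulr_ge0.
    by rewrite mulrC.
  have -> : C * tau ^+ 2 * n%:R * q ^+ n = C * tau * ((n%:R * tau) * q ^+ n) by ring.
  have -> : C * (T0 * expR (128 * M * T0)) * tau = C * tau * (T0 * expR (128 * M * T0)) by ring.
  rewrite ler_wpM2l ?mulr_ge0//; apply: ler_pM => //; first by rewrite mulr_ge0.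
  exact: exprn_ge0.
elim: n nT => [|n IH] nT.
  by move=> b k x k2; rewrite muln0 /= subrr normr0 mulr0 mul0r.
have nT' : n%:R * tau <= T0.
  by apply: le_trans nT; rewrite ler_wpM2r// ler_nat.
have h0 : 0 <= tau / 2 by lra.
have nE p : (p <= 2 * n.+1)%N -> bounded_jet 6 M (euler_orbit (tau / 2) p).
  move=> pn; apply: euler_orbit_bounded => //; apply: le_trans nT.
  have : p%:R <= (2 * n.+1)%:R :> R by rewrite ler_nat.
  by rewrite natrM => /(ler_wpM2r h0); lra.
rewrite mulnS euler_orbitS !add2n !euler_orbitS.
have n1 : (2 * n <= 2 * n.+1)%N by rewrite leq_mul2l leqnSn.
have n2 : ((2 * n).+1 <= 2 * n.+1)%N by rewrite mulnS add2n leqnSn.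
have S1 := CP _ _ (fun b => euler_orbit_jet (tau / 2) (2 * n) b) t0 (nE _ n1) (nE _ n2).
have S2 := euler_step_stable d c (n := 2) isT t0 (nE _ n1) (euler_orbit_bounded t0 nT') (IH nT').
move=> b k x k2; have := S1 b k x k2; have := S2 b k x k2; rewrite -/q.
have qn : 1 <= q ^+ n.+1 by rewrite exprn_ege1.
have Ct : 0 <= C * tau ^+ 2 by rewrite mulr_ge0// sqr_ge0.
have := ler_wpM2l Ct qn; rewrite mulr1.
set p1 := euler_step d c (tau / 2) _ _ _ _; set p2 := euler_step d c tau _ _ _ _.
set p3 := euler_step d c tau _ _ _ _.
rewrite -[n.+1%:R]natr1 [q ^+ n.+1]exprSr !ler_norml => H /andP[a1 a2] /andP[b1 b2].
by apply/andP; split; lra.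
Qed.

Lemma euler_orbit_lipschitz : exists2 C : R, 0 <= C & forall tau n p, 0 <= tau ->
  (n + p)%:R * tau <= T0 -> close_jet 4 (C * (p%:R * tau)) (euler_orbit tau (n + p)) (euler_orbit tau n).
Proof.
exists (3 * kap * M + 64 * M ^+ 2).
  by rewrite addr_ge0 ?mulr_ge0 ?ler0n ?sqr_ge0 ?(ltW M00) ?(coef_bound_ge0 c d0).
move=> tau n p t0; elim: p => [|p IH] nT b k x k4.
  by rewrite addn0 subrr normr0 mul0r mulr0.
have nT' : (n + p)%:R * tau <= T0.
  by apply: le_trans nT; rewrite ler_wpM2r// ler_nat addnS.
have S := euler_step_lipschitz c d0 (euler_orbit_jet tau (n + p)) (euler_orbit_bounded t0 nT') t0 b x k4.
rewrite addnS euler_orbitS -natr1; have := IH nT' b k x k4; move: S.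
rewrite !ler_norml => /andP[a1 a2] /andP[b1 b2].
by apply/andP; split; lra.
Qed.

(** Discrete form of the differential equation. Freezing the generator at step [n] costs
    [O((p tau)^2)], and the consistency errors of [p] steps cost [O(p tau^2)], which explains the
    last factor. *)
Lemma euler_orbit_expansion : exists2 C : R, 0 <= C & forall tau n p b x, 0 <= tau ->
  (n + p)%:R * tau <= T0 ->
  `|euler_orbit tau (n + p) b 0%N x - euler_orbit tau n b 0%N x -
    p%:R * tau * generator d c (euler_orbit tau n) b 0%N x| <=
  C * (p%:R * tau) * (p%:R * tau + tau).
Proof.
have [L L0 LP] := euler_orbit_lipschitz.
pose A := 6 * kap ^+ 2 * M; pose B := 2 * kap + 128 * M.
have k0 : 0 <= kap by exact: (coef_bound_ge0 c d0).
have A0 : 0 <= A by rewrite !mulr_ge0 ?ler0n ?sqr_ge0 ?(ltW M00).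
have B0 : 0 <= B by rewrite addr_ge0 ?mulr_ge0 ?ler0n ?(ltW M00).
exists (A + B * L); first by apply: addr_ge0 => //; apply: mulr_ge0.
move=> tau n p b x t0; elim: p => [|p IH] nT.
  by rewrite addn0 !mul0r subrr subr0 normr0 mulr0 mul0r.
have nT' : (n + p)%:R * tau <= T0.
  by apply: le_trans nT; rewrite ler_wpM2r// ler_nat addnS.
have n0T : n%:R * tau <= T0.
  by apply: le_trans nT'; rewrite ler_wpM2r// ler_nat leq_addr.
have S := euler_step_consistent c d0 (euler_orbit_jet tau (n + p)) (euler_orbit_bounded t0 nT') t0 b x (k := 0) isT.
have lip : close_jet 2 (L * (p%:R * tau)) (euler_orbit tau (n + p)) (euler_orbit tau n).
  by move=> b' k y k2; apply: LP => //; rewrite (leq_trans k2).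
have G := generator_dist c d0 (n := 0) isT (euler_orbit_bounded t0 nT') (euler_orbit_bounded t0 n0T) lip b x (k := 0) isT.
have {}G : `|tau * (generator d c (euler_orbit tau (n + p)) b 0%N x - generator d c (euler_orbit tau n) b 0%N x)| <=
    tau * (B * (L * (p%:R * tau))) by rewrite normrM (ger0_norm t0) ler_wpM2l.
rewrite addnS euler_orbitS -[p.+1%:R]natr1; have := IH nT'; move: S G; rewrite -/A.
have T1 : 0 <= A * tau ^+ 2 by rewrite mulr_ge0 ?sqr_ge0.
have T2 : 0 <= B * L * tau ^+ 2 by rewrite mulr_ge0 ?sqr_ge0// mulr_ge0.
have T3 : 0 <= A * tau ^+ 2 * p%:R by rewrite mulr_ge0.
have T4 : 0 <= B * L * tau ^+ 2 * p%:R by rewrite mulr_ge0.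
set s := p%:R in T3 T4 *; set G1 := generator _ _ _ _ _ _; set G0 := generator _ _ (euler_orbit tau n) _ _ _.
set o1 := euler_step d c tau _ _ _ _; set o2 := euler_orbit tau (n + p) b 0%N x.
rewrite !ler_norml => /andP[a1 a2] /andP[b1 b2] /andP[e1 e2].
by apply/andP; split; lra.
Qed.

End euler_limit.

(** * Passage to the limit along dyadic time steps *)

Section limit_flow.
Context {R : realType}.
Implicit Types (b : bool) (k m n p : nat) (x y t s h : R).

(* [W b k x t] is the [k]-th space derivative ([k <= 2]) of component [b]. *)
Definition flow (d c : bool -> R) (w0 : bool -> nat -> R -> R) (T0 C : R)
    (W : bool -> nat -> R -> R -> R) : Prop :=
  [/\ forall b k x, (k <= 2)%N -> W b k x 0 = w0 b k x,
      forall b k x t, (k <= 2)%N -> 0 <= t <= T0 -> `|W b k x t| <= C,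
      forall b k x y t, (k <= 2)%N -> 0 <= t <= T0 ->
        `|W b k y t - W b k x t| <= C * `|y - x|,
      forall b k x h t, (k <= 1)%N -> 0 <= t <= T0 ->
        `|W b k (x + h) t - W b k x t - h * W b k.+1 x t| <= C * h ^+ 2 &
      (forall b k x s t, (k <= 2)%N -> 0 <= s -> s <= t -> t <= T0 ->
        `|W b k x t - W b k x s| <= C * (t - s)) /\
      forall b x s t, 0 <= s -> s <= t -> t <= T0 ->
        `|W b 0 x t - W b 0 x s - (t - s) *
          (d b * W b 2 x s + c b * W b 1 x s + W (~~ b) 0 x s ^+ 2)| <=
          C * (t - s) ^+ 2].

Definition dyadic_index t m := Num.truncn (t * 2 ^+ m).

Lemma dyadic_indexP t m : 0 <= t ->
  (dyadic_index t m)%:R * (2 ^+ m)^-1 <= t <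
  ((dyadic_index t m)%:R + 1) * (2 ^+ m)^-1.
Proof.
move=> t0; have p0 := @pow2_gt0 R m.
have t2 : 0 <= t * 2 ^+ m by rewrite mulr_ge0// ltW.
rewrite ler_pdivrMr// ltr_pdivlMr// natr1.
by have /andP[-> ->] := truncn_itv t2.
Qed.

Lemma dyadic_index_le s t m : s <= t -> (dyadic_index s m <= dyadic_index t m)%N.
Proof. by move=> st; apply: le_truncn; rewrite ler_wpM2r// ltW// pow2_gt0. Qed.

(** Halving the step doubles the number of completed steps, up to one extra step [r]. The doubled
    part is compared by refinement, the extra step by Lipschitz continuity in time. *)
Lemma dyadic_indexS t m : 0 <= t -> exists2 r : nat, (r <= 1)%N &
  dyadic_index t m.+1 = (2 * dyadic_index t m + r)%N.
Proof.
move=> t0; have p0 := @pow2_gt0 R m.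
have t2 : 0 <= t * 2 ^+ m by rewrite mulr_ge0// ltW.
have t2' : 0 <= t * 2 ^+ m.+1 by rewrite mulr_ge0// ltW// pow2_gt0.
have /andP[a1 a2] := truncn_itv t2; have /andP[b1 b2] := truncn_itv t2'.
move: a1 a2 b1 b2; rewrite -/(dyadic_index t m) -/(dyadic_index t m.+1).
set n := dyadic_index t m; set n' := dyadic_index t m.+1.
rewrite exprS mulrCA => a1 a2 b1 b2.
have nn' : (2 * n < n'.+1)%N.
  by rewrite -(ltr_nat R) natrM; apply: le_lt_trans b2; rewrite ler_pM2l.
have n'n : (n' < 2 * n.+1)%N.
  by rewrite -(ltr_nat R) natrM; apply: (le_lt_trans b1); rewrite ltr_pM2l.
exists (n' - 2 * n)%N; last by rewrite subnKC.
by rewrite leq_subLR -ltnS addn1 (leq_trans n'n)// mulnS.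
Qed.

(** The scheme satisfies each inequality of [flow] up to a multiple of [2^-m], and [le_of_dyadic]
    removes that error. Derivatives of the limit thus come from remainder estimates, without
    exchanging limits. *)
Lemma euler_limit (d c : bool -> R) (w0 : bool -> nat -> R -> R) (M0 : R) :
  (forall b, 0 < d b) -> (forall b, is_jet (w0 b)) -> 0 < M0 ->
  bounded_jet 6 M0 w0 ->
  exists T0 : R, exists C : R, exists W : bool -> nat -> R -> R -> R,
    [/\ 0 < T0, 0 <= C & flow d c w0 T0 C W].
Proof.
move=> d0 w0J M00 w0M; pose M := 2 * M0; pose T0 := existence_time M0.
have T00 : 0 < T0 by rewrite invr_gt0 mulr_gt0 ?ltr0n.
have M_ge0 : 0 <= M by rewrite mulr_ge0 ?ler0n ?(ltW M00).
have [C1 C10 refine] := euler_orbit_refine c d0 w0J M00 w0M.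
have [C2 C20 lip] := euler_orbit_lipschitz c d0 w0J M00 w0M.
have [C3 C30 exp] := euler_orbit_expansion c d0 w0J M00 w0M.
have bdd := euler_orbit_bounded d c M00 w0M.
have jet tau n b : is_jet (euler_orbit d c w0 tau n b) := @euler_orbit_jet _ d c w0 w0J tau n b.
pose step m : R := (2 ^+ m)^-1.
have step0 m : 0 < step m by rewrite invr_gt0 pow2_gt0.
have step1 m : step m <= 1.
  by rewrite invf_le1 ?pow2_gt0// exprn_ege1// ler1n.
have stepS m : step m.+1 = step m / 2 by rewrite /step exprS invfM mulrC.
pose app m t := euler_orbit d c w0 (step m) (dyadic_index t m).
have nT m t : 0 <= t -> t <= T0 -> (dyadic_index t m)%:R * step m <= T0.
  by move=> t0 tT; have /andP[H _] := dyadic_indexP m t0; apply: le_trans tT.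
have appM m t : 0 <= t -> t <= T0 -> bounded_jet 6 M (app m t).
  by move=> t0 tT; apply: bdd; rewrite ?(ltW (step0 m))// nT.
have app_succ m t : 0 <= t -> t <= T0 ->
    close_jet 2 ((C1 + C2) / 2 ^+ m) (app m.+1 t) (app m t).
  move=> t0 tT b k x k2.
  have H1 := refine _ _ (ltW (step0 m)) (nT m t t0 tT) b k x k2.
  have [r r1 nE] := dyadic_indexS m t0.
  have nT1 := nT m.+1 t t0 tT; rewrite nE in nT1.
  have H2 := lip _ _ _ (ltW (step0 m.+1)) nT1 b k x (leq_trans k2 (isT : (2 <= 4)%N)).
  have H3 : C2 * (r%:R * step m.+1) <= C2 * step m.
    rewrite ler_wpM2l// stepS; have r1' : r%:R <= 1 :> R by rewrite -[1]/(1%:R) ler_nat.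
    by have := step0 m; nra.
  move: H1 H2; rewrite /app nE -stepS -/(step m) !ler_norml => /andP[a1 a2] /andP[b1 b2].
  have -> : (C1 + C2) / 2 ^+ m = C1 * step m + C2 * step m by rewrite -mulrDl.
  by apply/andP; split; lra.
have /choice[W' W'P] : forall q : (bool * nat) * (R * R), exists l : R,
    0 <= q.2.2 <= T0 -> (q.1.2 <= 2)%N -> forall m,
    `|app m q.2.2 q.1.1 q.1.2 q.2.1 - l| <= 2 * (C1 + C2) / 2 ^+ m.
  move=> [[b k] [x t]] /=; have [/andP[t0 tT]|nt] := boolP (0 <= t <= T0); last by exists 0.
  have [k2|nk] := boolP (k <= 2)%N; last by exists 0.
  by have [l lP] := geometric_limit (fun m => app_succ m t t0 tT b k x k2); exists l.
pose W b k x t := W' ((b, k), (x, t)).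
pose D := 2 * (C1 + C2).
have D0 : 0 <= D by rewrite mulr_ge0 ?ler0n ?addr_ge0.
have WP b k x t m : (k <= 2)%N -> 0 <= t -> t <= T0 -> `|app m t b k x - W b k x t| <= D * step m.
  by move=> k2 t0 tT; apply: (W'P ((b, k), (x, t))) => //=; rewrite t0.
have W1 b k x t : (k <= 2)%N -> 0 <= t -> t <= T0 -> `|W b k x t| <= M.
  move=> k2 t0 tT; apply: (le_of_dyadic (C := D)) => m; rewrite -/(step m).
  have := WP b k x t m k2 t0 tT; have := appM m t t0 tT b k x (leq_trans k2 (isT : (2 <= 6)%N)).
  by rewrite !ler_norml => /andP[a1 a2] /andP[b1 b2]; apply/andP; split; lra.
exists T0, (M + C2 + C3), W; split => //; first by rewrite !addr_ge0.
have leM (z : R) : 0 <= z -> M * z <= (M + C2 + C3) * z.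
  by move=> z0; rewrite ler_wpM2r//; lra.
split.
- move=> b k x k2; apply/eqP; rewrite -subr_eq0 -normr_le0.
  apply: (le_of_dyadic (C := D)) => m; rewrite -/(step m) add0r distrC.
  have := WP b k x 0 m k2 (lexx 0) (ltW T00); rewrite /app.
  by have -> : dyadic_index 0 m = 0%N by rewrite /dyadic_index mul0r truncn0.
- move=> b k x t k2 /andP[t0 tT]; apply: (le_trans (W1 b k x t k2 t0 tT)); lra.
- move=> b k x y t k2 /andP[t0 tT]; apply: le_trans (leM _ (normr_ge0 _)).
  apply: (le_of_dyadic (C := 2 * D)) => m; rewrite -/(step m).
  have H := jet_lipschitz (k := k) x y (jet (step m) (dyadic_index t m) b)
    (fun z => appM m t t0 tT b k.+1 z (leq_trans k2 (isT : (2 <= 5)%N))).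
  have := WP b k x t m k2 t0 tT; have := WP b k y t m k2 t0 tT; move: H; rewrite -/(app m t).
  rewrite !ler_norml => /andP[a1 a2] /andP[b1 b2] /andP[e1 e2]; apply/andP; split; lra.
- move=> b k x h t k1 /andP[t0 tT]; apply: le_trans (leM _ (sqr_ge0 _)).
  apply: (le_of_dyadic (C := (2 + `|h|) * D)) => m; rewrite -/(step m).
  have H := jet_expansion x h (jet (step m) (dyadic_index t m) b)
    (fun z => appM m t t0 tT b k.+2 z (leq_trans k1 (isT : (1 <= 4)%N))).
  have := WP b k x t m (leqW k1) t0 tT; have := WP b k (x + h) t m (leqW k1) t0 tT.
  have : `|h * (app m t b k.+1 x - W b k.+1 x t)| <= `|h| * (D * step m).
    by rewrite normrM ler_wpM2l// WP.
  move: H; rewrite -/(app m t).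
  rewrite !ler_norml => /andP[a1 a2] /andP[b1 b2] /andP[e1 e2] /andP[f1 f2].
  by apply/andP; split; lra.
(* The steps completed between [s] and [t] cover [t - s] up to one step length, because both times
   are rounded down. *)
have incr m s t : 0 <= s -> s <= t -> exists2 p, dyadic_index t m = (dyadic_index s m + p)%N &
    `|p%:R * step m - (t - s)| <= step m.
  move=> s0 st; have t0 := le_trans s0 st.
  exists (dyadic_index t m - dyadic_index s m)%N; first by rewrite subnKC// dyadic_index_le.
  have := dyadic_indexP m s0; have := dyadic_indexP m t0.
  rewrite natrB ?dyadic_index_le// -/(step m) => /andP[a1 a2] /andP[b1 b2].
  by rewrite ler_norml; apply/andP; split; lra.
split.
- move=> b k x s t k2 s0 st tT; apply: (@le_trans _ _ (C2 * (t - s))); last first.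
    by rewrite ler_wpM2r ?subr_ge0//; lra.
  have t0 := le_trans s0 st; have sT := le_trans st tT.
  apply: (le_of_dyadic (C := C2 + 2 * D)) => m; rewrite -/(step m).
  have [p pE pP] := incr m s t s0 st.
  have := nT m t t0 tT; rewrite pE => nTp.
  have H := lip _ _ _ (ltW (step0 m)) nTp b k x (leq_trans k2 (isT : (2 <= 4)%N)).
  have H2 : C2 * (p%:R * step m) <= C2 * (t - s + step m).
    by rewrite ler_wpM2l//; move: pP; rewrite ler_norml => /andP[]; lra.
  have := WP b k x t m k2 t0 tT; have := WP b k x s m k2 s0 sT; move: H.
  rewrite -pE -/(app m t) -/(app m s).
  rewrite !ler_norml => /andP[a1 a2] /andP[b1 b2] /andP[e1 e2].
  by apply/andP; split; lra.
move=> b x s t s0 st tT; set hh := t - s; have h0 : 0 <= hh by rewrite subr_ge0.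
have t0 := le_trans s0 st; have sT := le_trans st tT.
have hT : hh <= T0 by rewrite /hh; lra.
apply: (@le_trans _ _ (C3 * hh ^+ 2)); last by rewrite ler_wpM2r ?sqr_ge0//; lra.
pose G := 2 * coef_bound d c * M + 64 * M ^+ 2.
pose D' := (d b + `|c b| + 2 * M) * D.
set gW := d b * _ + _ + _.
apply: (le_of_dyadic (C := C3 * (3 * T0 + 2) + 2 * D + G + T0 * D')) => m; rewrite -/(step m).
have [p pE pP] := incr m s t s0 st.
have := nT m t t0 tT; rewrite pE => nTp.
have H := exp _ _ _ b x (ltW (step0 m)) nTp.
have gb := generator_bounded c d0 b x (appM m s s0 sT) (leq0n 4).
pose g := generator d c (app m s) b 0 x.
have gg : `|g - gW| <= D' * step m.
  have Z2 := WP b 2 x s m isT s0 sT; have Z1 := WP b 1 x s m isT s0 sT.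
  have Z0 := WP (~~ b) 0 x s m isT s0 sT.
  have Y0 := appM m s s0 sT (~~ b) 0%N x isT; have Y1 := W1 (~~ b) 0 x s isT s0 sT.
  have -> : g - gW = d b * (app m s b 2 x - W b 2 x s) + c b * (app m s b 1 x - W b 1 x s) +
      (app m s (~~ b) 0 x - W (~~ b) 0 x s) * (app m s (~~ b) 0 x + W (~~ b) 0 x s).
    by rewrite /g /gW /generator /=; ring.
  have F1 : `|d b * (app m s b 2 x - W b 2 x s)| <= d b * (D * step m).
    by rewrite normrM gtr0_norm// ler_wpM2l// ltW.
  have F2 : `|c b * (app m s b 1 x - W b 1 x s)| <= `|c b| * (D * step m).
    by rewrite normrM ler_wpM2l.
  have F3 : `|(app m s (~~ b) 0 x - W (~~ b) 0 x s) * (app m s (~~ b) 0 x + W (~~ b) 0 x s)| <=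
      (D * step m) * (2 * M).
    rewrite normrM; apply: ler_pM => //.
    by rewrite (le_trans (ler_normD _ _))//; lra.
  rewrite /D' (le_trans (ler_normD _ _))// (le_trans (lerD (ler_normD _ _) (lexx _)))//.
  by lra.
have st0 := step0 m; have st1 := step1 m.
set e := p%:R * step m in pP H.
have e0 : 0 <= e by rewrite mulr_ge0// ltW.
have F1 : `|(e - hh) * g| <= step m * G by rewrite normrM; apply: ler_pM.
have D'0 : 0 <= D' * step m by exact: le_trans gg.
have F2 : `|hh * (g - gW)| <= T0 * (D' * step m).
  by rewrite normrM (ger0_norm h0); apply: ler_pM.
have eh : e <= hh + step m by move: pP; rewrite -/hh ler_norml => /andP[]; lra.
have F3 : e * (e + step m) <= hh ^+ 2 + (3 * T0 + 2) * step m.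
  apply: (@le_trans _ _ ((hh + step m) * (hh + 2 * step m))).
    by apply: ler_pM => //; lra.
  have : hh * step m <= T0 * step m by rewrite ler_wpM2r// ltW.
  have : step m * step m <= step m by rewrite ler_piMr// ltW.
  by rewrite expr2; lra.
have {}F3 : C3 * e * (e + step m) <= C3 * (hh ^+ 2 + (3 * T0 + 2) * step m).
  by rewrite -mulrA ler_wpM2l.
have := WP b 0 x t m isT t0 tT; have := WP b 0 x s m isT s0 sT; move: H.
rewrite -pE -/(app m t) -/(app m s) -/g; move: F1 F2.
have -> : (e - hh) * g = e * g - hh * g by ring.
have -> : hh * (g - gW) = hh * g - hh * gW by ring.
rewrite !ler_norml => /andP[a1 a2] /andP[b1 b2] /andP[e1 e2] /andP[f1 f2] /andP[g1 g2].
by apply/andP; split; lra.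
Qed.

End limit_flow.

(** * Local existence: the limit is a classical solution *)

Section lipschitz_functions.
Context {R : realType}.
Implicit Types (f g u v : R -> R -> R) (L : R) (x y s t : R).

Definition bounded_lipschitz L f : Prop :=
  [/\ forall x t, `|f x t| <= L, forall x y t, `|f y t - f x t| <= L * `|y - x| &
      forall x s t, `|f x t - f x s| <= L * `|t - s|].

Lemma bounded_lipschitz_ge0 L f : bounded_lipschitz L f -> 0 <= L.
Proof. by move=> [H _ _]; exact: le_trans (H 0 0). Qed.

Lemma bounded_lipschitz_continuous L f : bounded_lipschitz L f ->
  continuous (fun p : R * R => f p.1 p.2).
Proof.
move=> fL [x t]; have L0 := bounded_lipschitz_ge0 fL; have [_ fx ft] := fL.
apply/cvgrPdist_le => e e0.
have r0 : 0 < e / (2 * (L + 1)) by rewrite divr_gt0//; lra.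
apply: filterS (nbhsx_ballx (x, t) _ r0) => -[y s] [/= yx st].
have rE : 2 * (L + 1) * (e / (2 * (L + 1))) = e by field; rewrite gt_eqF//; lra.
move: yx st rE; rewrite /ball/=; set r := e / _ => yx st rE.
have := fx y x t; have := ft y s t.
have yx' := ltW yx; have st' := ltW st.
have H1 := ler_wpM2l L0 yx'; have H2 := ler_wpM2l L0 st'.
have -> : f x t - f y s = (f x t - f y t) + (f y t - f y s) by ring.
by move=> H3 H4; rewrite (le_trans (ler_normD _ _))//; nra.
Qed.

Lemma lipschitz_continuous_at (g : R -> R) L x : 0 <= L ->
  (forall y, `|g y - g x| <= L * `|y - x|) -> {for x, continuous g}.
Proof.
move=> L0 gL; apply/cvgrPdist_le => e e0.
have r0 : 0 < e / (L + 1) by rewrite divr_gt0//; lra.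
apply: filterS (nbhsx_ballx x _ r0) => y yx; rewrite distrC (le_trans (gL y))//.
have rE : (L + 1) * (e / (L + 1)) = e by field; rewrite gt_eqF//; lra.
by move: yx rE; rewrite /ball/= distrC; set r := e / _ => /ltW yx rE; nra.
Qed.

(** For [r <= 1] the Lipschitz bound suffices since [r <= r^a]; for [r >= 1] the sup bound does
    since [r^a >= 1]. It serves both exponents, [alpha] in space and [alpha / 2] in time. *)
Lemma holder_of_lipschitz (a L r D : R) : 0 < a -> a <= 1 -> 0 <= L -> 0 <= r ->
  D <= L * r -> D <= 2 * L -> D <= 2 * L * r `^ a.
Proof.
move=> a0 a1 L0; rewrite le_eqVlt => /predU1P[<-|r0] D1 D2.
  by apply: (le_trans D1); rewrite mulr0 mulr_ge0 ?powR_ge0// mulr_ge0.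
have [r1|/ltW r1] := lerP r 1.
  apply: (le_trans D1); apply: (@le_trans _ _ (L * r `^ a)).
    by rewrite ler_wpM2l// ger1_powR// r0 r1.
  by rewrite ler_wpM2r ?powR_ge0//; lra.
apply: (le_trans D2); rewrite ler_peMr ?mulr_ge0//.
by rewrite -(powRr0 r) ler_powR// ltW.
Qed.

Lemma bounded_lipschitz_holder (a L tau T1 : R) f : 0 < a -> a <= 1 ->
  bounded_lipschitz L f -> holder_on_slab a tau T1 f.
Proof.
move=> a0 a1 fL; have L0 := bounded_lipschitz_ge0 fL; have [fb fx ft] := fL.
have two (p q : R) : `|p| <= L -> `|q| <= L -> `|p - q| <= 2 * L.
  by move=> pL qL; rewrite (le_trans (ler_normB _ _))//; lra.
have a20 : 0 < a / 2 by rewrite divr_gt0.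
have a21 : a / 2 <= 1 by lra.
split; exists (2 * L).
  move=> x y t _; apply: (holder_of_lipschitz a0 a1 L0 (normr_ge0 _)); first exact: fx.
  exact: two.
move=> x s t _ _; apply: (holder_of_lipschitz a20 a21 L0 (normr_ge0 _)); first exact: ft.
exact: two.
Qed.

Lemma bounded_lipschitzD L M f g : bounded_lipschitz L f -> bounded_lipschitz M g ->
  bounded_lipschitz (L + M) (fun x t => f x t + g x t).
Proof.
move=> [f1 f2 f3] [g1 g2 g3]; split => [x t|x y t|x s t].
- by rewrite (le_trans (ler_normD _ _))// lerD.
- have -> : f y t + g y t - (f x t + g x t) = (f y t - f x t) + (g y t - g x t) by ring.
  by rewrite (le_trans (ler_normD _ _))// mulrDl lerD.
have -> : f x t + g x t - (f x s + g x s) = (f x t - f x s) + (g x t - g x s) by ring.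
by rewrite (le_trans (ler_normD _ _))// mulrDl lerD.
Qed.

Lemma bounded_lipschitzZ (a : R) L f : bounded_lipschitz L f ->
  bounded_lipschitz (`|a| * L) (fun x t => a * f x t).
Proof.
move=> [f1 f2 f3]; split => [x t|x y t|x s t].
- by rewrite normrM ler_wpM2l.
- by rewrite -mulrBr normrM -mulrA ler_wpM2l.
by rewrite -mulrBr normrM -mulrA ler_wpM2l.
Qed.

Lemma bounded_lipschitz_sqr L f : 0 < L -> bounded_lipschitz L f ->
  bounded_lipschitz (2 * L ^+ 2 + L ^+ 2) (fun x t => f x t ^+ 2).
Proof.
move=> L0 [f1 f2 f3].
have sq (p q r : R) : `|p| <= L -> `|q| <= L -> 0 <= r -> `|p - q| <= L * r ->
    `|p ^+ 2 - q ^+ 2| <= (2 * L ^+ 2 + L ^+ 2) * r.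
  move=> pL qL r0 pq; rewrite subr_sqr normrM.
  apply: (@le_trans _ _ (L * r * (2 * L))).
    by apply: ler_pM => //; rewrite (le_trans (ler_normD _ _))//; lra.
  have : 0 <= L ^+ 2 * r by rewrite mulr_ge0// sqr_ge0.
  by lra.
split => [x t|x y t|x s t]; [|exact: sq|exact: sq].
rewrite normrX; apply: (@le_trans _ _ (L ^+ 2)); first by rewrite lerXn2r// nnegrE ltW.
by have := sqr_ge0 L; lra.
Qed.

Lemma bounded_lipschitz_sup_continuous L (T : \bar R) u v : bounded_lipschitz L u ->
  bounded_lipschitz L v -> sup_norm_continuous T u v.
Proof.
move=> uL vL; have L0 := bounded_lipschitz_ge0 uL.
have [u1 u2 u3] := uL; have [v1 v2 v3] := vL.
split=> [t _|t0 _].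
  split.
    move=> x; apply: (@cvg_pair _ _ _ (nbhs x) (nbhs (u x t)) (nbhs (v x t)) _ _ _
      (u^~ t) (v^~ t)).
      by apply: (lipschitz_continuous_at L0) => y; exact: u2.
    by apply: (lipschitz_continuous_at L0) => y; exact: v2.
  apply: (@le_lt_trans _ _ (2 * L)%:E); last by rewrite ltry.
  apply: sup_norm_le => x; rewrite lee_fin (le_trans (euclid_le _))//=.
  by have := u1 x t; have := v1 x t; lra.
have H0 : (2 * L * `|t - t0|)%:E @[t --> within (time_interval T) (nbhs t0)] --> (0%E : \bar R).
  apply: cvg_within_filter; apply: cvg_EFin; first by near=> t.
  have -> : 0 = 2 * L * `|t0 - t0| by rewrite subrr normr0 mulr0.
  apply: cvgM; first exact: cvg_cst.
  by apply: cvg_norm; apply: cvgB => //; exact: cvg_cst.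
apply: (squeeze_cvge _ (cvg_cst 0%E) H0).
near=> t; apply/andP; split.
  apply: (@le_trans _ _ (euclid ((slice u v t - slice u v t0) 0))%:E).
    by rewrite lee_fin euclid_ge0.
  exact: sup_norm_ge.
apply: sup_norm_le => x; rewrite lee_fin (le_trans (euclid_le _))//=.
by have := u3 x t0 t; have := v3 x t0 t; lra.
Unshelve. all: by end_near. Qed.

End lipschitz_functions.

Section flow_solution.
Context {R : realType}.
Variables (d c : bool -> R) (w0 : bool -> nat -> R -> R) (T0 C : R)
  (W : bool -> nat -> R -> R -> R).
Hypotheses (T00 : 0 < T0) (C0 : 0 <= C) (WP : flow d c w0 T0 C W).
Implicit Types (b : bool) (k : nat) (x y s t h : R).

Definition clamp t := Num.max 0 (Num.min t T0).

Lemma clamp_in t : 0 <= clamp t <= T0.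
Proof. by rewrite le_max lexx/= ge_max (ltW T00)/= ge_min lexx orbT. Qed.

Lemma clampE t : 0 <= t <= T0 -> clamp t = t.
Proof. by move=> /andP[t0 tT]; rewrite /clamp min_l// max_r. Qed.

Lemma clamp_lipschitz s t : `|clamp t - clamp s| <= `|t - s|.
Proof.
wlog st : s t / s <= t.
  move=> H; have /orP[st|ts] := le_total s t; first exact: (H s t st).
  by rewrite distrC (distrC t); exact: (H t s ts).
rewrite (ger0_norm (x := t - s)) ?subr_ge0//.
have [m1 m2] : Num.min s T0 <= Num.min t T0 /\ Num.min t T0 - Num.min s T0 <= t - s.
  by case: (leP t T0) => ?; case: (leP s T0) => ?; split; lra.
rewrite /clamp; move: (Num.min t T0) (Num.min s T0) m1 m2 => p q qp pq.
by case: (leP 0 p) => ?; case: (leP 0 q) => ?; rewrite ler_norml; lra.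
Qed.

(* Freezing the solution at times outside [0, T0] makes its Lipschitz bounds hold
   at all times. *)
Definition frozen b k x t := W b k x (clamp t).

Definition frozen_speed b x t := d b * frozen b 2 x t + c b * frozen b 1 x t +
  frozen (~~ b) 0 x t ^+ 2.

Lemma frozen_lipschitz b k : (k <= 2)%N -> bounded_lipschitz C (frozen b k).
Proof.
move=> k2; have [_ W1 W2 _ [W4 _]] := WP.
split=> [x t|x y t|x s t].
- by apply: W1 => //; exact: clamp_in.
- by apply: W2 => //; exact: clamp_in.
apply: (@le_trans _ _ (C * `|clamp t - clamp s|)); last first.
  by rewrite ler_wpM2l// clamp_lipschitz.
have /andP[s0 sT] := clamp_in s; have /andP[t0 tT] := clamp_in t.
rewrite /frozen; have /orP[st|ts] := le_total (clamp s) (clamp t).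
  by rewrite (ger0_norm (x := clamp t - clamp s)) ?subr_ge0//; exact: W4.
rewrite distrC (distrC (clamp t)) (ger0_norm (x := clamp s - clamp t)) ?subr_ge0//.
exact: W4.
Qed.

Lemma frozen_speed_lipschitz b : exists L : R, bounded_lipschitz L (frozen_speed b).
Proof.
(* The lemma on squares asks for a positive constant, whereas [C] may be 0. *)
have C1 : 0 < C + 1 by rewrite ltr_wpDl.
have F : bounded_lipschitz (C + 1) (frozen (~~ b) 0).
  have [f1 f2 f3] := frozen_lipschitz (~~ b) (leq0n 2).
  split=> [x t|x y t|x s t].
  - by apply: (le_trans (f1 x t)); lra.
  - by apply: (le_trans (f2 x y t)); rewrite ler_wpM2r//; lra.
  by apply: (le_trans (f3 x s t)); rewrite ler_wpM2r//; lra.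
eexists; apply: bounded_lipschitzD; last exact: bounded_lipschitz_sqr C1 F.
apply: bounded_lipschitzD; apply: bounded_lipschitzZ; exact: frozen_lipschitz.
Qed.

Lemma frozen_dx b k x t : (k <= 1)%N -> is_derive x 1 ((frozen b k)^~ t) (frozen b k.+1 x t).
Proof.
move=> k1; have [_ _ _ W3 _] := WP; apply: expansion_is_derive => e e0.
have r0 : 0 < e / (C + 1) by rewrite divr_gt0// ltr_wpDl.
exists (e / (C + 1)) => // h hr; apply: (le_trans (W3 b k x h _ k1 (clamp_in t))).
rewrite -[h ^+ 2]real_normK ?num_real// expr2 mulrA ler_wpM2r//.
have rE : (C + 1) * (e / (C + 1)) = e by rewrite mulrCA divff ?mulr1// gt_eqF// ltr_wpDl.
by move: hr rE; set r := e / _ => /ltW hr rE; have := normr_ge0 h; have := C0; nra.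
Qed.

Lemma frozen_dt b x t : 0 < t -> t < T0 -> is_derive t 1 (frozen b 0 x) (frozen_speed b x t).
Proof.
move=> t0 tT; have [_ _ _ _ [_ W5]] := WP; have [L LP] := frozen_speed_lipschitz b.
have L0 := bounded_lipschitz_ge0 LP; have [_ _ Lt] := LP.
apply: expansion_is_derive => e e0.
pose r := e / (C + L + 1).
have CL : 0 < C + L + 1 by rewrite ltr_wpDl// addr_ge0.
have r0 : 0 < r by rewrite divr_gt0.
have rE : (C + L + 1) * r = e by rewrite /r mulrCA divff ?mulr1// gt_eqF.
exists (Num.min r (Num.min t (T0 - t))); first by rewrite !lt_min r0 t0 subr_gt0.
move=> h; rewrite !lt_min => /and3P[hr ht hT].
have tI : 0 <= t <= T0 by lra.
have thI : 0 <= t + h <= T0.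
  by move: ht hT; rewrite !ltr_norml => /andP[a1 a2] /andP[b1 b2]; lra.
have key : (C + L) * h ^+ 2 <= e * `|h|.
  rewrite -[h ^+ 2]real_normK ?num_real// expr2 mulrA ler_wpM2r//.
  by have := ltW hr; have := normr_ge0 h; nra.
have Lh : 0 <= L * h ^+ 2 by rewrite mulr_ge0// sqr_ge0.
have fE s : 0 <= s <= T0 -> forall a k y, frozen a k y s = W a k y s.
  by move=> sI a k y; rewrite /frozen clampE.
have /orP[h0|h0] := le_total 0 h.
  have tth : t <= t + h by rewrite lerDl.
  have := W5 b x t (t + h) (ltW t0) tth _.
  have -> : t + h <= T0 by case/andP: thI.
  move=> /(_ isT); have -> : t + h - t = h by ring.
  rewrite /frozen_speed !fE// => H; apply: (le_trans H); lra.
(* The flow expands forward only. For [h <= 0] the expansion starts at [t + h], and the Lipschitz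
   bound of the speed moves the base point back to [t] at a cost [L h^2]. *)
have tth : t + h <= t by lra.
have th0 : 0 <= t + h by case/andP: thI.
have := W5 b x (t + h) t th0 tth (ltW tT).
have := Lt x t (t + h); have -> : t + h - t = h by ring.
move=> /(ler_wpM2l (normr_ge0 h)).
rewrite -normrM (_ : `|h| * (L * `|h|) = L * h ^+ 2); last first.
  by rewrite -[h ^+ 2]real_normK ?num_real// expr2; ring.
have -> : t - (t + h) = - h by ring.
rewrite sqrrN !fE//.
have -> : d b * W b 2 x (t + h) + c b * W b 1 x (t + h) + W (~~ b) 0 x (t + h) ^+ 2 =
  frozen_speed b x (t + h) by rewrite /frozen_speed !fE.
rewrite !ler_norml => /andP[a1 a2] /andP[b1 b2].
move: key Lh; set K := e * `|h| => key Lh.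
by apply/andP; split; lra.
Qed.

Lemma dx_frozen b k : (k <= 1)%N -> dx (frozen b k) = frozen b k.+1.
Proof.
move=> k1; apply/funext => x; apply/funext => t; rewrite /dx derive1E.
by have [_ ->] := frozen_dx b x t k1.
Qed.

Lemma dxx_frozen b : dxx (frozen b 0) = frozen b 2.
Proof. by rewrite /dxx !dx_frozen. Qed.

Lemma dt_frozen b x t : 0 < t -> t < T0 -> dt (frozen b 0) x t = frozen_speed b x t.
Proof.
move=> t0 tT; rewrite /dt derive1E.
by have [_ ->] := frozen_dt b x t0 tT.
Qed.

Lemma frozen_C21 b : C21 T0%:E (frozen b 0).
Proof.
move=> x t t0; rewrite lte_fin => tT; rewrite dxx_frozen dx_frozen//.
split; split.
- by have [] := frozen_dt b x t0 tT.
- by have [] := frozen_dx b x t (leq0n 1).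
- by have [] := frozen_dx b x t (leqnn 1).
- have [L LP] := frozen_speed_lipschitz b.
  (* The time derivative is identified for [0 < t < T0], an open condition, so near the point it may
     be replaced by the Lipschitz function [frozen_speed]. *)
  have near_eq : \forall p \near (x, t), frozen_speed b p.1 p.2 = dt (frozen b 0) p.1 p.2.
    have r0 : 0 < Num.min t (T0 - t) by rewrite lt_min t0 subr_gt0.
    apply: filterS (nbhsx_ballx (x, t) _ r0) => -[y s] [_ /=].
    rewrite /ball/= lt_min !ltr_norml => /andP[/andP[_ a] /andP[b1 _]].
    by rewrite dt_frozen//; lra.
  suff: (fun p : R * R => dt (frozen b 0) p.1 p.2) @ (x, t) --> frozen_speed b x t.
    by rewrite -(dt_frozen b x t0 tT).
  have cs : (fun p : R * R => frozen_speed b p.1 p.2) @ (x, t) --> frozen_speed b x t.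
    exact: bounded_lipschitz_continuous LP (x, t).
  apply: cvg_trans cs.
  exact: near_eq_cvg.
- exact: bounded_lipschitz_continuous (frozen_lipschitz b (isT : (1 <= 2)%N)) (x, t).
- exact: bounded_lipschitz_continuous (frozen_lipschitz b (leqnn 2)) (x, t).
Qed.

Lemma frozen_interior_regular (alpha : R) b : 0 < alpha -> alpha <= 1 ->
  interior_regular alpha T0%:E (frozen b 0).
Proof.
move=> a0 a1 tau T1 tau0 tauT; rewrite lte_fin => T1T.
have [L LP] := frozen_speed_lipschitz b; have [Lb _ _] := LP.
have dtE x t : tau <= t <= T1 -> dt (frozen b 0) x t = frozen_speed b x t.
  by move=> /andP[t1 t2]; apply: dt_frozen; lra.
rewrite dxx_frozen dx_frozen//; split; split.
- by exists C => x t _; have [H _ _] := frozen_lipschitz b (leq0n 2); exact: H.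
- by exists C => x t _; have [H _ _] := frozen_lipschitz b (isT : (1 <= 2)%N); exact: H.
- by exists C => x t _; have [H _ _] := frozen_lipschitz b (leqnn 2); exact: H.
- by exists L => x t tI; rewrite dtE.
- exact: bounded_lipschitz_holder (frozen_lipschitz b (leqnn 2)).
have [[H1 HP1] [H2 HP2]] := bounded_lipschitz_holder tau T1 a0 a1 LP.
split; [exists H1 => x y t tI|exists H2 => x s t sI tI]; rewrite !dtE//.
  exact: HP1.
exact: HP2.
Qed.

Lemma flow_classical (alpha : R) : 0 < alpha -> alpha <= 1 ->
  classical_solution alpha (d true) (d false) (c true) (c false)
    (fun x => (w0 true 0%N x, w0 false 0%N x)) T0%:E (frozen true 0) (frozen false 0).
Proof.
move=> a0 a1; have [W0 _ _ _ _] := WP; split; first by rewrite lte_fin.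
split.
  apply/funext => x; rewrite /slice /frozen clampE ?lexx ?(ltW T00)//.
  by rewrite !W0.
split.
  exact: bounded_lipschitz_sup_continuous (frozen_lipschitz true (leq0n 2))
    (frozen_lipschitz false (leq0n 2)).
split; first by split; exact: frozen_C21.
split; last by split; exact: frozen_interior_regular.
move=> x t t0; rewrite lte_fin => tT.
by rewrite !dt_frozen// !dxx_frozen !dx_frozen.
Qed.

End flow_solution.

Lemma local_existence (R : realType) (alpha d1 d2 c1 c2 : R) (u0 v0 : nat -> R -> R) (M : R) :
  0 < alpha -> alpha <= 1 -> 0 < d1 -> 0 < d2 -> is_jet u0 -> is_jet v0 ->
  (forall k x, (k <= 6)%N -> `|u0 k x| <= M /\ `|v0 k x| <= M) ->
  exists T u v, classical_solution alpha d1 d2 c1 c2 (fun x => (u0 0%N x, v0 0%N x)) T u v.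
Proof.
move=> a0 a1 d10 d20 uJ vJ uvM.
pose d b := if b then d1 else d2; pose c b := if b then c1 else c2.
pose w0 b := if b then u0 else v0.
have d0 b : 0 < d b by case: b.
have wJ b : is_jet (w0 b) by case: b.
have M1 : 0 < `|M| + 1 by have := normr_ge0 M; lra.
have wM : bounded_jet 6 (`|M| + 1) w0.
  move=> b k x k6; have [uM vM] := uvM k x k6; have := ler_norm M.
  by case: b => /= H; [apply: (le_trans uM)|apply: (le_trans vM)]; lra.
have [T0 [C [W [T00 C0 WP]]]] := euler_limit c d0 wJ M1 wM.
exists T0%:E, (frozen T0 W true 0), (frozen T0 W false 0).
exact: (flow_classical T00 C0 WP a0 a1).
Qed.

(** * Maximal extension *)

Section maximal_solutions.
Context {R : realType}.
Variables (alpha d1 d2 c1 c2 : R) (z0 : R -> R * R).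
Implicit Types (f g u v : R -> R -> R) (T : \bar R) (x y s t : R).

Definition agree T f g : Prop := forall x t, time_interval T t -> f x t = g x t.

Lemma lt_room t T : (t%:E < T)%E -> exists2 r : R, 0 < r &
  forall s, `|s - t| < r -> (s%:E < T)%E.
Proof.
case: T => [T| |] //; last by exists 1 => // s _; rewrite ltry.
rewrite lte_fin => tT; exists (T - t); first by rewrite subr_gt0.
by move=> s; rewrite lte_fin ltr_norml => /andP[_]; lra.
Qed.

Lemma time_interval_near t T : 0 < t -> (t%:E < T)%E -> \forall s \near t, 0 < s /\ (s%:E < T)%E.
Proof.
move=> t0 tT; have [r r0 rP] := lt_room tT.
have m0 : 0 < Num.min r t by rewrite lt_min r0.
apply: filterS (nbhsx_ballx t _ m0) => s; rewrite /ball/= lt_min => /andP[sr st].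
split; last by apply: rP; rewrite distrC.
by move: st; rewrite ltr_norml => /andP[_]; lra.
Qed.

Section agreement.
Variables (T : \bar R) (f g : R -> R -> R).
Hypothesis fg : agree T f g.

Lemma agree_slice t : time_interval T t -> f^~ t = g^~ t.
Proof. by move=> tT; apply/funext => x; exact: fg. Qed.

Lemma agree_dx : agree T (dx f) (dx g).
Proof. by move=> x t tT; exact: (congr1 (fun h => derive1 h x) (agree_slice tT)). Qed.

Lemma agree_near t x : 0 < t -> (t%:E < T)%E -> {near t, f x =1 g x}.
Proof.
move=> t0 tT; apply: filterS (time_interval_near t0 tT) => s [s0 sT].
by apply: fg; split => //; exact: ltW.
Qed.

(** Space derivatives live in a single slice, but the time derivative sees neighbouring times; these
    lie in the interval because [0 < t] and [[0, T)] is open on the right. *)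
Lemma agree_dt x t : 0 < t -> (t%:E < T)%E -> dt f x t = dt g x t.
Proof.
move=> t0 tT; rewrite /dt !derive1E; apply: near_eq_derive.
exact: agree_near.
Qed.

End agreement.

Lemma agree_dxx T f g : agree T f g -> agree T (dxx f) (dxx g).
Proof. by move=> fg; do 2 apply: agree_dx. Qed.

Lemma agree_continuous T f g x t : 0 < t -> (t%:E < T)%E ->
  (forall y s, 0 < s -> (s%:E < T)%E -> f y s = g y s) ->
  {for (x, t), continuous (fun p : R * R => g p.1 p.2)} ->
  {for (x, t), continuous (fun p : R * R => f p.1 p.2)}.
Proof.
move=> t0 tT fg gc.
suff : (fun p : R * R => f p.1 p.2) @ (x, t) --> g x t by rewrite -(fg x t t0 tT).
have gc' : (fun p : R * R => g p.1 p.2) @ (x, t) --> g x t by exact: gc.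
apply: cvg_trans gc'; apply: near_eq_cvg.
have [r r0 rP] := lt_room tT; have m0 : 0 < Num.min r t by rewrite lt_min r0.
apply: filterS (nbhsx_ballx (x, t) _ m0) => -[y s] [_ /=].
rewrite /ball/= lt_min => /andP[sr st]; rewrite fg//; last by apply: rP; rewrite distrC.
by move: st; rewrite ltr_norml => /andP[_]; lra.
Qed.

Lemma agree_C21 T f g x t : agree T f g -> C21 T g -> 0 < t -> (t%:E < T)%E ->
  [/\ derivable (f x) t 1, derivable (f^~ t) x 1 & derivable ((dx f)^~ t) x 1]
  /\
  [/\ {for (x, t), continuous (fun p : R * R => dt f p.1 p.2)},
      {for (x, t), continuous (fun p : R * R => dx f p.1 p.2)} &
      {for (x, t), continuous (fun p : R * R => dxx f p.1 p.2)}].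
Proof.
move=> fg gC t0 tT; have [[g1 g2 g3] [g4 g5 g6]] := gC x t t0 tT.
have tI : time_interval T t by split => //; exact: ltW.
have gf : agree T g f by move=> y s sT; rewrite fg.
split; split.
- by apply: near_eq_derivable g1; exact: agree_near gf _ _ t0 tT.
- exact: (eq_ind _ (fun h => derivable h x 1) g2 _ (agree_slice gf tI)).
- exact: (eq_ind _ (fun h => derivable h x 1) g3 _ (agree_slice (agree_dx gf) tI)).
- by apply: (agree_continuous t0 tT _ g4) => y s s0 sT; exact: agree_dt fg _ _ s0 sT.
- by apply: (agree_continuous t0 tT _ g5) => y s s0 sT; apply: agree_dx fg _ _ _; split => //; exact: ltW.
- by apply: (agree_continuous t0 tT _ g6) => y s s0 sT; apply: agree_dxx fg _ _ _; split => //; exact: ltW.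
Qed.

Lemma agree_interior_regular T f g (tau T1 : R) : agree T f g ->
  interior_regular alpha T g -> 0 < tau -> tau < T1 -> (T1%:E < T)%E ->
  [/\ bounded_on_slab tau T1 f, bounded_on_slab tau T1 (dx f),
      bounded_on_slab tau T1 (dxx f) & bounded_on_slab tau T1 (dt f)] /\
  (holder_on_slab alpha tau T1 (dxx f) /\ holder_on_slab alpha tau T1 (dt f)).
Proof.
move=> fg gr tau0 tauT T1T.
have [[[B1 b1] [B2 b2] [B3 b3] [B4 b4]] [[[H1 h1] [H2 h2]] [[H3 h3] [H4 h4]]]] := gr tau T1 tau0 tauT T1T.
have sT s : tau <= s <= T1 -> 0 < s /\ (s%:E < T)%E.
  move=> /andP[s1 s2]; split; first exact: lt_le_trans s1.
  by rewrite (le_lt_trans _ T1T)// lee_fin.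
have sI s : tau <= s <= T1 -> time_interval T s.
  by move=> /sT[s0 sT']; split => //; exact: ltW.
have xxE y s : tau <= s <= T1 -> dxx f y s = dxx g y s.
  by move=> /sI; exact: agree_dxx.
have tE y s : tau <= s <= T1 -> dt f y s = dt g y s.
  by move=> /sT[s0 sT']; exact: agree_dt fg _ _ s0 sT'.
split; split.
- by exists B1 => y s sI'; rewrite (fg y s (sI s sI')); exact: b1.
- by exists B2 => y s sI'; rewrite (agree_dx fg y (sI s sI')); exact: b2.
- by exists B3 => y s sI'; rewrite xxE//; exact: b3.
- by exists B4 => y s sI'; rewrite tE//; exact: b4.
- split; [exists H1 => x y t tI|exists H2 => x s t sI' tI]; rewrite !xxE//; [exact: h1|exact: h2].
- split; [exists H3 => x y t tI|exists H4 => x s t sI' tI]; rewrite !tE//; [exact: h3|exact: h4].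
Qed.

Local Notation solution := (classical_solution alpha d1 d2 c1 c2 z0).

(** Being a classical solution is local in time: each requirement concerns one time, nearby times,
    or a slab ending at some [T1 < T]. It can thus be checked on a solution that lives beyond that
    time. *)
Lemma classical_glue T u v : (0 < T)%E ->
  (forall t, 0 <= t -> (t%:E < T)%E -> exists T' u' v',
     [/\ (t%:E < T')%E, solution T' u' v', agree T' u u' & agree T' v v']) ->
  solution T u v.
Proof.
move=> T0 loc; split => //; split.
  have [T' [u' [v' [_ [T'0 [ini _]] uu' vv']]]] := loc 0 (lexx 0) T0.
  rewrite -ini; apply/funext => x.
  have I0 : time_interval T' 0 by split.
  by rewrite /slice (uu' x 0 I0) (vv' x 0 I0).
have sliceE T' u' v' t : agree T' u u' -> agree T' v v' -> time_interval T' t ->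
    slice u v t = slice u' v' t.
  by move=> uu' vv' tI; apply/funext => x; rewrite /slice uu'// vv'.
split.
  split=> [t [t0 tT]|t [t0 tT]].
    have [T' [u' [v' [tT' [_ [_ [[c1' _] _]]] uu' vv']]]] := loc t t0 tT.
    have tI : time_interval T' t by split.
    by rewrite (sliceE T' u' v')//; exact: c1'.
  have [T' [u' [v' [tT' [_ [_ [[_ c2'] _]]] uu' vv']]]] := loc t t0 tT.
  have tI : time_interval T' t by split.
  move=> N /(c2' t tI) N'.
  have {N'} : \forall s \near within (time_interval T') (nbhs t),
    N (sup_norm (slice u' v' s - slice u' v' t)%R) := N'.
  rewrite near_withinE => /nbhs_ballP[r r0 rP].
  have [q q0 qP] := lt_room tT'.
  suff : \forall s \near within (time_interval T) (nbhs t),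
    N (sup_norm (slice u v s - slice u v t)%R) by [].
  rewrite near_withinE; apply/nbhs_ballP; exists (Num.min r q) => /=; first by rewrite lt_min r0.
  move=> s; rewrite /ball/= lt_min => /andP[sr sq] [s0 _].
  have sI : time_interval T' s by split => //; apply: qP; rewrite distrC.
  by rewrite (sliceE T' u' v' s)// (sliceE T' u' v' t)//; exact: rP.
split.
  split=> x t t0 tT; have [T' [u' [v' [tT' [_ [_ [_ [[uC vC] _]]]] uu' vv']]]] := loc t (ltW t0) tT.
    exact: agree_C21 uu' uC t0 tT'.
  exact: agree_C21 vv' vC t0 tT'.
split.
  move=> x t t0 tT; have [T' [u' [v' [tT' [_ [_ [_ [_ [pde _]]]]] uu' vv']]]] := loc t (ltW t0) tT.
  have tI : time_interval T' t by split => //; exact: ltW.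
  rewrite (agree_dt uu' x t0 tT') (agree_dt vv' x t0 tT').
  rewrite (agree_dxx uu' x tI) (agree_dxx vv' x tI) (agree_dx uu' x tI) (agree_dx vv' x tI).
  by rewrite (uu' x t tI) (vv' x t tI); exact: pde.
split=> tau T1 tau0 tauT T1T; have T10 : 0 <= T1 by rewrite ltW// (lt_trans tau0).
  have [T' [u' [v' [tT' [_ [_ [_ [_ [_ [ur vr]]]]]] uu' vv']]]] := loc T1 T10 T1T.
  exact: agree_interior_regular uu' ur tau0 tauT tT'.
have [T' [u' [v' [tT' [_ [_ [_ [_ [_ [ur vr]]]]]] uu' vv']]]] := loc T1 T10 T1T.
exact: agree_interior_regular vv' vr tau0 tauT tT'.
Qed.

Record partial_solution := PartialSolution {
  lifespan : \bar R; fst_part : R -> R -> R; snd_part : R -> R -> R;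
  partial_solutionP : solution lifespan fst_part snd_part }.

Definition extends (p q : partial_solution) : Prop :=
  [/\ (lifespan p <= lifespan q)%E, agree (lifespan p) (fst_part q) (fst_part p) &
      agree (lifespan p) (snd_part q) (snd_part p)].

Lemma extends_trans p q r : extends p q -> extends q r -> extends p r.
Proof.
move=> [pq1 pq2 pq3] [qr1 qr2 qr3]; split; first exact: le_trans qr1.
- move=> x t tp; have [t0 tT] := tp; rewrite qr2 ?pq2//.
  by split => //; exact: lt_le_trans pq1.
- move=> x t tp; have [t0 tT] := tp; rewrite qr3 ?pq3//.
  by split => //; exact: lt_le_trans pq1.
Qed.

(** The upper bound is the union of the chain. At each time a member still alive there is chosen;
    two members alive at the same time agree, so the choice is immaterial. Times beyond all
    lifespans receive the default [p0]. *)
Lemma chain_bound (A : set partial_solution) (p0 : partial_solution) : A p0 ->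
  (forall p q, A p -> A q -> extends p q \/ extends q p) ->
  exists q, forall p, A p -> extends p q.
Proof.
move=> Ap0 tot; pose S := ereal_sup [set lifespan p | p in A].
have leS p : A p -> (lifespan p <= S)%E.
  by move=> Ap; apply: ereal_sup_ubound; exists p.
have /choice[P PP] : forall t, exists p, A p /\
    ((exists2 q, A q & (t%:E < lifespan q)%E) -> (t%:E < lifespan p)%E).
  move=> t; have [[q Aq tq]|nq] := pselect (exists2 q, A q & (t%:E < lifespan q)%E).
    by exists q.
  by exists p0.
pose u x t := fst_part (P t) x t; pose v x t := snd_part (P t) x t.
have uE q : A q -> agree (lifespan q) u (fst_part q).
  move=> Aq x t [t0 tq]; have [APt /(_ _)tP] := PP t.
  have {}tP : (t%:E < lifespan (P t))%E by apply: tP; exists q.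
  have [[_ H _]|[_ H _]] := tot _ _ APt Aq; first by rewrite /u -H.
  by rewrite /u H.
have vE q : A q -> agree (lifespan q) v (snd_part q).
  move=> Aq x t [t0 tq]; have [APt tP] := PP t.
  have {}tP : (t%:E < lifespan (P t))%E by apply: tP; exists q.
  have [[_ _ H]|[_ _ H]] := tot _ _ APt Aq; first by rewrite /v -H.
  by rewrite /v H.
have sol : solution S u v.
  apply: classical_glue.
    by apply: lt_le_trans (leS _ Ap0); have [] := partial_solutionP p0.
  move=> t t0 /ereal_sup_gt[_ [q Aq <-] tq].
  exists (lifespan q), (fst_part q), (snd_part q); split => //.
  - exact: partial_solutionP.
  - exact: uE.
  - exact: vE.
exists (PartialSolution sol) => p Ap; split => //=; [exact: leS|exact: uE|exact: vE].
Qed.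

(** Extension is only a preorder, because values after the lifespan are arbitrary. A maximal element
    may thus have proper extensions, but each of them is extended back by it, which forbids a longer
    lifespan. *)
Lemma maximal_extension T u v : solution T u v ->
  exists T' u' v', maximal_classical_solution alpha d1 d2 c1 c2 z0 T' u' v'.
Proof.
move=> sol; pose p0 := PartialSolution sol.
have [||A Atot|p pmax] := @ZL_preorder _ p0 (fun p q => `[< extends p q >]).
- by move=> p; apply/asboolP; split.
- move=> p q r /asboolP pq /asboolP qr; apply/asboolP; exact: extends_trans qr.
- have [[p Ap]|nA] := pselect (exists p, A p); last first.
    by exists p0 => p Ap; exfalso; apply: nA; exists p.
  have [q qP] := @chain_bound A p Ap (fun r q Ar Aq =>
    match Atot r q Ar Aq with or_introl h => or_introl (asboolW h) | or_intror h => or_intror (asboolW h) end).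
  by exists q => r Ar; apply/asboolP; exact: qP.
exists (lifespan p), (fst_part p), (snd_part p); split; first exact: partial_solutionP.
move=> [T' [u' [v' [TT' sol' ext]]]].
have /pmax/asboolP[] : `[< extends p (PartialSolution sol') >].
  apply/asboolP; split=> /=; first exact: ltW.
    by move=> x t tI; have := congr1 (fun h => (h x).1) (ext t tI).
  by move=> x t tI; have := congr1 (fun h => (h x).2) (ext t tI).
by move=> /= T'T; rewrite ltNge T'T in TT'.
Qed.

End maximal_solutions.

(** * Instability *)

Section gaussian_data.
Context {R : realType}.
Implicit Types (p : {poly R}) (x M A : R).

Lemma poly_growth p : exists C : R, exists n : nat,
  forall x, `|p.[x]| <= C * (1 + x ^+ 2) ^+ n.
Proof.
elim/poly_ind: p => [|p a [C [n CP]]].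
  by exists 0, 0%N => x; rewrite horner0 normr0 mul0r.
exists (C + `|a|), n.+1 => x; rewrite hornerD hornerM hornerX hornerC.
have q1 : 1 <= 1 + x ^+ 2 by rewrite lerDl sqr_ge0.
have xq : `|x| <= 1 + x ^+ 2.
  by have := sqr_ge0 (`|x| - 1); rewrite -[x ^+ 2]real_normK ?num_real//; nra.
rewrite (le_trans (ler_normD _ _))// mulrDl lerD//.
  rewrite normrM exprSr mulrA; apply: ler_pM => //.
by rewrite ler_peMr// exprn_ege1.
Qed.

(** From [1 + x^2 <= N exp (x^2 / N)] with [N = (n + 1) M], the power [n] grows at most like
    [exp (n x^2 / N)], which the Gaussian absorbs because [n / N <= 1 / M]. *)
Lemma poly_gaussian_bounded p M : 1 <= M -> exists B : R,
  forall x, `|p.[x] * expR (- (x ^+ 2 / M))| <= B.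
Proof.
move=> M1; have [C [n CP]] := poly_growth p.
have M0 : 0 < M by lra.
have C0 : 0 <= C by have := CP 0; rewrite expr0n/= addr0 expr1n mulr1; exact: le_trans.
pose N : R := n.+1%:R * M; have N1 : 1 <= N.
  by rewrite /N; have : 1 <= n.+1%:R :> R by [rewrite ler1n|]; nra.
have N0 : 0 < N by lra.
exists (C * N ^+ n) => x; rewrite normrM (ger0_norm (expR_ge0 _)).
have e0 := expR_gt0 (- (x ^+ 2 / M)).
apply: (@le_trans _ _ (C * (1 + x ^+ 2) ^+ n * expR (- (x ^+ 2 / M)))).
  by rewrite ler_wpM2r// ltW.
rewrite -mulrA ler_wpM2l// expRN ler_pdivrMr ?expR_gt0//.
have b1 : 1 + x ^+ 2 <= N * expR (x ^+ 2 / N).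
  apply: (@le_trans _ _ (N * (1 + x ^+ 2 / N))).
    by rewrite mulrDr mulr1 mulrCA divff ?gt_eqF// mulr1 lerD2r.
  by rewrite ler_wpM2l ?(ltW N0)// expR_ge1Dx.
apply: (@le_trans _ _ ((N * expR (x ^+ 2 / N)) ^+ n)).
  rewrite lerXn2r ?nnegrE// ?addr_ge0 ?sqr_ge0// mulr_ge0 ?expR_ge0//; exact: ltW.
rewrite exprMn ler_wpM2l ?exprn_ge0 ?(ltW N0)// -expRM_natl ler_expR.
have -> : n%:R * (x ^+ 2 / N) = n%:R / n.+1%:R * (x ^+ 2 / M).
  by rewrite /N; field; rewrite !gt_eqF ?ltr0n.
rewrite ler_piMl//.
  by rewrite divr_ge0 ?sqr_ge0// ltW.
by rewrite ler_pdivrMr ?ltr0n// mul1r ler_nat.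
Qed.

(** Polynomial factors of the derivatives of [A exp (- x^2 / M)]: rescaled Hermite polynomials up to
    sign and normalisation. *)
Fixpoint hermite M A (k : nat) : {poly R} :=
  if k is j.+1 then (hermite M A j)^`() - (2 / M) *: ('X * hermite M A j) else A%:P.

Definition gaussian_jet M A (k : nat) x : R := (hermite M A k).[x] * expR (- (x ^+ 2 / M)).

Lemma gaussian_is_jet M A : is_jet (gaussian_jet M A).
Proof.
move=> k x; rewrite /gaussian_jet.
have dl : is_derive x 1 (fun y : R => - (y ^+ 2 / M)) (- (2 * x / M)).
  by apply: is_derive_eq; rewrite /GRing.scale/= /cst; ring.
have dE := is_derive_compose (g := fun y => - (y ^+ 2 / M)) (is_derive_expR _) dl.
have dp := is_derive_poly (hermite M A k) x.
apply: (is_derive_eq (is_deriveM dp dE)).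
by rewrite /GRing.scale/= hornerD hornerN hornerZ hornerM hornerX; ring.
Qed.

Lemma gaussian_jet_bounded M A n : 1 <= M -> exists B : R,
  forall k x, (k <= n)%N -> `|gaussian_jet M A k x| <= B.
Proof.
move=> M1; elim: n => [|n [B BP]].
  have [B BP] := poly_gaussian_bounded (hermite M A 0) M1.
  by exists B => k x; rewrite leqn0 => /eqP->; exact: BP.
have [B' BP'] := poly_gaussian_bounded (hermite M A n.+1) M1.
exists (Num.max B B') => k x; rewrite leq_eqVlt => /predU1P[->|].
  by rewrite le_max; apply/orP; right; exact: BP'.
by rewrite ltnS le_max => kn; apply/orP; left; exact: BP.
Qed.

Lemma jet_holder_space (alpha B : R) (f : nat -> R -> R) : 0 < alpha -> alpha <= 1 ->
  is_jet f -> (forall k x, (k <= 1)%N -> `|f k x| <= B) ->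
  holder_space alpha (fun x => (f 0%N x, 0)).
Proof.
move=> a0 a1 fJ fB; have B0 : 0 <= B by exact: le_trans (fB 0%N 0 isT).
have eE (p q : R) : euclid ((p, 0) - (q, 0)) = `|p - q|.
  by rewrite /euclid/= subrr expr0n/= addr0 sqrtr_sqr.
split.
  apply: (@le_lt_trans _ _ B%:E); last by rewrite ltry.
  apply: sup_norm_le => x; rewrite lee_fin.
  by have := eE (f 0%N x) 0; rewrite !subr0 => ->; exact: fB.
exists (2 * B) => x y; rewrite eE.
apply: (holder_of_lipschitz a0 a1 B0 (normr_ge0 _)).
  by apply: jet_lipschitz => // z; exact: fB.
rewrite (le_trans (ler_normB _ _))//.
by have := fB 0%N x isT; have := fB 0%N y isT; lra.
Qed.

End gaussian_data.

(** The Gaussian is the reciprocal of the weight, so the weighted length of the data is constant,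
    equal to [A = delta / 2]. The second component starts at 0, and the growth estimate covers such
    data. *)
Lemma gaussian_instability (R : realType) (alpha d1 d2 c1 c2 M : R) :
  0 < alpha -> alpha < 1 -> 0 < d1 -> 0 < d2 -> 1 <= M ->
  nonlinearly_unstable alpha d1 d2 c1 c2 (gaussian_weight M).
Proof.
move=> a0 a1 d10 d20 M1; exists 1 => // delta delta0.
pose A := delta / 2; have A0 : 0 < A by rewrite divr_gt0.
have [B BP] := gaussian_jet_bounded A 6 M1.
pose u0 := gaussian_jet M A 0; pose v0 : R -> R := fun=> 0.
have u0E x : u0 x = A * expR (- (x ^+ 2 / M)) by rewrite /u0 /gaussian_jet hornerC.
have u00 x : 0 <= u0 x by rewrite u0E mulr_ge0 ?expR_ge0// ltW.
have hs : holder_space alpha (fun x => (u0 x, v0 x)).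
  apply: jet_holder_space (ltW a1) (gaussian_is_jet M A) _ => // k x k1.
  by apply: BP; rewrite (leq_trans k1).
have wn x : euclid (u0 x, v0 x) * gaussian_weight M x = A.
  rewrite /euclid/= expr0n/= addr0 sqrtr_sqr ger0_norm// u0E /gaussian_weight.
  by rewrite -mulrA -expRD addNr expR0 mulr1.
have wnA : (weighted_norm (gaussian_weight M) (fun x => (u0 x, v0 x)) <= A%:E)%E.
  by apply: ge_ereal_sup => _ [x _ <-]; rewrite wn.
exists (fun x => (u0 x, v0 x)); split.
- by split => //; apply: le_lt_trans wnA _; rewrite ltry.
- by apply: le_lt_trans wnA _; rewrite lte_fin /A; lra.
have zJ : is_jet (fun _ : nat => v0) by move=> k x; exact: is_derive_cst.
have [|T0 [u1 [v1 sol1]]] := @local_existence R alpha d1 d2 c1 c2 (gaussian_jet M A)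
  (fun=> v0) B a0 (ltW a1) d10 d20 (gaussian_is_jet M A) zJ.
  move=> k x k6; split; first exact: BP.
  by rewrite normr0; exact: le_trans (BP 0%N 0 isT).
have [T [u [v umax]]] := maximal_extension sol1.
exists T, u, v; split => //; have [sol _] := umax.
have [Ty|Tn] := pselect (T = +oo%E); last by left; rewrite lt_neqAle leey andbT; apply/eqP.
right; have nz : (fun x => (u0 x, v0 x)) <> (fun=> (0, 0)).
  move=> /(congr1 (fun h => (h 0).1)) /=; rewrite u0E; apply/eqP.
  by rewrite gt_eqF// mulr_gt0 ?expR_gt0.
have [k k0 kP] := classical_growth c1 c2 a0 d10 d20 hs nz u00 (fun=> lexx 0).
(* At this time the lower bound [k ln (1 + t)] equals 2, which exceeds the threshold 1. *)
pose t := expR (2 / k) - 1.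
have t0 : 0 <= t by rewrite subr_ge0 -expR0 ler_expR divr_ge0// ltW.
have tT : (t%:E < T)%E by rewrite Ty ltry.
have [kt _] := kP T u v sol t t0 tT.
exists t => //; apply: lt_le_trans kt.
rewrite lte_fin /t addrC subrK expRK mulrCA divff ?gt_eqF// mulr1.
by rewrite ltr1n.
Qed.

Theorem theorem1p4 (R : realType) (alpha d1 d2 c1 c2 : R)
    (halpha0 : 0 < alpha) (halpha1 : alpha < 1) (hd1 : 0 < d1) (hd2 : 0 < d2) :
  (forall u0 v0 : R -> R,
     holder_space alpha (fun x => (u0 x, v0 x)) ->
     (fun x => (u0 x, v0 x)) <> (fun=> (0, 0)) ->
     (forall x, 0 <= u0 x) -> (forall x, 0 <= v0 x) ->
     exists2 c : R, 0 < c &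
       forall (T : \bar R) (u v : R -> R -> R),
         maximal_classical_solution alpha d1 d2 c1 c2
           (fun x => (u0 x, v0 x)) T u v ->
         forall t : R, 0 <= t -> (t%:E < T)%E ->
           ((c * ln (1 + t))%:E <= sup_norm (slice u v t))%E /\
           ((c * t)%:E <= L1_norm (slice u v t))%E) /\
  (forall M : R, 1 <= M ->
     nonlinearly_unstable alpha d1 d2 c1 c2 (gaussian_weight M)).
Proof.
split=> [u0 v0 hs nz u00 v00|M M1]; last exact: gaussian_instability.
have [k k0 kP] := classical_growth c1 c2 halpha0 hd1 hd2 hs nz u00 v00.
by exists k => // T u v [sol _]; exact: kP.
Qed.
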